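(* Let $T_\lambda=\sum_{i=0}^k Q_i(z)\lambda^{k-i}\frac{d^i}{dz^i}$ be a homogenized spectral pencil of general type whose characteristic equation has $k$ distinct roots $\alpha_1,\dots,\alpha_k$, and let $\lambda_{n,j}$, $p_{n,j}(z)$ ($j=1,\dots,k$, $n$ sufficiently large) be its eigenvalues and polynomial eigenfunctions, labeled so that $\lim_{n\to\infty}\lambda_{n,j}/n=\alpha_j$. Then for every $j=1,\dots,k$ there exists a subsequence $\{n_{i,j}\}$, $i=1,2,\dots$, of the positive integers such that the limits $$\Psi_j(z):=\lim_{i\to\infty}\frac{p_{n_{i,j},j}'(z)}{\lambda_{n_{i,j},j}\,p_{n_{i,j},j}(z)},\qquad j=1,\dots,k,$$ exist almost everywhere in $\mathbb{C}$ and are analytic functions in some neighborhood of $\infty$. Each $\Psi_j(z)$ satisfies $\sum_{i=0}^k Q_i(z)\Psi_j^i(z)=0$ almost everywhere in $\mathbb{C}$, and the functions $\Psi_1(z),\dots,\Psi_k(z)$ are independent sections of the curve $\Gamma=\{\sum_{i=0}^kQ_i(z)w^i=0\}$, considered as a branched covering over $\mathbb{CP}^1$ (with coordinate $z$), in a sufficiently small neighborhood of $\infty$.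
   Context: A homogenized spectral pencil is a family $T_\lambda=\sum_{i=0}^k Q_i(z)\lambda^{k-i}\frac{d^i}{dz^i}$, $\lambda\in\mathbb{C}$, where each $Q_i(z)=\sum_{j=0}^i a_{i,j}z^j$ is a complex polynomial of degree at most $i$. Its characteristic equation is $a_{k,k}+a_{k-1,k-1}t+\dots+a_{0,0}t^k=0$. Its associated plane curve $\Gamma$ is given by $\sum_{i=0}^k Q_i(z)w^i=0$. The pencil is of general type if (i) $\deg Q_k=k$ (i.e. $a_{k,k}\neq0$), and (ii) no two roots of the characteristic equation lie on a line through the origin (in particular, $0$ is not a root). An eigenvalue is a value of $\lambda$ for which $T_\lambda p=0$ has a nonzero polynomial solution $p$, called an eigenpolynomial (polynomial eigenfunction). If the pencil is of general type and its characteristic equation has $k$ distinct roots $\alpha_1,\dots,\alpha_k$ (so $a_{0,0}\ne0$), then for all sufficiently large $n$ there are exactly $k$ distinct eigenvalues $\lambda_{n,1},\dots,\lambda_{n,k}$ for which there is an eigenpolynomial of degree exactly $n$, and they can be labeled so that $\lim_{n\to\infty}\lambda_{n,j}/n=\alpha_j$. For such $n$, $p_{n,j}(z)$ denotes a polynomial of degree exactly $n$ with $T_{\lambda_{n,j}}p_{n,j}=0$. ''Independent sections of $\Gamma$ near $\infty$'' means that $\Psi_1,\dots,\Psi_k$ are the $k$ pairwise distinct branches of the $k$-sheeted covering $\Gamma\to\mathbb{CP}^1$ near $z=\infty$. Almost everywhere refers to Lebesgue measure. *)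

(* Defs.v *)
(* MathComp / MathComp-Analysis, with R[i] for the complex numbers. The
   library topologizes R[i] as the normed module R[i]^o over itself, so
   limits and (complex) derivability are taken in R[i]^o. *)
From HB Require Import structures.
From mathcomp Require Import all_boot all_order all_algebra.
From mathcomp Require Import complex.
From mathcomp Require Import all_classical all_reals all_analysis.

Set Implicit Arguments.
Unset Strict Implicit.
Unset Printing Implicit Defensive.

Import Order.TTheory GRing.Theory Num.Theory.
Import numFieldNormedType.Exports.

Local Open Scope classical_set_scope.
Local Open Scope complex_scope.
Local Open Scope ring_scope.

Definition homogenized_pencil (R : realType) (k : nat)
    (Q : 'I_k.+1 -> {poly R[i]}) : Prop :=
  forall i : 'I_k.+1, (size (Q i) <= i.+1)%N.

Definition pencil_op (R : realType) (k : nat) (Q : 'I_k.+1 -> {poly R[i]})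
    (l : R[i]) (p : {poly R[i]}) : {poly R[i]} :=
  \sum_(i < k.+1) l ^+ (k - i) *: (Q i * p^`(i)).

Definition characteristic (R : realType) (k : nat)
    (Q : 'I_k.+1 -> {poly R[i]}) : {poly R[i]} :=
  \sum_(i < k.+1) (Q i)`_i *: 'X^(k - i).

Definition on_line_through_origin (R : realType) (s t : R[i]) : Prop :=
  exists2 u : R[i], u != 0 & exists a b : R, s = a%:C * u /\ t = b%:C * u.

(* The first clause makes 0 a non-root of the characteristic polynomial, whose
   constant term is the coefficient of z^k in [Q ord_max]. *)
Definition general_type (R : realType) (k : nat)
    (Q : 'I_k.+1 -> {poly R[i]}) : Prop :=
  size (Q ord_max) = k.+1 /\
  forall s t : R[i], root (characteristic Q) s -> root (characteristic Q) t ->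
    s != t -> ~ on_line_through_origin s t.

Definition eigenpolynomial (R : realType) (k : nat)
    (Q : 'I_k.+1 -> {poly R[i]}) (l : R[i]) (p : {poly R[i]}) : Prop :=
  p != 0 /\ pencil_op Q l p = 0.

Definition eigenvalue_of_degree (R : realType) (k : nat)
    (Q : 'I_k.+1 -> {poly R[i]}) (n : nat) (l : R[i]) : Prop :=
  exists p : {poly R[i]}, eigenpolynomial Q l p /\ size p = n.+1.

Definition plane_curve (R : realType) (k : nat) (Q : 'I_k.+1 -> {poly R[i]})
    (z w : R[i]) : Prop :=
  \sum_(i < k.+1) (Q i).[z] * w ^+ i = 0.

(* Almost everywhere for planar Lebesgue measure, with R[i] identified with
   R * R through real and imaginary parts. *)
Definition ae_complex (R : realType) (P : R[i] -> Prop) : Prop :=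
  \forall xy \ae (@lebesgue_measure R \x @lebesgue_measure R)%E,
    P (xy.1 +i* xy.2).

Definition near_infinity (R : realType) (P : R[i] -> Prop) : Prop :=
  exists r : R, forall z : R[i], r%:C < `|z| -> P z.

(* Analyticity on a neighbourhood of the point at infinity of CP^1, including
   that point: in the chart w = 1/z, f coincides off w = 0 with a function
   that is complex differentiable on a full neighbourhood of 0. *)
Definition analytic_near_infinity (R : realType) (f : R[i] -> R[i]) : Prop :=
  exists g : R[i]^o -> R[i]^o,
    (\forall w \near (0 : R[i]^o), derivable g w 1) /\
    near_infinity (fun z => f z = g z^-1).

(* "The limit of the quotients p_m'(z) / (l_m p_m(z)) exists and equals x".
   Division being total, the first clause requires the quotients to be
   genuinely defined from some rank on. *)
Definition logderiv_limit (R : realType) (l : nat -> R[i])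
    (p : nat -> {poly R[i]}) (z x : R[i]) : Prop :=
  (\forall m \near \oo, l m * (p m).[z] != 0) /\
  (fun m => (p m)^`().[z] / (l m * (p m).[z]) : R[i]^o) @ \oo --> (x : R[i]^o).

(* Over every point z close enough to infinity, Psi_1(z), ..., Psi_k(z) are
   pairwise distinct and exhaust the fibre of the curve: together with their
   analyticity, they are the k different branches of the covering. *)
Definition independent_sections_near_infinity (R : realType) (k : nat)
    (Q : 'I_k.+1 -> {poly R[i]}) (Psi : 'I_k -> R[i] -> R[i]) : Prop :=
  (forall j : 'I_k, analytic_near_infinity (Psi j)) /\
  near_infinity (fun z =>
    injective (fun j => Psi j z) /\
    forall w : R[i], plane_curve Q z w <-> exists j : 'I_k, w = Psi j z).

(* Main.v *)
Require Import Defs.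
From HB Require Import structures.
From mathcomp Require Import all_boot all_order all_algebra.
From mathcomp Require Import complex.
From mathcomp Require Import all_classical all_reals all_analysis.
From mathcomp Require Import measurable_realfun.
From mathcomp Require Import ring lra zify.

Set Implicit Arguments.
Unset Strict Implicit.
Unset Printing Implicit Defensive.

Import Order.TTheory GRing.Theory Num.Theory.
Import numFieldNormedType.Exports.

Local Open Scope classical_set_scope.
Local Open Scope complex_scope.
Local Open Scope ring_scope.

(** Write [p] for an eigenpolynomial of degree n, [l] for its eigenvalue and
    f = p' / (l p). Divided by l^k p, the equation [pencil_op Q l p = 0] is the
    equation of the curve in which each power f^i is replaced by
    p^(i) / (l^i p). By Newton's identities the two differ by at most a constant
    times the sum of |l (z - x)|^-2 over the zeros x of p, as long as f stays
    bounded ([revprod_coef_approx], [logderiv_near_curve]). So a limit of the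
    f's lies on the curve wherever this sum tends to 0.

    Boundedness of the zeros. This is where general type enters. Near infinity
    z f(z) is a power series in 1/z whose coefficients v_r are the power sums of
    the zeros divided by l, and the differential equation becomes a Riccati-like
    recursion for them ([hierarchy_eq0]). With y_m = 1 / alpha_m, the factor of
    v_r in the equation of order r is, in the limit, the leading coefficient of
    Q_k times the product of the y_j t - y_m over m distinct from j, where
    t = 1 - r/n. As t is real and no two characteristic roots lie on a line
    through the origin, no factor vanishes and the product is at least
    c (1 + r/n)^(k-1) ([divdiff_ge]). That power pays exactly for the k - 1
    Euler derivatives of the nonlinear terms, so a majorant argument bounds v_r
    by rho^-r, with rho independent of n ([majorant]). Power sums bounded in
    this way force all the zeros into the disc of radius 1/rho
    ([psum_root_bound], [roots_bounded]).

    Almost everywhere convergence. Up to the convergent factor n/l, f is the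
    mean of the 1/(z - x) ([cauchy]). The function |z - x|^(-3/2) is integrable
    on every box, uniformly in x ([integral_kern]), and it controls the
    variation of 1/(z - x) when x moves ([inv_diff_kern]). As the zeros are
    bounded, rounding the proportions of zeros in the cells of a finite net thus
    leaves finitely many classes of f's up to a small error in the mean
    ([finite_code]); a diagonal extraction makes successive differences
    summable, and the limit exists almost everywhere ([ae_cauchy_limit]).
    Similarly, n^(-3/2) times the sum of the |z - x|^(-3/2) has a mean of order
    n^(-1/2); it tends to 0 almost everywhere along a sparse subsequence, and it
    controls the sum of the squares |z - x|^-2 divided by n^2
    ([sqsum_le_kern]). Hence the limit lies on the curve.

    Near infinity. In the chart s = 1/z, w = s u the curve has the k distinct
    points u = y_j over s = 0, so its sheets stay in disjoint discs around them
    ([chart_branches]) and are differentiable ([branch_derivable]). For |z|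
    large, z f(z) is close to n/l, hence to y_j, and it almost satisfies the
    equation of the curve; so it converges to the sheet through y_j
    ([branch_limit]). Distinct j give distinct sheets, and there are k of
    them. *)

(** * The modulus as a real number *)

Definition cabs (R : rcfType) (z : R[i]) : R := Normc.normc z.
Arguments cabs : simpl never.

Section Cabs.
Variable R : rcfType.
Implicit Types (x y z : R[i]).

Lemma normE z : `|z| = (cabs z)%:C. Proof. by []. Qed.

Lemma cabs0 : cabs (0 : R[i]) = 0. Proof. exact: Normc.normc0. Qed.
Lemma cabs1 : cabs (1 : R[i]) = 1. Proof. exact: Normc.normc1. Qed.
Lemma cabsM x y : cabs (x * y) = cabs x * cabs y. Proof. exact: Normc.normcM. Qed.
Lemma cabsV x : cabs x^-1 = (cabs x)^-1. Proof. exact: Normc.normcV. Qed.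
Lemma cabsN x : cabs (- x) = cabs x. Proof. exact: normcN. Qed.
Lemma cabs_ge0 x : 0 <= cabs x.
Proof. by rewrite -ler0c -normE. Qed.
Lemma cabsD x y : cabs (x + y) <= cabs x + cabs y. Proof. exact: le_normcD. Qed.
Lemma cabsC x y : cabs (x - y) = cabs (y - x).
Proof. by rewrite -opprB cabsN. Qed.
Lemma cabsB x y : cabs (x - y) <= cabs x + cabs y.
Proof. by rewrite -[cabs y]cabsN cabsD. Qed.
Lemma cabsBge x y : cabs x - cabs y <= cabs (x - y).
Proof. by rewrite lerBlDr; apply: le_trans (cabsD _ _); rewrite subrK. Qed.
Lemma cabs_eq0 x : (cabs x == 0) = (x == 0).
Proof. by apply/eqP/eqP => [/Normc.eq0_normc|->//]; rewrite ?cabs0. Qed.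
Lemma cabs_gt0 x : (0 < cabs x) = (x != 0).
Proof. by rewrite lt0r cabs_ge0 andbT cabs_eq0. Qed.
Lemma cabsX x n : cabs (x ^+ n) = cabs x ^+ n.
Proof. by elim: n => [|n IH]; rewrite ?expr0 ?cabs1// !exprS cabsM IH. Qed.
Lemma cabs_real (a : R) : cabs a%:C = `|a|.
Proof. by rewrite /cabs /= expr0n/= addr0 sqrtr_sqr. Qed.
Lemma cabs_nat n : cabs (n%:R : R[i]) = n%:R.
Proof. by rewrite -(rmorph_nat (real_complex R)) cabs_real ger0_norm. Qed.
Lemma cabs_sum (I : Type) (r : seq I) (P : pred I) (F : I -> R[i]) :
  cabs (\sum_(i <- r | P i) F i) <= \sum_(i <- r | P i) cabs (F i).
Proof.
elim/big_rec2: _ => [|i x y _ h]; first by rewrite cabs0.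
by apply: le_trans (cabsD _ _) _; rewrite lerD2l.
Qed.
Lemma cabs_prod (I : Type) (r : seq I) (P : pred I) (F : I -> R[i]) :
  cabs (\prod_(i <- r | P i) F i) = \prod_(i <- r | P i) cabs (F i).
Proof. by apply: (big_morph (@cabs R)); [exact: cabsM|exact: cabs1]. Qed.
Lemma cabs_div x y : cabs (x / y) = cabs x / cabs y.
Proof. by rewrite cabsM cabsV. Qed.
Lemma Re_le_cabs z : `|complex.Re z| <= cabs z.
Proof. by rewrite -lecR; exact: normc_ge_Re. Qed.
Lemma Im_le_cabs z : `|complex.Im z| <= cabs z.
Proof.
case: z => a b; rewrite /cabs /= -[leLHS]sqrtr_sqr.
by apply: ler_wsqrtr; rewrite lerDr sqr_ge0.
Qed.
Lemma cabs_le_ReIm z : cabs z <= `|complex.Re z| + `|complex.Im z|.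
Proof.
rewrite {1}[z]complexE; apply: le_trans (cabsD _ _) _.
rewrite cabsM !cabs_real.
by rewrite {1}/cabs /= expr0n expr1n add0r sqrtr1 mul1r.
Qed.
End Cabs.

(** * Newton's identities and almost-multiplicativity of derivatives *)

Section Newton.
Variable C : fieldType.

Definition revprod (s : seq C) : {poly C} := \prod_(z <- s) (1 - z *: 'X).
Definition psum (s : seq C) (j : nat) : C := \sum_(z <- s) z ^+ j.

Lemma revprod_cons z s : revprod (z :: s) = (1 - z *: 'X) * revprod s.
Proof. by rewrite /revprod big_cons. Qed.

Lemma psum0 s : psum s 0 = (size s)%:R.
Proof.
rewrite /psum; under eq_bigr do rewrite expr0.
by rewrite big_const_seq count_predT iter_addr_0.
Qed.

Lemma coef0_revprod s : (revprod s)`_0 = 1.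
Proof.
elim: s => [|z s IH]; first by rewrite /revprod big_nil coefC.
by rewrite revprod_cons coef0M IH coefB coefZ coefX coef1 mulr0 subr0 mulr1.
Qed.

(** The logarithmic derivative of [revprod s] is minus the generating series of
    the power sums; truncating that series at [M] only costs a multiple of
    ['X^M]. *)
Lemma newton s M :
  'X^M %| (revprod s)^`() + revprod s * \poly_(j < M) psum s j.+1.
Proof.
elim: s => [|z s IH].
  rewrite /revprod !big_nil derivC add0r mul1r.
  rewrite (_ : \poly_(j < M) _ = 0) ?dvdp0//.
  by apply/polyP=> i; rewrite coef_poly coef0 /psum big_nil if_same.
rewrite revprod_cons.
pose G := \poly_(j < M) z ^+ j.
have -> : \poly_(j < M) psum (z :: s) j.+1 = z *: G + \poly_(j < M) psum s j.+1.
  apply/polyP=> i; rewrite coefD coefZ !coef_poly; case: ifP => _.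
    by rewrite /psum big_cons exprS.
  by rewrite mulr0 addr0.
have hG : (1 - z *: 'X) * G = 1 - (z ^+ M) *: 'X^M.
  have -> : (z ^+ M) *: 'X^M = (z *: 'X : {poly C}) ^+ M by rewrite exprZn.
  rewrite -{2}[1](expr1n _ M) subrXX; congr (_ * _).
  rewrite /G poly_def; apply: eq_bigr => i _.
  by rewrite expr1n mul1r exprZn.
rewrite derivM derivB derivC derivZ derivX.
have -> : (0 - z *: 1) * revprod s + (1 - z *: 'X) * (revprod s)^`() +
  (1 - z *: 'X) * revprod s * (z *: G + \poly_(j < M) psum s j.+1) =
  (1 - z *: 'X) * ((revprod s)^`() + revprod s * \poly_(j < M) psum s j.+1)
  + z *: (revprod s * ((1 - z *: 'X) * G - 1)).
  by rewrite -!mul_polyC; ring.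
apply: dvdp_add; first exact: dvdp_mull.
rewrite hG addrAC subrr add0r -!mul_polyC.
by apply/dvdp_mull/dvdp_mull; rewrite dvdpNr dvdp_mull.
Qed.

Lemma newton_coef s i :
  (revprod s)`_i.+1 *+ i.+1 = - \sum_(j < i.+1) psum s j.+1 * (revprod s)`_(i - j).
Proof.
have /dvdpP [q hq] := newton s i.+1.
have /(congr1 (fun p : {poly C} => p`_i)) := hq.
rewrite coefMXn ltnS leqnn coefD coef_deriv mulrC coefM => /eqP.
rewrite addr_eq0 => /eqP ->; congr (- _); apply: eq_bigr => j _.
by rewrite coef_poly ltn_ord.
Qed.
End Newton.

Section ScaledDerivatives.
Variable R : rcfType.
Local Notation C := R[i].
Implicit Types (s : seq C) (z l : C).

Definition sqsum s : R := \sum_(z <- s) cabs z ^+ 2.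

Lemma sqsum_ge0 s : 0 <= sqsum s.
Proof. by apply: sumr_ge0 => z _; rewrite exprn_ge0 ?cabs_ge0. Qed.

Lemma cabs_psum_le s j : sqsum s <= 1 -> cabs (psum s j.+2) <= sqsum s.
Proof.
move=> s1; apply: le_trans (cabs_sum _ _ _) _.
rewrite big_seq [leRHS]big_seq; apply: ler_sum => z zs.
have z1 : cabs z <= 1.
  rewrite -(@ler_pXn2r _ 2) ?nnegrE ?cabs_ge0// expr1n; apply: le_trans s1.
  rewrite /sqsum (big_rem z zs)/= lerDl.
  by apply: sumr_ge0 => ? _; rewrite exprn_ge0 ?cabs_ge0.
rewrite cabsX -addn2 exprD ler_piMl ?exprn_ge0 ?cabs_ge0//.
by rewrite exprn_ile1 ?cabs_ge0.
Qed.

(** In Newton's recursion only the first power sum is of order one: the others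
    are bounded by the sum of the squares. Hence i! times the i-th elementary
    symmetric function is the i-th power of the sum, up to that error. *)
Lemma revprod_coef_approx (B : R) (i : nat) : 1 <= B ->
  exists2 c : R, 0 <= c & forall s, cabs (psum s 1) <= B -> sqsum s <= 1 ->
    forall m, (m <= i)%N ->
    cabs ((revprod s)`_m *+ m`! - (- psum s 1) ^+ m) <= c * sqsum s.
Proof.
move=> B1; have B0 : 0 <= B by apply: le_trans B1.
elim: i => [|i [c c0 IH]].
  exists 0 => // s _ _ [|//] _.
  by rewrite coef0_revprod fact0 mulr1n expr0 subrr cabs0 mul0r.
exists (c + (B * c + i`!%:R * (i%:R * (B ^+ i + c)))).
  have ? : 0 <= B ^+ i by rewrite exprn_ge0.
  by rewrite !(addr_ge0, mulr_ge0)// addr_ge0.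
move=> s sB s1 m; have s0 := sqsum_ge0 s.
have cX : 0 <= B * c + i`!%:R * (i%:R * (B ^+ i + c)).
  have ? : 0 <= B ^+ i by rewrite exprn_ge0.
  by rewrite !(addr_ge0, mulr_ge0)// addr_ge0.
rewrite leq_eqVlt => /orP[/eqP ->{m}|]; last first.
  rewrite ltnS => mi; apply: le_trans (IH s sB s1 m mi) _.
  by rewrite ler_wpM2r// lerDl.
have bd m : (m <= i)%N -> cabs (revprod s)`_m <= B ^+ i + c.
  move=> mi; have h := IH s sB s1 m mi.
  have h2 : cabs ((revprod s)`_m *+ m`!) <= B ^+ i + c.
    rewrite -[X in cabs X](subrK ((- psum s 1) ^+ m)).
    apply: le_trans (cabsD _ _) _; rewrite addrC lerD//.
      rewrite cabsX cabsN; apply: (@le_trans _ _ (B ^+ m)).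
        by rewrite lerXn2r// ?nnegrE ?cabs_ge0.
      by rewrite ler_weXn2l.
    by apply: le_trans h _; rewrite ler_piMr.
  apply: le_trans h2; rewrite -[_ *+ m`!]mulr_natr cabsM cabs_nat.
  by rewrite ler_peMr ?cabs_ge0// ler1n fact_gt0.
rewrite factS mulrnA newton_coef big_ord_recl /= subn0 mulNrn mulrnDl.
set T := \sum_(_ < _) _.
have -> : - (psum s 1 * (revprod s)`_i *+ i`! + T *+ i`!) - (- psum s 1) ^+ i.+1 =
   (- psum s 1) * ((revprod s)`_i *+ i`! - (- psum s 1) ^+ i) - T * i`!%:R.
  rewrite exprS -(mulr_natr T) -(mulr_natr (_ * _)) -(mulr_natr (revprod s)`_i).
  by ring.
apply: le_trans (cabsB _ _) _; rewrite !cabsM cabsN cabs_nat.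
apply: (@le_trans _ _ ((B * c + i`!%:R * (i%:R * (B ^+ i + c))) * sqsum s)); last first.
  by rewrite ler_wpM2r// lerDr.
rewrite mulrDl lerD//.
  by rewrite -mulrA ler_pM ?cabs_ge0//; exact: IH.
rewrite mulrC -mulrA ler_wpM2l//; apply: le_trans (cabs_sum _ _ _) _.
apply: (@le_trans _ _ (\sum_(j < i) (B ^+ i + c) * sqsum s)).
  apply: ler_sum => j _; rewrite cabsM mulrC ler_pM ?cabs_ge0//.
    by apply: bd; rewrite leq_subr.
  exact: cabs_psum_le.
by rewrite sumr_const card_ord -(mulr_natl (_ * _)) mulrA.
Qed.

Lemma derivn_comp_affine (p : {poly C}) (a z : C) i :
  (p \Po (a *: 'X + z%:P))^`(i) = a ^+ i *: (p^`(i) \Po (a *: 'X + z%:P)).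
Proof.
elim: i => [|i IH]; first by rewrite !derivn0 expr0 scale1r.
rewrite !derivnS IH derivZ deriv_comp derivD derivZ derivX derivC addr0.
by rewrite -scalerAr mulr1 scalerA -exprSr.
Qed.

(** Expanding [p] at [z] in the variable rescaled by [l]: the zeros seen from
    [z] become the numbers 1 / (l (z - x)). *)
Definition local_zeros (l z : C) (s : seq C) := [seq - (l * (z - x))^-1 | x <- s].

Lemma comp_local_zeros (c l z : C) s : z \notin s ->
  let p := c *: \prod_(x <- s) ('X - x%:P) in
  p \Po (l^-1 *: 'X + z%:P) = p.[z] *: revprod (local_zeros l z s).
Proof.
move=> zs /=; rewrite linearZ /= hornerZ -scalerA; congr (_ *: _).
elim: s zs => [|x s IH]; first by rewrite /revprod !big_nil hornerC comp_polyC scale1r.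
rewrite inE negb_or => /andP[zx zs].
rewrite !big_cons comp_polyM IH// hornerM -scalerA.
rewrite [local_zeros _ _ _]/= revprod_cons scalerAr scalerAl; congr (_ * _).
rewrite scalerBr comp_polyB comp_polyX comp_polyC hornerXsubC scalerA.
rewrite mulrN scaleNr opprK invfM mulrCA divff ?subr_eq0// mulr1 alg_polyC.
by rewrite polyCB [RHS]addrC addrA.
Qed.

Lemma derivn_local_zeros (c l z : C) s i : z \notin s -> l != 0 ->
  let p := c *: \prod_(x <- s) ('X - x%:P) in
  p^`(i).[z] = l ^+ i * p.[z] * ((revprod (local_zeros l z s))`_i *+ i`!).
Proof.
move=> zs l0 p.
have := congr1 (fun q : {poly C} => q^`(i)`_0) (comp_local_zeros c l zs).
rewrite /= -/p; clearbody p => {c zs}.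
rewrite derivn_comp_affine coefZ derivnZ coefZ coef_derivn addn0 ffactnn.
rewrite -horner_coef0 horner_comp !hornerE ?mulr0 ?add0r => h.
apply: (mulfI (expf_neq0 i (invr_neq0 l0))).
by rewrite h !mulrA -exprMn mulVf// expr1n mul1r.
Qed.

Lemma psum1_local_zeros (c l z : C) s : z \notin s -> l != 0 ->
  let p := c *: \prod_(x <- s) ('X - x%:P) in
  - psum (local_zeros l z s) 1 * (l * p.[z]) = p^`().[z].
Proof.
move=> zs l0 p; rewrite -derivn1 (derivn_local_zeros c 1 zs l0) -/p expr1 mulr1n mulrC.
congr (_ * _); have := newton_coef (local_zeros l z s) 0.
by rewrite big_ord_recl big_ord0 addr0 subn0 coef0_revprod mulr1.
Qed.
End ScaledDerivatives.

(** * The Riccati hierarchy as power series at infinity *)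

Section Reversal.
Variable C : numFieldType.
Implicit Types p q : {poly C}.

Definition revp (n : nat) p : {poly C} := \poly_(r < n.+1) p`_(n - r).

Lemma horner_revp n p (z : C) : (size p <= n.+1)%N -> z != 0 ->
  (revp n p).[z^-1] * z ^+ n = p.[z].
Proof.
move=> sp z0; rewrite horner_poly (horner_coef_wide _ sp) mulr_suml.
rewrite (reindex_inj rev_ord_inj) /=; apply: eq_bigr => i _.
have ni : (i <= n)%N by rewrite -ltnS.
rewrite subSS subKn// -mulrA; congr (_ * _).
have -> : z ^+ n = z ^+ (n - i) * z ^+ i by rewrite -exprD subnK.
by rewrite exprVn mulrA mulVf ?mul1r// expf_neq0.
Qed.

Lemma poly_eq_off0 p q : (forall z, z != 0 -> p.[z] = q.[z]) -> p = q.
Proof.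
move=> h; apply/eqP; rewrite -subr_eq0; apply/negPn/negP => r0.
pose rs := [seq (i.+1)%:R : C | i <- iota 0 (size (p - q))].
suff : (size rs < size (p - q)%R)%N by rewrite size_map size_iota ltnn.
apply: max_poly_roots => //.
  by apply/allP => x /mapP[i _ ->]; rewrite /root !hornerE h ?subrr ?pnatr_eq0.
rewrite map_inj_uniq ?iota_uniq// => i j /eqP.
by rewrite eqr_nat => /eqP[].
Qed.

Lemma revprod_revp s : revprod s = revp (size s) (\prod_(x <- s) ('X - x%:P)).
Proof.
apply: poly_eq_off0 => z z0.
have sz : (size (\prod_(x <- s) ('X - x%:P))%R <= (size s).+1)%N.
  by rewrite size_prod_XsubC.
have zi0 : z^-1 != 0 by rewrite invr_eq0.
apply: (mulIf (expf_neq0 (size s) zi0)).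
have := horner_revp sz zi0; rewrite invrK => ->; rewrite /revprod.
elim: s {sz} => [|x s IH]; first by rewrite !big_nil !hornerC expr0 mulr1.
rewrite !big_cons !hornerM exprS mulrACA IH; congr (_ * _).
by rewrite !hornerE mulrBl mul1r -mulrA divff// mulr1.
Qed.
End Reversal.

Section Hierarchy.
Variable R : rcfType.
Local Notation C := R[i].
Variables (s : seq C) (l : C) (M : nat).
Local Notation n := (size s).

(** Reversed polynomials of X^i p^(i), for p monic with zeros [s] *)
Fixpoint rev_derivs (i : nat) : {poly C} :=
  if i is j.+1 then (n%:R - j%:R) *: rev_derivs j - 'X * (rev_derivs j)^`()
  else revprod s.

Definition logder_series : {poly C} := l^-1 *: \poly_(r < M.+1) psum s r.

(** Truncated expansion, in powers of 1/z, of z^i p^(i)(z) / (l^i p(z)): the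
    recursion expresses that the Euler operator acts on p through the
    logarithmic derivative. *)
Fixpoint hierarchy (i : nat) : {poly C} :=
  if i is j.+1 then
    hierarchy j * (logder_series - (j%:R / l)%:P) - l^-1 *: ('X * (hierarchy j)^`())
  else 1.

Lemma logder_seriesP : l != 0 ->
  'X^(M.+1) %| l *: (revprod s * logder_series) - n%:R *: revprod s + 'X * (revprod s)^`().
Proof.
move=> l0; have := dvdp_mul (dvdpp 'X) (newton s M); rewrite -exprS => h.
suff -> : l *: (revprod s * logder_series) - n%:R *: revprod s +
  'X * (revprod s)^`() =
  'X * ((revprod s)^`() + revprod s * \poly_(j < M) psum s j.+1) by [].
rewrite /logder_series -scalerAr scalerA divff// scale1r.
have -> : \poly_(r < M.+1) psum s r = n%:R%:P + 'X * \poly_(j < M) psum s j.+1.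
  apply/polyP => i; rewrite coefD coefXM coefC !coef_poly.
  case: i => [|i] /=; last by rewrite add0r ltnS.
  by rewrite addr0 psum0.
by rewrite -mul_polyC; ring.
Qed.

Lemma hierarchy_revp i : l != 0 ->
  'X^(M.+1) %| l ^+ i *: (revprod s * hierarchy i) - rev_derivs i.
Proof.
move=> l0; elim: i => [|i IH] /=.
  by rewrite expr0 scale1r mulr1 subrr dvdp0.
set D := (_ - rev_derivs i) in IH.
have hD : 'X^(M.+1) %| 'X * D^`().
  case/dvdpP: IH => h ->; rewrite derivM derivXn mulrDr.
  apply: dvdp_add; first by rewrite mulrA dvdp_mull.
  rewrite mulrCA; apply: dvdp_mull.
  by rewrite mulrnAr -exprS -scaler_nat -mul_polyC dvdp_mull.
have h1 : 'X^(M.+1) %| (n%:R - i%:R) *: D - 'X * D^`().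
  by apply: dvdp_sub => //; rewrite -mul_polyC dvdp_mull.
have h2 := dvdp_mull (l ^+ i *: hierarchy i) (logder_seriesP l0).
have := dvdp_add h1 h2; congr (_ %| _).
set W := logder_series - _.
have hW : l *: W = l *: logder_series - i%:R%:P.
  by rewrite /W scalerBr; congr (_ - _); rewrite -mul_polyC -polyCM mulrC mulfVK.
have -> : l ^+ i.+1 *: (revprod s * (hierarchy i * W - l^-1 *: ('X * (hierarchy i)^`()))) =
  l ^+ i *: (revprod s * (hierarchy i * (l *: W) - 'X * (hierarchy i)^`())).
  rewrite exprSr -scalerA; congr (_ *: _); rewrite scalerAr; congr (_ * _).
  by rewrite scalerBr scalerA divff// scale1r scalerAr.
rewrite hW /D derivB derivZ derivM -!mul_polyC polyCB.
by ring.
Qed.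

Section Pencil.
Variables (k : nat) (Q : 'I_k.+1 -> {poly C}).
Hypothesis hQ : forall i : 'I_k.+1, (size (Q i) <= i.+1)%N.
Variable c : C.
Let p : {poly C} := c *: \prod_(x <- s) ('X - x%:P).
Hypothesis c0 : c != 0.
Hypothesis p_eig : \sum_(i < k.+1) l ^+ (k - i) *: (Q i * p^`(i)) = 0.

Lemma coef_euler (q : {poly C}) i m : ('X^i * q^`(i))`_m = q`_m *+ m ^_ i.
Proof.
rewrite coefXnM coef_derivn; case: ltnP => h; first by rewrite ffact_small.
by rewrite subnKC.
Qed.

Lemma rev_derivsE i : c *: rev_derivs i = revp n ('X^i * p^`(i)).
Proof.
elim: i => [|i IH] /=.
  rewrite expr0 mul1r ?derivn0 revprod_revp; apply/polyP => r.
  by rewrite coefZ !coef_poly coefZ; case: ifP => _ //; rewrite mulr0.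
have IHr r : c * (rev_derivs i)`_r = (revp n ('X^i * p^`(i)))`_r by rewrite -IH coefZ.
apply/polyP => r.
have eX : ('X * (rev_derivs i)^`())`_r = r%:R * (rev_derivs i)`_r.
  rewrite coefXM coef_deriv; case: r => [|r] /=; first by rewrite mul0r.
  by rewrite mulr_natl.
rewrite coefZ coefB coefZ eX -mulrBl mulrCA IHr !coef_poly.
case: ifP => hr; last by rewrite mulr0.
rewrite !coef_euler ffactnSr mulrnA.
have rn : (r <= n)%N by rewrite -ltnS.
have [h|h] := leqP i (n - r); last by rewrite ffact_small// mulr0n mulr0 mul0rn.
by rewrite -[RHS]mulr_natl natrB// natrB// addrAC.
Qed.

(** Divided by l^k p, the differential equation is linear in the members of the
    hierarchy; the division is possible in power series because [revprod s], the
    reversal of p, has constant term 1. *)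
Lemma hierarchy_eq0 :
  l != 0 -> 'X^(M.+1) %| \sum_(i < k.+1) revp i (Q i) * hierarchy i.
Proof.
move=> l0.
have x0 : \sum_(i < k.+1) l ^+ (k - i) *: (revp i (Q i) * (c *: rev_derivs i)) = 0.
  apply: poly_eq_off0 => y y0; rewrite horner0.
  pose z := y^-1; have z0 : z != 0 by rewrite invr_eq0.
  have -> : y = z^-1 by rewrite invrK.
  apply: (mulIf (expf_neq0 n z0)); rewrite mul0r.
  have <- : (\sum_(i < k.+1) l ^+ (k - i) *: (Q i * p^`(i))).[z] = 0.
    by rewrite p_eig horner0.
  rewrite !horner_sum mulr_suml; apply: eq_bigr => i _.
  rewrite !hornerZ !hornerM -!mulrA; congr (_ * _).
  rewrite rev_derivsE horner_revp//; last first.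
    apply/leq_sizeP => j hj; rewrite coef_euler nth_default ?mul0rn//.
    by apply: leq_trans hj; rewrite (leq_trans (size_scale_leq _ _))// size_prod_XsubC.
  by rewrite -(horner_revp (hQ i) z0) hornerM hornerXn mulrA.
have y0 : \sum_(i < k.+1) l ^+ (k - i) *: (revp i (Q i) * rev_derivs i) = 0.
  apply: (scalerI c0); rewrite scaler0 -[RHS]x0 scaler_sumr; apply: eq_bigr => i _.
  by rewrite -scalerAr !scalerA mulrC.
have h : 'X^(M.+1) %| l ^+ k *: (revprod s * \sum_(i < k.+1) revp i (Q i) * hierarchy i).
  have -> : l ^+ k *: (revprod s * \sum_(i < k.+1) revp i (Q i) * hierarchy i) =
    \sum_(i < k.+1) l ^+ (k - i) *: (revp i (Q i) *
      (l ^+ i *: (revprod s * hierarchy i) - rev_derivs i)).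
    rewrite -[LHS]subr0 -[X in _ - X]y0 mulr_sumr scaler_sumr -sumrB.
    apply: eq_bigr => i _; have ik : (i <= k)%N by rewrite -ltnS.
    rewrite mulrBr scalerBr; congr (_ - _).
    by rewrite -scalerAr scalerA -exprD subnK// mulrCA.
  elim/big_ind: _ => [|a b|i _]; rewrite ?dvdp0//; first exact: dvdp_add.
  by rewrite -mul_polyC !dvdp_mull// hierarchy_revp.
move: h; rewrite -mul_polyC Gauss_dvdpr; last first.
  by rewrite coprimep_expl// coprimep_sym coprimepX /root hornerC expf_neq0.
rewrite Gauss_dvdpr// coprimep_expl// coprimep_sym coprimepX /root.
by rewrite horner_coef0 coef0_revprod oner_neq0.
Qed.
End Pencil.
End Hierarchy.

(** * Majorants for the coefficients of the hierarchy *)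

Section WeightedNorm.
Variable R : rcfType.
Local Notation C := R[i].
Variables (n : nat) (rho : R).
Hypothesis rho0 : 0 < rho.
Implicit Types x y : nat -> C.

(** One factor [wt r] pays for one Euler derivative. *)
Definition wt (r : nat) : R := 1 + r%:R / n%:R.
Definition wnorm (m M : nat) x : R :=
  \sum_(1 <= r < M.+1) cabs (x r) * (wt r ^+ m * rho ^+ r).
Definition conv x y (r : nat) : C := \sum_(1 <= j < r) x j * y (r - j)%N.

Lemma wt_ge1 r : 1 <= wt r.
Proof. by rewrite /wt lerDl mulr_ge0// invr_ge0. Qed.
Lemma wt_ge0 r : 0 <= wt r. Proof. exact: le_trans (wt_ge1 r). Qed.

Let rho_ge0 : 0 <= rho := ltW rho0.

Let wr0 m r : 0 <= wt r ^+ m * rho ^+ r.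
Proof. by rewrite mulr_ge0// exprn_ge0 ?wt_ge0// ltW. Qed.

Lemma wnorm_ge0 m M x : 0 <= wnorm m M x.
Proof. by apply: sumr_ge0 => r _; rewrite mulr_ge0 ?cabs_ge0. Qed.

Lemma wnormS m M x : wnorm m M.+1 x = wnorm m M x + cabs (x M.+1) * (wt M.+1 ^+ m * rho ^+ M.+1).
Proof. by rewrite /wnorm big_nat_recr. Qed.

Lemma wnorm_leM m M x : wnorm m M x <= wnorm m M.+1 x.
Proof. by rewrite wnormS lerDl mulr_ge0// cabs_ge0. Qed.

Lemma wnorm_lem m m' M x : (m <= m')%N -> wnorm m M x <= wnorm m' M x.
Proof.
move=> mm; apply: ler_sum => r _; rewrite ler_wpM2l ?cabs_ge0// ler_wpM2r//.
  by rewrite exprn_ge0// ltW.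
by rewrite ler_weXn2l ?wt_ge1.
Qed.

Lemma ler_wnorm m M x y (b : R) :
  (forall r, (1 <= r <= M)%N -> cabs (x r) <= b * wt r * cabs (y r)) ->
  wnorm m M x <= b * wnorm m.+1 M y.
Proof.
move=> h; rewrite /wnorm big_nat [X in b * X]big_nat mulr_sumr.
apply: ler_sum => r rM; apply: le_trans (ler_wpM2r (wr0 m r) (h r rM)) _.
by rewrite exprS le_eqVlt; apply/orP; left; apply/eqP; ring.
Qed.

Lemma wnormD m M x y z : (forall r, (1 <= r <= M)%N -> x r = y r + z r) ->
  wnorm m M x <= wnorm m M y + wnorm m M z.
Proof.
move=> h; rewrite /wnorm -big_split /=; apply: ler_sum_nat => r rM.
by rewrite -mulrDl ler_wpM2r// h// cabsD.
Qed.

Lemma wnormZ m M b x : wnorm m M (fun r => b * x r) = cabs b * wnorm m M x.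
Proof. by rewrite /wnorm mulr_sumr; apply: eq_bigr => r _; rewrite cabsM -mulrA. Qed.

Lemma wnorm_sum m M (I : finType) (F : I -> nat -> C) :
  wnorm m M (fun r => \sum_(i : I) F i r) <= \sum_(i : I) wnorm m M (F i).
Proof.
rewrite /wnorm exchange_big /=; apply: ler_sum => r _.
by rewrite -mulr_suml ler_wpM2r// cabs_sum.
Qed.

Lemma wt_sub j t : wt (j + t) <= wt j * wt t.
Proof.
rewrite /wt natrD mulrDl; set a := j%:R / _; set b := t%:R / _.
rewrite -subr_ge0 (_ : _ - _ = a * b); last by ring.
by rewrite /a /b !mulr_ge0 ?invr_ge0.
Qed.

(** The weights are submultiplicative, [wt_sub]; and as only indices below [r]
    enter [conv], the norm gains one order, which is what makes the induction of
    [majorant] close. *)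
Lemma wnorm_conv m M x y :
  wnorm m M.+1 (conv x y) <= wnorm m M x * wnorm m M y.
Proof.
pose a j := cabs (x j) * (wt j ^+ m * rho ^+ j).
pose b j := cabs (y j) * (wt j ^+ m * rho ^+ j).
have b0 j : 0 <= b j by rewrite mulr_ge0 ?cabs_ge0.
apply: (@le_trans _ _
  (\sum_(1 <= r < M.+2) \sum_(1 <= j < M.+1 | (j < r)%N) a j * b (r - j)%N)).
  apply: ler_sum_nat => r /andP[r1 rM].
  rewrite -(@big_nat_widen _ _ _ 1 r M.+1 xpredT)//; apply: le_trans (ler_wpM2r (wr0 _ _) (cabs_sum _ _ _)) _.
  rewrite mulr_suml; apply: ler_sum_nat => j /andP[j1 jr].
  rewrite cabsM /a /b [leRHS]mulrACA ler_wpM2l ?mulr_ge0 ?cabs_ge0//.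
  have e : r = (j + (r - j))%N by rewrite subnKC// ltnW.
  rewrite {1 2}e exprD mulrACA ler_wpM2r ?mulr_ge0 ?exprn_ge0//.
  by rewrite -exprMn; apply: lerXn2r; rewrite ?nnegrE ?mulr_ge0 ?wt_ge0 ?wt_sub.
rewrite /index_iota; under eq_bigr do rewrite big_mkcond.
rewrite exchange_big /= [X in _ <= X * _]/wnorm mulr_suml.
apply: ler_sum_nat => j /andP[j1 jM].
rewrite -big_mkcond -mulr_sumr; apply: ler_wpM2l; first by rewrite mulr_ge0 ?cabs_ge0.
have -> : \sum_(1 <= r < M.+2 | (j < r)%N) b (r - j)%N = \sum_(j.+1 <= r < M.+2) b (r - j)%N.
  by rewrite (@big_nat_widenl _ _ _ j.+1 1).
rewrite -[j.+1]add1n big_addn; under eq_bigr do rewrite addnK.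
have jM' : (M.+2 - j <= M.+1)%N by rewrite leq_subLR addnC -addn1 leq_add2l.
rewrite (big_nat_widen _ _ _ _ _ jM') /= big_mkcond /=.
by apply: ler_sum => t _; case: ifP => _; [exact: lexx|exact: b0].
Qed.
End WeightedNorm.

Lemma euler_coef_bound (R : rcfType) (k n : nat) (l : R[i]) (K : R) (i r : nat) :
  (0 < n)%N -> n%:R / cabs l * k.+1%:R <= K -> (i <= k)%N ->
  cabs ((n%:R - i%:R - r%:R) / l) <= K * wt R n r.
Proof.
move=> n0 lK ik; have n0' : 0 < n%:R :> R by rewrite ltr0n.
rewrite cabs_div; apply: (@le_trans _ _ ((n%:R + k%:R + r%:R) / cabs l)).
  rewrite ler_wpM2r ?invr_ge0 ?cabs_ge0//.
  apply: le_trans (cabsB _ _) _; rewrite cabs_nat lerD2r.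
  apply: le_trans (cabsB _ _) _; rewrite !cabs_nat lerD2l.
  by rewrite ler_nat.
apply: le_trans (ler_wpM2r (wt_ge0 _ _ _) lK).
have -> : n%:R / cabs l * k.+1%:R * wt R n r = (k.+1%:R * (n%:R + r%:R)) / cabs l.
  have -> : n%:R + r%:R = n%:R * wt R n r.
    by rewrite /wt mulrDr mulr1 mulrCA divff ?lt0r_neq0// mulr1.
  by ring.
rewrite ler_wpM2r ?invr_ge0 ?cabs_ge0// -!natrD -!natrM ler_nat.
by nia.
Qed.

Section Majorant.
Variable R : rcfType.
Local Notation C := R[i].

(** Constants of the majorant argument: [majC] bounds the i-th member of the
    hierarchy, [majD] the part of it that is at least quadratic, and [majG] the
    defect in the resulting recursive inequality. *)
Fixpoint majC (K : R) (i : nat) : R :=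
  if i is j.+1 then (K + 1) * majC K j + K ^+ j else 0.
Fixpoint majD (K : R) (i : nat) : R :=
  if i is j.+1 then K * majD K j + majC K j else 0.
Definition majG (k : nat) (K B : R) : R :=
  \sum_(i < k.+1) B * (majD K i + majC K i + K ^+ i).

Lemma majC_ge0 K i : 0 <= K -> 0 <= majC K i.
Proof. by move=> K0; elim: i => //= i IH; rewrite addr_ge0 ?exprn_ge0 ?mulr_ge0 ?addr_ge0. Qed.
Lemma majD_ge0 K i : 0 <= K -> 0 <= majD K i.
Proof. by move=> K0; elim: i => //= i IH; rewrite addr_ge0 ?mulr_ge0 ?majC_ge0. Qed.
Lemma majG_ge0 k K B : 0 <= K -> 0 <= B -> 0 <= majG k K B.
Proof.
move=> K0 B0; apply: sumr_ge0 => i _.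
by rewrite mulr_ge0// !addr_ge0 ?majC_ge0 ?majD_ge0 ?exprn_ge0.
Qed.

Variables (k' n M0 : nat) (l : C) (rho K B c : R).
Local Notation k := k'.+1.
Variables (v : nat -> C) (E : nat -> nat -> C) (a : 'I_k.+1 -> nat -> C).

(** The part of the hierarchy that is linear in the unknown coefficient. *)
Fixpoint linpart (r i : nat) : C :=
  if i is j.+1 then (n%:R - j%:R - r%:R) / l * linpart r j + E j 0 else 0.

Hypothesis n0 : (0 < n)%N.
Hypothesis rho0 : 0 < rho.
Hypothesis K0 : 0 <= K.
Hypothesis lK : n%:R / cabs l * k.+1%:R <= K.
Hypothesis v_0 : v 0 = n%:R / l.
Hypothesis E_0 : forall r, E 0 r = (r == 0)%:R.
Hypothesis E_S : forall i r, (r <= M0)%N -> E i.+1 r =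
  \sum_(j < r.+1) E i j * v (r - j) - (i + r)%:R / l * E i r.
Hypothesis aE : forall r, (r <= M0)%N ->
  \sum_(i < k.+1) \sum_(j < r.+1) a i j * E i (r - j)%N = 0.
Hypothesis a_0 : forall i, cabs (a i 0) <= B.
Hypothesis a_norm : forall i M, wnorm n rho 0 M (a i) <= B * rho.
Hypothesis c0 : 0 < c.
Hypothesis lin_ge : forall r, (0 < r <= M0)%N ->
  c * wt R n r ^+ k' <= cabs (\sum_(i < k.+1) a i 0 * linpart r i).

Let B0 : 0 <= B := le_trans (cabs_ge0 _) (a_0 ord0).

Let sum_split (x y : nat -> C) r : (0 < r)%N ->
  \sum_(j < r.+1) x j * y (r - j)%N = x 0 * y r + x r * y 0 + conv x y r :> C.
Proof.
move=> r0; rewrite -(big_mkord xpredT (fun j => x j * y (r - j)%N)) big_nat_recr//=.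
by rewrite subnn big_ltn// subn0 addrAC.
Qed.

(** Isolates the terms of order [r] that contain the coefficient [v r], directly
    or through [E i r], from those that only involve lower orders. *)
Lemma E_rec i r : (0 < r <= M0)%N ->
  E i.+1 r = (n%:R - i%:R - r%:R) / l * E i r + E i 0 * v r + conv (E i) v r.
Proof.
move=> /andP[r0 rM]; rewrite E_S// sum_split// v_0 natrD.
by rewrite !mulrDl !mulNr; ring.
Qed.

Local Notation N := (wnorm n rho).
Local Notation w := (wt R n).

Lemma E_0_bound i : (i <= k)%N -> cabs (E i 0) <= K ^+ i.
Proof.
elim: i => [|i IH] ik; first by rewrite E_0 eqxx cabs1 expr0.
rewrite E_S// big_ord1 subnn v_0 addn0.
have -> : E i 0 * (n%:R / l) - i%:R / l * E i 0 = (n%:R - i%:R - 0%:R) / l * E i 0.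
  by ring.
rewrite cabsM exprS; apply: ler_pM; rewrite ?cabs_ge0// ?IH ?(ltnW ik)//.
apply: le_trans (euler_coef_bound 0 n0 lK (ltnW ik)) _.
by rewrite /wt mul0r addr0 mulr1.
Qed.

(** Each step of the hierarchy applies one Euler operator, which costs one power
    of the weight: of the k' = k - 1 available for [v], k - i remain for
    [E i]. *)
Lemma E_bound M i : (M <= M0)%N -> (i <= k)%N -> N k' M v <= 1 ->
  N (k - i) M (E i) <= majC K i * N k' M v.
Proof.
move=> MM ik S1; have S0 := wnorm_ge0 n rho0 k' M v.
elim: i ik => [|i IH] ik.
  rewrite mul0r /wnorm big_nat big1// => r /andP[r0 _].
  by rewrite E_0 eqn0Ngt r0 cabs0 mul0r.
have {IH} := IH (ltnW ik); rewrite subSS => IH.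
set S := N k' M v in S0 S1 IH *.
have Nv : N (k' - i) M v <= S by apply: wnorm_lem => //; rewrite leq_subr.
have Ei : N (k' - i) M (E i) <= majC K i * S.
  apply: le_trans IH; apply: wnorm_lem => //; exact: leq_sub2r.
have NE0 := wnorm_ge0 n rho0 (k' - i) M (E i).
have Nv0 := wnorm_ge0 n rho0 (k' - i) M v.
apply: le_trans (@wnormD _ n _ rho0 _ _ _ (fun r => (n%:R - i%:R - r%:R) / l * E i r + E i 0 * v r)
  (conv (E i) v) _) _.
  by move=> r /andP[r0 rM]; rewrite E_rec// r0 (leq_trans rM).
rewrite /= mulrDl; apply: (@le_trans _ _ (K * (majC K i * S) + K ^+ i * S + majC K i * S)); last first.
  by rewrite le_eqVlt; apply/orP; left; apply/eqP; ring.
apply: lerD; last first.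
  apply: le_trans (wnorm_leM n rho0 _ _ _) _; apply: le_trans (wnorm_conv n rho0 _ _ _ _) _.
  rewrite -[leRHS]mulr1; apply: ler_pM => //; exact: le_trans Nv S1.
apply: le_trans (@wnormD _ n _ rho0 _ _ _ (fun r => (n%:R - i%:R - r%:R) / l * E i r)
  (fun r => E i 0 * v r) _) _; first by [].
apply: lerD.
  apply: le_trans (_ : _ <= K * N (k' - i).+1 M (E i)) _.
    apply: ler_wnorm => // r _; rewrite cabsM ler_wpM2r ?cabs_ge0//.
    exact: euler_coef_bound n0 lK (ltnW ik).
  by rewrite ler_wpM2l// -subSn.
rewrite wnormZ; apply: ler_pM => //; first exact: cabs_ge0.
exact: E_0_bound (ltnW ik).
Qed.

Let q i r := E i r - linpart r i * v r.

Lemma q_bound M i : (M < M0)%N -> (i <= k)%N -> N k' M v <= 1 ->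
  N (k - i) M.+1 (q i) <= majD K i * N k' M v ^+ 2.
Proof.
move=> MM ik S1; have S0 := wnorm_ge0 n rho0 k' M v.
elim: i ik => [|i IH] ik.
  rewrite mul0r /wnorm big_nat big1// => r /andP[r0 _].
  by rewrite /q E_0 eqn0Ngt r0 /= mul0r subr0 cabs0 mul0r.
have {IH} := IH (ltnW ik); rewrite subSS => IH.
have := E_bound (ltnW MM) (ltnW ik) S1.
set S := N k' M v in S0 S1 IH * => Ei.
have Nv : N (k' - i) M v <= S by apply: wnorm_lem => //; rewrite leq_subr.
have NE0 := wnorm_ge0 n rho0 (k' - i) M (E i).
have Nv0 := wnorm_ge0 n rho0 (k' - i) M v.
apply: le_trans (@wnormD _ n _ rho0 _ _ _ (fun r => (n%:R - i%:R - r%:R) / l * q i r)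
  (conv (E i) v) _) _.
  by move=> r /andP[r0 rM]; rewrite /q E_rec/= ?r0 ?(leq_trans rM)//; ring.
rewrite mulrDl; apply: lerD.
  apply: le_trans (_ : _ <= K * N (k' - i).+1 M.+1 (q i)) _.
    apply: ler_wnorm => // r _; rewrite cabsM ler_wpM2r ?cabs_ge0//.
    exact: euler_coef_bound n0 lK (ltnW ik).
  by rewrite -mulrA ler_wpM2l// -subSn.
apply: le_trans (wnorm_conv n rho0 _ _ _ _) _; rewrite expr2 mulrA.
apply: ler_pM => //; apply: le_trans Ei; apply: wnorm_lem => //; exact: leq_sub2r.
Qed.

(** Solving the equation of order [r] for [v r]: the lower bound of the linear
    part absorbs all the weights, the rest is quadratic in [v] or carries the
    factor [rho] of the subleading coefficients of the Q_i. *)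
Lemma majorant_step M : (M < M0)%N -> N k' M v <= 1 ->
  c * N k' M.+1 v <= majG k K B * (N k' M v ^+ 2 + rho).
Proof.
move=> MM S1; have S0 := wnorm_ge0 n rho0 k' M v.
set S := N k' M v in S0 S1 *.
pose T (i : 'I_k.+1) r := a i 0 * q i r + (E i 0 * a i r + conv (a i) (E i) r).
have hT r : (0 < r <= M0)%N ->
    (\sum_(i < k.+1) a i 0 * linpart r i) * v r = - \sum_(i < k.+1) T i r.
  move=> /andP[r0 rM]; apply/eqP; rewrite -subr_eq0 opprK -[X in _ == X](aE rM).
  rewrite mulr_suml -big_split; apply/eqP; apply: eq_bigr => i _.
  by rewrite sum_split// /T /q/=; ring.
have h1 : c * N k' M.+1 v <= \sum_(i < k.+1) N 0 M.+1 (T i).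
  apply: le_trans (wnorm_sum n rho0 _ _ _).
  rewrite /wnorm mulr_sumr; apply: ler_sum_nat => r /andP[r0 rM].
  have rM0 : (0 < r <= M0)%N by rewrite r0 (leq_trans _ MM).
  rewrite expr0 mul1r -[X in _ <= X * _]cabsN -hT// cabsM.
  rewrite (_ : c * _ = (c * w r ^+ k') * (cabs (v r) * rho ^+ r)); last by ring.
  rewrite -[leRHS]mulrA; apply: ler_wpM2r; last exact: lin_ge.
  by rewrite mulr_ge0 ?cabs_ge0// exprn_ge0// ltW.
apply: le_trans h1 _; rewrite /majG mulr_suml; apply: ler_sum => i _.
have ik : (i <= k)%N by rewrite -ltnS.
have CK := majC_ge0 i K0; have DK := majD_ge0 i K0; have KK := exprn_ge0 i K0.
have rho_ge0 := ltW rho0.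
apply: (@le_trans _ _ (B * (majD K i * S ^+ 2) + (K ^+ i * (B * rho) + B * rho * (majC K i * S)))).
  apply: le_trans (@wnormD _ n _ rho0 _ _ _ (fun r => a i 0 * q i r)
     (fun r => E i 0 * a i r + conv (a i) (E i) r) _) _; first by [].
  apply: lerD.
    rewrite wnormZ; apply: ler_pM; rewrite ?cabs_ge0 ?wnorm_ge0//.
    by apply: le_trans (q_bound MM ik S1); apply: wnorm_lem.
  apply: le_trans (@wnormD _ n _ rho0 _ _ _ (fun r => E i 0 * a i r)
     (conv (a i) (E i)) _) _; first by [].
  apply: lerD.
    by rewrite wnormZ; apply: ler_pM; rewrite ?cabs_ge0 ?wnorm_ge0// E_0_bound.
  apply: le_trans (wnorm_conv n rho0 _ _ _ _) _.
  apply: ler_pM; rewrite ?wnorm_ge0//.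
  by apply: le_trans (E_bound (ltnW MM) ik S1); apply: wnorm_lem.
have Br : 0 <= B * rho by rewrite mulr_ge0.
have S2 : 0 <= S ^+ 2 by rewrite exprn_ge0.
rewrite -subr_ge0; set D := majD K i in DK *; set C1 := majC K i in CK *; set Ki := K ^+ i in KK *.
rewrite (_ : _ - _ = B * D * rho + B * C1 * S ^+ 2 + B * rho * C1 * (1 - S) + B * Ki * S ^+ 2); last by ring.
by rewrite !addr_ge0// !mulr_ge0// subr_ge0.
Qed.

(** Induction on the order: the quadratic inequality of [majorant_step] traps the
    norm below [eta], since the truncation of order 0 starts below it. *)
Lemma majorant (eta : R) : 0 < eta -> eta <= 1 ->
  majG k K B * (eta ^+ 2 + rho) <= c * eta ->
  forall M, (M <= M0)%N -> N k' M v <= eta.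
Proof.
move=> eta0 eta1 hG; elim=> [|M IH] MM.
  by rewrite /wnorm big_geq// ltW.
have {}IH := IH (ltnW MM).
rewrite -(ler_pM2l c0); apply: le_trans hG.
apply: le_trans (majorant_step MM (le_trans IH eta1)) _.
rewrite ler_wpM2l ?majG_ge0// lerD2r.
by apply: lerXn2r; rewrite ?nnegrE ?wnorm_ge0// ltW.
Qed.
End Majorant.

(** * The linear part of the hierarchy stays away from zero *)

Section LinearPart.
Variable R : rcfType.
Local Notation C := R[i].

(** Divided difference of X^i between [y] and [y * t]: what [linpart] becomes in
    the limit. *)
Fixpoint divdiff (y t : C) (i : nat) : C :=
  if i is j.+1 then y * t * divdiff y t j + y ^+ j else 0.

Lemma divdiffE y t i : divdiff y t i * (y * t - y) = (y * t) ^+ i - y ^+ i.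
Proof.
elim: i => [|i IH] /=; first by rewrite mul0r !expr0 subrr.
by rewrite mulrDl -mulrA IH !exprS; ring.
Qed.

(** Constants of the comparison of [linpart] with its limit: [linK] for the
    values of the hierarchy at infinity, [linG] for the size of the divided
    differences, [linD] for their distance to [linpart]. *)
Fixpoint linK (K : R) (i : nat) : R :=
  if i is j.+1 then 2 * K ^+ j + K * linK K j else 0.
Fixpoint linG (K : R) (i : nat) : R :=
  if i is j.+1 then K * linG K j + K ^+ j else 0.
Fixpoint linD (K : R) (i : nat) : R :=
  if i is j.+1 then K * linD K j + 2 * linG K j + linK K j else 0.

Lemma linK_ge0 K i : 0 <= K -> 0 <= linK K i.
Proof. by move=> K0; elim: i => //= i IH; rewrite addr_ge0 ?mulr_ge0 ?exprn_ge0. Qed.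
Lemma linG_ge0 K i : 0 <= K -> 0 <= linG K i.
Proof. by move=> K0; elim: i => //= i IH; rewrite addr_ge0 ?mulr_ge0 ?exprn_ge0. Qed.
Lemma linD_ge0 K i : 0 <= K -> 0 <= linD K i.
Proof.
by move=> K0; elim: i => //= i IH; rewrite !addr_ge0 ?mulr_ge0 ?linG_ge0 ?linK_ge0.
Qed.

Variables (k n r : nat) (l y : C) (K delta : R) (E : nat -> nat -> C).
Hypothesis n0 : (0 < n)%N.
Hypothesis K0 : 0 <= K.
Hypothesis yK : cabs y <= K.
Hypothesis lK : n%:R / cabs l * k.+1%:R <= K.
Hypothesis E_0 : E 0 0 = 1.
Hypothesis E_S : forall i, E i.+1 0 = (n%:R - i%:R) / l * E i 0.
Hypothesis ly : cabs (n%:R / l - y) <= delta.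
Hypothesis ld : k%:R / cabs l <= delta.

Local Notation w := (wt R n r).
Local Notation t := ((1 - r%:R / n%:R) : C).

Let delta0 : 0 <= delta := le_trans (cabs_ge0 _) ly.
Let w1 : 1 <= w := wt_ge1 R n r.
Let w0 : 0 <= w := wt_ge0 R n r.

Lemma cabs_t : cabs t <= w.
Proof.
by apply: le_trans (cabsB _ _) _; rewrite cabs1 cabs_div !cabs_nat.
Qed.

Let id_le i : (i <= k)%N -> i%:R / cabs l <= delta.
Proof.
move=> ik; apply: le_trans ld; rewrite ler_wpM2r ?invr_ge0 ?cabs_ge0//.
by rewrite ler_nat.
Qed.

Lemma E_0_close i : (i <= k)%N ->
  cabs (E i 0) <= K ^+ i /\ cabs (E i 0 - y ^+ i) <= delta * linK K i.
Proof.
elim: i => [|i IH] ik.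
  by rewrite E_0 !expr0 subrr cabs0 cabs1 mulr0.
have [h1 h2] := IH (ltnW ik); rewrite E_S.
have b1 : cabs ((n%:R - i%:R) / l) <= K.
  have := euler_coef_bound 0 n0 lK (ltnW ik); rewrite subr0.
  by rewrite /wt mul0r addr0 mulr1.
split; first by rewrite cabsM exprS ler_pM ?cabs_ge0.
have -> : (n%:R - i%:R) / l * E i 0 - y ^+ i.+1 =
  ((n%:R / l - y) - i%:R / l) * E i 0 + y * (E i 0 - y ^+ i).
  by rewrite exprS; ring.
apply: le_trans (cabsD _ _) _; rewrite !cabsM /= mulrDr; apply: lerD.
  rewrite mulrA; apply: ler_pM; rewrite ?cabs_ge0//.
  rewrite mulr2n mulrDr mulr1; apply: le_trans (cabsB _ _) _; apply: lerD => //.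
  by rewrite cabs_div cabs_nat id_le// ltnW.
by rewrite mulrCA ler_pM ?cabs_ge0.
Qed.

Lemma divdiff_bound i : w * cabs (divdiff y t i) <= linG K i * w ^+ i.
Proof.
elim: i => [|i IH] /=; first by rewrite cabs0 mulr0 mul0r.
apply: le_trans (ler_wpM2l w0 (cabsD _ _)) _; rewrite [leLHS]mulrDr [leRHS]mulrDl; apply: lerD.
  rewrite !cabsM mulrCA exprS [leRHS]mulrACA; apply: ler_pM IH; rewrite ?mulr_ge0 ?cabs_ge0//.
  by apply: ler_pM; rewrite ?cabs_ge0// cabs_t.
rewrite mulrC; apply: ler_pM; rewrite ?cabs_ge0//.
  by rewrite cabsX; apply: lerXn2r; rewrite ?nnegrE ?cabs_ge0.
by rewrite exprS ler_peMr// exprn_ege1.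
Qed.

(** The factor [w] on the left replaces the exponent i - 1 by i on the right, so
    that the case i = 0 needs no convention. *)
Lemma linpart_close i : (i <= k)%N ->
  w * cabs (linpart n l E r i - divdiff y t i) <= delta * linD K i * w ^+ i.
Proof.
elim: i => [|i IH] ik /=; first by rewrite subrr cabs0 mulr0 mulr0 mul0r.
have {}IH := IH (ltnW ik); have [_ h2] := E_0_close (ltnW ik).
have dd := divdiff_bound i.
set D := divdiff y t i in IH dd *; set L := linpart n l E r i in IH *.
have nn : n%:R != 0 :> C by rewrite pnatr_eq0 -lt0n.
have b1 : cabs ((n%:R - i%:R - r%:R) / l) <= K * w.
  exact: euler_coef_bound _ n0 lK (ltnW ik).
set be := (n%:R - i%:R - r%:R) / l in b1 *.
have b2 : cabs (be - y * t) <= 2 * delta * w.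
  have -> : be - y * t = (n%:R / l - y) * t - i%:R / l.
    by rewrite /be; move: (l^-1) => li; field.
  apply: le_trans (cabsB _ _) _.
  rewrite (_ : 2 * delta * w = delta * w + delta * w); last by ring.
  apply: lerD.
    by rewrite cabsM ler_pM ?cabs_ge0// cabs_t.
  rewrite cabs_div cabs_nat; apply: le_trans (id_le (ltnW ik)) _.
  by rewrite ler_peMr.
clearbody be L D.
have -> : be * L + E i 0 - (y * t * D + y ^+ i) =
  be * (L - D) + (be - y * t) * D + (E i 0 - y ^+ i) by ring.
apply: le_trans (ler_wpM2l w0 (le_trans (cabsD _ _) (lerD (cabsD _ _) (lexx _)))) _.
rewrite !cabsM exprS.
rewrite [leLHS](_ : _ = cabs be * (w * cabs (L - D)) +
  cabs (be - y * t) * (w * cabs D) + cabs (E i 0 - y ^+ i) * w); last by ring.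
rewrite [leRHS](_ : _ = K * w * (delta * linD K i * w ^+ i) +
  2 * delta * w * (linG K i * w ^+ i) + delta * linK K i * (w * w ^+ i)); last by ring.
apply: lerD; first apply: lerD.
- by apply: ler_pM IH; rewrite ?mulr_ge0 ?cabs_ge0.
- by apply: ler_pM dd; rewrite ?mulr_ge0 ?cabs_ge0.
- by apply: ler_pM; rewrite ?cabs_ge0// ler_peMr// exprn_ege1.
Qed.

(** A lower bound on the limiting linear part survives the perturbation. *)
Lemma linpart_ge k' (a : 'I_k.+1 -> C) (B c : R) : k = k'.+1 ->
  (forall i, cabs (a i) <= B) ->
  2 * c * w ^+ k' <= cabs (\sum_(i < k.+1) a i * divdiff y t i) ->
  delta * (B * \sum_(i < k.+1) linD K i) <= c ->
  c * w ^+ k' <= cabs (\sum_(i < k.+1) a i * linpart n l E r i).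
Proof.
move=> kk aB h1 h2; have wp : 0 < w by apply: lt_le_trans w1.
have B0 : 0 <= B := le_trans (cabs_ge0 _) (aB ord0).
rewrite -(ler_pM2l wp); set S := \sum_(i < _) _ in h1; set T := \sum_(i < _) _ * linpart _ _ _ _ _.
have h3 : w * cabs (T - S) <= c * w ^+ k.
  apply: (@le_trans _ _ (\sum_(i < k.+1) B * (delta * linD K i * w ^+ k))).
    rewrite /T /S -sumrB; apply: le_trans (ler_wpM2l w0 (cabs_sum _ _ _)) _.
    rewrite mulr_sumr; apply: ler_sum => i _.
    have ik : (i <= k)%N by rewrite -ltnS.
    rewrite -mulrBr cabsM mulrCA; apply: ler_pM; rewrite ?mulr_ge0 ?cabs_ge0//.
    apply: le_trans (linpart_close ik) _.
    by rewrite ler_wpM2l ?mulr_ge0 ?linD_ge0// ler_weXn2l.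
  rewrite -mulr_sumr -mulr_suml mulrA ler_wpM2r ?exprn_ge0//.
  by rewrite -mulr_sumr mulrCA.
have h4 : cabs S <= cabs T + cabs (T - S).
  by apply: le_trans (cabsB T (T - S)); rewrite opprB addrC subrK.
have h5 := ler_wpM2l w0 (le_trans h1 h4).
have h6 : c * w ^+ k = w * (c * w ^+ k') by rewrite kk exprS; ring.
move: h3 h5; rewrite h6 mulrDr -[2 * c * _]mulrA [w * (2 * _)]mulrCA.
by move=> ? ?; lra.
Qed.
End LinearPart.

(** * The zeros of the eigenpolynomials stay bounded *)

Section PowerSums.
Variable R : realType.
Local Notation C := R[i].

Lemma le1_of_bounded_powers (x D : R) : 0 <= x ->
  (forall r, (0 < r)%N -> x ^+ r <= D) -> x <= 1.
Proof.
move=> x0 h; rewrite leNgt; apply/negP => x1.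
have b r : 1 + r%:R * (x - 1) <= x ^+ r.
  elim: r => [|r IH]; first by rewrite mul0r addr0 expr0.
  rewrite exprS; apply: le_trans (ler_wpM2l x0 IH).
  rewrite -natr1 -subr_ge0 (_ : _ - _ = r%:R * (x - 1) ^+ 2); last by ring.
  by rewrite mulr_ge0// sqr_ge0.
have x10 : 0 < x - 1 by rewrite subr_gt0.
have D0 : 0 <= D by apply: le_trans (h 1%N _).
pose r := Num.Def.truncn (D / (x - 1)).
have hr : D < r.+1%:R * (x - 1).
  by rewrite -ltr_pdivrMr// truncnS_gt.
have := le_trans (b r.+1) (h r.+1 isT).
by rewrite leNgt (lt_trans hr)// ltrDr.
Qed.

(** Testing the power sums against the polynomial that vanishes at every other
    point of [s] isolates one point. *)
Lemma psum_root_bound (s : seq C) (rho K : R) : 0 < rho ->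
  (forall r, (0 < r)%N -> cabs (psum s r) * rho ^+ r <= K) ->
  forall z, z \in s -> cabs z * rho <= 1.
Proof.
move=> rho0 hs z zs.
(* Repetitions only multiply the value at [z] by a positive integer. *)
pose W : {poly C} := \prod_(x <- undup s | x != z) ('X - x%:P).
have Wz : W.[z] != 0.
  rewrite /W horner_prod prodf_seq_neq0; apply/allP => x _; apply/implyP => xz.
  by rewrite hornerXsubC subr_eq0 eq_sym.
have Wx x : x \in s -> x != z -> W.[x] = 0.
  move=> xs xz; apply/eqP; rewrite /W horner_prod prodf_seq_eq0.
  apply/hasP; exists x; rewrite ?mem_undup// xz hornerXsubC subrr eqxx//.
have key r : \sum_(j < size W) W`_j * psum s (r + j) = (count_mem z s)%:R * (z ^+ r * W.[z]).
  have -> : \sum_(j < size W) W`_j * psum s (r + j) = \sum_(x <- s) x ^+ r * W.[x].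
    rewrite /psum; under eq_bigr do rewrite mulr_sumr.
    rewrite exchange_big /=; apply: eq_bigr => x _.
    rewrite horner_coef mulr_sumr; apply: eq_bigr => j _.
    by rewrite exprD mulrCA.
  rewrite (bigID (pred1 z)) /= [X in _ + X]big_seq_cond [X in _ + X]big1 ?addr0; last first.
    by move=> x /andP[xs xz]; rewrite Wx// mulr0.
  rewrite (eq_bigr (fun=> z ^+ r * W.[z])); last by move=> x /eqP ->.
  by rewrite big_const_seq iter_addr_0 mulr_natl.
have c0 : (0 < count_mem z s)%N by rewrite -has_count has_pred1.
apply: (@le1_of_bounded_powers _
   ((\sum_(j < size W) cabs W`_j * K / rho ^+ j) / cabs W.[z])).
  by rewrite mulr_ge0 ?cabs_ge0// ltW.
move=> r r0; rewrite ler_pdivlMr ?cabs_gt0//.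
rewrite exprMn mulrAC -cabsX -cabsM.
apply: (@le_trans _ _ (cabs ((count_mem z s)%:R * (z ^+ r * W.[z])) * rho ^+ r)).
  rewrite ler_wpM2r ?exprn_ge0 ?(ltW rho0)// [leRHS]cabsM cabs_nat ler_peMl ?cabs_ge0//.
  by rewrite ler1n.
rewrite -key; apply: le_trans (ler_wpM2r _ (cabs_sum _ _ _)) _.
  by rewrite exprn_ge0// ltW.
rewrite mulr_suml; apply: ler_sum => j _; rewrite cabsM -!mulrA.
apply: ler_wpM2l; first exact: cabs_ge0.
rewrite ler_pdivlMr ?exprn_gt0// -mulrA -exprD; apply: hs.
by rewrite addn_gt0 r0.
Qed.
End PowerSums.

Section RootBound.
Variable R : realType.
Local Notation C := R[i].

(** A real number stays at distance at least |Im g| from [g], and this distance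
    grows like the number itself. *)
Lemma nonreal_dist (g : C) : complex.Im g != 0 ->
  exists2 c : R, 0 < c & forall x : R, 0 <= x -> c * (1 + x) <= cabs (x%:C - g).
Proof.
move=> g0; set b := `|complex.Im g|.
have b0 : 0 < b by rewrite normr_gt0.
have d0 : 0 < b + (cabs g + 1) by rewrite ltr_wpDr// addr_ge0 ?cabs_ge0.
exists (b / (b + (cabs g + 1))); first by rewrite divr_gt0.
move=> x x0; rewrite mulrAC ler_pdivrMr//.
have h1 : b <= cabs (x%:C - g).
  by apply: le_trans (Im_le_cabs _); rewrite raddfB /= sub0r normrN.
have h2 : x <= cabs (x%:C - g) + cabs g.
  rewrite -[leLHS]ger0_norm// -cabs_real -{1}(subrK g x%:C); exact: cabsD.
have h3 := cabs_ge0 g; set d := cabs (_ - g) in h1 h2 *; set m := cabs g in h2 h3 *.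
have : b * (1 + x) <= b * (1 + (d + m)) by rewrite ler_pM2l// lerD2l.
have : b * (1 + m) <= d * (1 + m) by rewrite ler_wpM2r// addr_ge0.
by nra.
Qed.

Variable k' : nat.
Local Notation k := k'.+1.
Variables (Q : 'I_k.+1 -> {poly C}) (y : 'I_k -> C) (a : C).
Hypothesis hQ : forall i : 'I_k.+1, (size (Q i) <= i.+1)%N.
Hypothesis a0 : a != 0.
Hypothesis hchi : \sum_(i < k.+1) (Q i)`_i *: 'X^i = a *: \prod_(j < k) ('X - (y j)%:P).

Section OneRoot.
Variable j : 'I_k.
Hypothesis yj0 : y j != 0.
Hypothesis yj : forall m, m != j -> complex.Im (y m / y j) != 0.

(** The sum is the divided difference between y_j t and y_j of the polynomial
    with the roots y_m, that is, the product of the y_j t - y_m over m distinct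
    from j. As t is real and y_m / y_j is not, each factor is bounded below. *)
Lemma divdiff_ge : exists2 c : R, 0 < c & forall r n, (0 < r)%N -> (0 < n)%N ->
  2 * c * wt R n r ^+ k' <=
  cabs (\sum_(i < k.+1) (Q i)`_i * divdiff (y j) (1 - r%:R / n%:R) i).
Proof.
have /choice[d hd] : forall m : 'I_k, exists d : R, 0 < d /\ (m != j ->
    forall x : R, 0 <= x -> d * (1 + x) <= cabs (y j * (1 - x%:C) - y m)).
  move=> m; have [->|mj] := eqVneq m j; first by exists 1.
  have /nonreal_dist[c c0 hc] : complex.Im (1 - y m / y j) != 0.
    by rewrite raddfB /= sub0r oppr_eq0 yj.
  exists (cabs (y j) * c); split; first by rewrite mulr_gt0 ?cabs_gt0.
  move=> _ x x0; rewrite -mulrA.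
  have -> : y j * (1 - x%:C) - y m = - (y j * (x%:C - (1 - y m / y j))) by field.
  by rewrite cabsN cabsM ler_wpM2l ?cabs_ge0// hc.
exists (cabs a * \prod_(m < k | m != j) d m / 2).
  rewrite divr_gt0// mulr_gt0 ?cabs_gt0// prodr_gt0// => m _; by case: (hd m).
move=> r n r0 n0; rewrite mulrCA divff ?pnatr_eq0// mulr1.
set t : C := 1 - _; set S := \sum_(i < _) _.
have xE : r%:R / n%:R = (r%:R / n%:R : R)%:C.
  by rewrite rmorphM fmorphV !rmorph_nat.
have t1 : t - 1 != 0.
  by rewrite /t addrAC subrr add0r oppr_eq0 mulf_neq0 ?invr_eq0// pnatr_eq0 -lt0n.
have hS : S * (y j * t - y j) = a * \prod_(m < k) (y j * t - y m).
  have hh x : (\sum_(i < k.+1) (Q i)`_i * x ^+ i) = a * \prod_(m < k) (x - y m).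
    have := congr1 (fun p : {poly C} => p.[x]) hchi.
    rewrite horner_sum hornerZ horner_prod => h.
    rewrite -[LHS](_ : \sum_(i < k.+1) ((Q i)`_i *: 'X^i).[x] = _).
      by rewrite h; congr (_ * _); apply: eq_bigr => m _; rewrite hornerXsubC.
    by apply: eq_bigr => i _; rewrite hornerZ hornerXn.
  have e0 : \sum_(i < k.+1) (Q i)`_i * (y j) ^+ i = 0.
    by rewrite hh (bigD1 j)//= subrr mul0r mulr0.
  rewrite -hh -[RHS]subr0 -[X in _ = _ - X]e0 -sumrB mulr_suml; apply: eq_bigr => i _.
  by rewrite -mulrA divdiffE mulrBr.
have -> : S = a * \prod_(m < k | m != j) (y j * t - y m).
  apply: (mulIf (mulf_neq0 yj0 t1)).
  have -> : y j * (t - 1) = y j * t - y j by rewrite mulrBr mulr1.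
  by rewrite hS (bigD1 j)//= mulrAC mulrA.
rewrite cabsM cabs_prod -mulrA; apply: ler_wpM2l; first exact: cabs_ge0.
have -> : wt R n r ^+ k' = \prod_(m < k | m != j) wt R n r.
  rewrite prodr_const; congr (_ ^+ _).
  by rewrite (cardC1 j) card_ord.
rewrite -big_split; apply: ler_prod => m mj /=.
have [dm0 hm] := hd m; rewrite mulr_ge0 ?wt_ge0 ?(ltW dm0)//= /t xE.
by apply: (hm mj (r%:R / n%:R)); rewrite mulr_ge0// invr_ge0.
Qed.

(** The constants are chosen in this order: [K] and [B] from the equation, [eps]
    so that the linear part keeps half of its limiting lower bound, [eta] and
    [rho] so that the majorant closes. The bound does not depend on the number
    of zeros. *)
Theorem roots_bounded : exists eps R0 : R, 0 < eps /\
  forall (s : seq C) (l c : C), (0 < size s)%N -> l != 0 -> c != 0 ->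
  cabs ((size s)%:R / l - y j) <= eps -> k%:R / cabs l <= eps ->
  let p := c *: \prod_(x <- s) ('X - x%:P) in
  \sum_(i < k.+1) l ^+ (k - i) *: (Q i * p^`(i)) = 0 ->
  forall z, z \in s -> cabs z <= R0.
Proof.
have [c c0 hc] := divdiff_ge.
pose al i := (revp (nat_of_ord i) (Q i)).
pose B := \sum_(i < k.+1) \sum_(r < k.+1) cabs (al i)`_r.
pose K := (cabs (y j) + 1) * k.+1%:R.
pose D := B * \sum_(i < k.+1) linD K i.
pose G := majG k K B.
have K0 : 0 <= K by rewrite mulr_ge0// addr_ge0 ?cabs_ge0.
have B0 : 0 <= B by apply: sumr_ge0 => i _; apply: sumr_ge0 => r _; exact: cabs_ge0.
have D0 : 0 <= D by rewrite mulr_ge0// sumr_ge0// => i _; exact: linD_ge0.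
have G0 : 0 <= G by exact: majG_ge0.
pose eps := Num.min 1 (c / (D + 1)).
pose eta := Num.min 1 (c / (2 * (G + 1))).
pose rho := Num.min 1 (c * eta / (2 * (G + 1))).
have D1 : 0 < D + 1 by lra.
have G1 : 0 < 2 * (G + 1) by lra.
have eps0 : 0 < eps by rewrite lt_min ltr01 divr_gt0.
have eta0 : 0 < eta by rewrite lt_min ltr01 divr_gt0.
have rho0 : 0 < rho by rewrite lt_min ltr01 divr_gt0// mulr_gt0.
have eps1 : eps <= 1 by rewrite ge_min lexx.
have eta1 : eta <= 1 by rewrite ge_min lexx.
have rho1 : rho <= 1 by rewrite ge_min lexx.
have hGe : G * (eta ^+ 2 + rho) <= c * eta.
  have h1 : eta * (2 * (G + 1)) <= c by rewrite -ler_pdivlMr// ge_min lexx orbT.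
  have h2 : rho * (2 * (G + 1)) <= c * eta by rewrite -ler_pdivlMr// ge_min lexx orbT.
  have h3 := ler_wpM2r (ltW eta0) h1.
  by rewrite mulrDr expr2; nra.
have hD : eps * D <= c.
  have h1 : eps * (D + 1) <= c by rewrite -ler_pdivlMr// ge_min lexx orbT.
  by apply: le_trans h1; rewrite ler_wpM2l ?(ltW eps0)// lerDl.
exists eps, rho^-1; split => // s l cc s0 l0 cc0 ly lk p pe z zs.
suff : cabs z * rho <= 1 by rewrite -ler_pdivlMr// div1r.
apply: (@psum_root_bound _ s rho (cabs l)) zs => // M M0.
have lK : (size s)%:R / cabs l * k.+1%:R <= K.
  rewrite ler_wpM2r// -(cabs_nat R (size s)) -cabs_div.
  rewrite -(subrK (y j) (_ / l)) addrC; apply: le_trans (cabsD _ _) _.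
  by rewrite lerD2l (le_trans ly).
have yK : cabs (y j) <= K.
  rewrite /K; have y0 := cabs_ge0 (y j).
  have k1 : 1 <= k.+1%:R :> R by rewrite ler1n.
  have : 0 <= (cabs (y j) + 1) * (k.+1%:R - 1) by rewrite mulr_ge0 ?subr_ge0 ?addr_ge0.
  by rewrite mulrBr mulr1 subr_ge0; apply: le_trans; rewrite lerDl.
pose v r := (logder_series s l M)`_r.
pose E i r := (hierarchy s l M i)`_r.
have vE r : (r <= M)%N -> v r = l^-1 * psum s r.
  by move=> rM; rewrite /v coefZ coef_poly ltnS rM.
have v0 : v 0 = (size s)%:R / l.
  by rewrite vE// mulrC psum0.
have E0 r : E 0 r = (r == 0)%:R by rewrite /E /= coef1.
have ES i r : E i.+1 r = \sum_(t < r.+1) E i t * v (r - t)%N - (i + r)%:R / l * E i r.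
  rewrite /E /= coefB coefZ mulrBr coefB coefM coefMC.
  have -> : ('X * (hierarchy s l M i)^`())`_r = r%:R * (hierarchy s l M i)`_r.
    rewrite coefXM coef_deriv; case: r => [|r] /=; first by rewrite mul0r.
    by rewrite mulr_natl.
  by rewrite natrD; ring.
have aE r : (r <= M)%N ->
    \sum_(i < k.+1) \sum_(t < r.+1) (al i)`_t * E i (r - t)%N = 0.
  move=> rM; have /dvdpP[q hq] := hierarchy_eq0 M hQ cc0 pe l0.
  have := congr1 (fun x : {poly C} => x`_r) hq.
  rewrite coefMXn ltnS rM coef_sum => h; etransitivity; last exact: h.
  by apply: eq_bigr => i _; rewrite coefM.
have aB i r : cabs (al i)`_r <= B.
  have [rk|rk] := ltnP r k.+1; last first.
    rewrite nth_default ?cabs0//; apply: leq_trans (size_poly _ _) _.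
    exact: leq_trans (ltn_ord i) _.
  rewrite /B (bigD1 i)//= (bigD1 (Ordinal rk))//= -addrA lerDl addr_ge0//.
    by apply: sumr_ge0 => ? _; exact: cabs_ge0.
  by apply: sumr_ge0 => ? _; apply: sumr_ge0 => ? _; exact: cabs_ge0.
have anorm i M' : wnorm (size s) rho 0 M' (fun r => (al i)`_r) <= B * rho.
  rewrite /wnorm; under eq_bigr do rewrite expr0 mul1r.
  apply: (@le_trans _ _ (\sum_(1 <= r < M'.+1) cabs (al i)`_r * rho)).
    apply: ler_sum_nat => r /andP[r0 _]; apply: ler_wpM2l; first exact: cabs_ge0.
    by case: r r0 => // r _; rewrite exprS ler_piMr ?(ltW rho0)// exprn_ile1 ?(ltW rho0).
  rewrite -mulr_suml; apply: ler_wpM2r; first exact: ltW.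
  apply: (@le_trans _ _ (\sum_(r < k.+1) cabs (al i)`_r)); last first.
    by rewrite /B [leRHS](bigD1 i)//= lerDl sumr_ge0// => ? _; apply: sumr_ge0 => ? _; exact: cabs_ge0.
  have al0 r : (k < r)%N -> cabs (al i)`_r = 0.
    move=> kr; rewrite nth_default ?cabs0//; apply: leq_trans (size_poly _ _) _.
    exact: leq_trans (ltn_ord i) _.
  rewrite -(big_mkord xpredT (fun r => cabs (al i)`_r)) [leRHS]big_ltn//.
  apply: (@le_trans _ _ (\sum_(1 <= r < k.+1) cabs (al i)`_r)); last by rewrite lerDr cabs_ge0.
  have [Mk|kM] := leqP M' k.
    rewrite [leRHS](@big_cat_nat _ _ _ M'.+1)//= lerDl.
    by apply: sumr_ge0 => ? _; exact: cabs_ge0.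
  rewrite (@big_cat_nat _ _ _ k.+1)//=; last by rewrite ltnW.
  rewrite [X in _ + X]big_nat [X in _ + X]big1 ?addr0// => r /andP[kr _].
  exact: al0.
have lin r : (0 < r <= M)%N -> c * wt R (size s) r ^+ k' <=
    cabs (\sum_(i < k.+1) (al i)`_0 * linpart (size s) l E r i).
  move=> /andP[r0 rM].
  apply: (@linpart_ge _ k (size s) r l (y j) K eps E s0 K0 yK lK _ _ ly lk k' _ B c erefl) => //.
  - move=> i; rewrite ES big_ord1 subnn v0 addn0; ring.
  - have := hc r _ r0 s0; congr (_ <= cabs _); apply: eq_bigr => i _; congr (_ * _).
    by rewrite coef_poly /= subn0.
have := @majorant _ k' (size s) M l rho K B c v E (fun i r => (al i)`_r)
  s0 rho0 K0 lK v0 E0 (fun i r _ => ES i r) aE (fun i => aB i 0%N) anorm c0 lin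
  eta eta0 eta1 hGe M (leqnn _).
case: M M0 @v @E vE v0 E0 ES aE lin => // M _ v E vE v0 E0 ES aE lin.
rewrite wnormS => h.
have {}h : cabs (v M.+1) * (wt R (size s) M.+1 ^+ k' * rho ^+ M.+1) <= 1.
  apply: le_trans eta1; apply: le_trans h; rewrite lerDr; exact: wnorm_ge0.
have w1 : 1 <= wt R (size s) M.+1 ^+ k' by rewrite exprn_ege1// wt_ge1.
have -> : psum s M.+1 = l * v M.+1 by rewrite vE// mulrA divff// mul1r.
rewrite cabsM -mulrA ler_piMr ?cabs_ge0//; apply: le_trans h.
apply: ler_wpM2l; first exact: cabs_ge0.
by rewrite ler_peMl// exprn_ge0// ltW.
Qed.
End OneRoot.
End RootBound.

(** * An integrable kernel dominating |z - w|^(-3/2) *)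

Section Kernel.
Variable R : realType.
Local Notation C := R[i].
Local Notation T := (R * R)%type.
Local Notation mu := (@lebesgue_measure R \x @lebesgue_measure R)%E.

Definition cplx (z : T) : C := z.1 +i* z.2.

Definition box (x y r : R) : set T :=
  `[x - r, x + r]%classic `*` `[y - r, y + r]%classic.

(** On the shell 4^-(q+1) < |z - w| <= 4^-q the power -3/2 of the distance is at
    most 8^(q+1). The sum of these steps is comparable to that power, but
    measurability and the integral are immediate: a square of half-side 4^-q
    contributes at most 8^(q+1) 4 (4^-q)^2 = 32 2^-q. *)
Definition kern_shell (w : C) (q : nat) (z : T) : \bar R :=
  ((8 ^+ q.+1)%:E * (\1_(box (complex.Re w) (complex.Im w) (4 ^- q)) z)%:E)%E.

(** The value is +oo at [w]: the inequalities below then hold everywhere, with no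
    exceptional point, although 1/0 is 0. *)
Definition kern (w : C) (z : T) : \bar R :=
  (1 + \sum_(0 <= q <oo) kern_shell w q z)%E.

Definition boxM (M : nat) : set T := box 0 0 M%:R.
Definition kern_int (M : nat) : R := (2 * M%:R) ^+ 2 + 64.

Lemma measurable_box x y r : measurable (box x y r).
Proof. by apply: measurableX; exact: measurable_itv. Qed.

Lemma mu_box x y r : 0 <= r -> mu (box x y r) = ((2 * r) ^+ 2)%:E.
Proof.
move=> r0; rewrite product_measure1E//.
have h (c : R) : @lebesgue_measure R `[c - r, c + r]%classic = (2 * r)%:E.
  rewrite lebesgue_measure_itv /=; case: ifPn => hr.
    by rewrite -EFinB; congr (_%:E); ring.
  congr (_%:E); move: hr; rewrite lte_fin -leNgt => hr; lra.
transitivity ((2 * r)%:E * (2 * r)%:E)%E; last by rewrite -EFinM expr2.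
by congr (_ * _)%E; exact: h.
Qed.

Lemma nneseries_le (u : (\bar R)^nat) (c : \bar R) : (forall q, 0 <= u q)%E ->
  (forall n, \sum_(0 <= q < n) u q <= c)%E -> (\sum_(0 <= q <oo) u q <= c)%E.
Proof.
move=> u0 h; apply: lime_le; first by apply: is_cvg_nneseries => *; exact: u0.
exact: nearW.
Qed.

Lemma sum_inv_pow2_le n : \sum_(0 <= q < n) 2 ^- q <= 2 :> R.
Proof.
suff -> : \sum_(0 <= q < n) 2 ^- q = 2 - 2 * 2 ^- n :> R.
  have : 0 <= 2 ^- n :> R by rewrite invr_ge0 exprn_ge0.
  lra.
elim: n => [|n IH]; first by rewrite big_geq// expr0 invr1 mulr1 subrr.
rewrite big_nat_recr//= IH exprS.
have h2 : 2 ^+ n != 0 :> R by rewrite expf_neq0.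
by move: (2 ^+ n) h2 => a ha; field.
Qed.

Lemma kern_shell_ge0 (w : C) q z : (0 <= kern_shell w q z)%E.
Proof. by rewrite mule_ge0// lee_fin ?exprn_ge0. Qed.

#[local] Hint Resolve kern_shell_ge0 : core.

Lemma measurable_kern_shell (w : C) q : measurable_fun setT (kern_shell w q).
Proof.
apply: measurable_funeM; apply/measurable_EFinP.
by apply: measurable_indic; exact: measurable_box.
Qed.

#[local] Hint Resolve measurable_kern_shell : core.

Lemma kern_ge1 w z : (1 <= kern w z)%E.
Proof. by rewrite /kern leeDl// nneseries_ge0. Qed.

Lemma kern_ge0 w z : (0 <= kern w z)%E.
Proof. by apply: le_trans (kern_ge1 w z); rewrite lee_fin. Qed.

Lemma measurable_kern w : measurable_fun setT (kern w).
Proof.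
apply: emeasurable_funD; first exact: measurable_cst.
exact: (@ge0_emeasurable_sum _ _ _ _ _ xpredT).
Qed.

Lemma integral_kern w M : (\int[mu]_(z in boxM M) kern w z <= (kern_int M)%:E)%E.
Proof.
have mM : measurable (boxM M) by exact: measurable_box.
rewrite ge0_integralD//; last 2 first.
- by move=> *; apply: nneseries_ge0.
- apply: (@ge0_emeasurable_sum _ _ _ _ _ xpredT) => // q _.
  by apply: measurable_funTS; exact: measurable_kern_shell.
have mb : (mu (boxM M) <= ((2 * M%:R) ^+ 2)%:E)%E by rewrite mu_box.
rewrite integral_cst// mul1e /kern_int EFinD; apply: leeD; first exact: mb.
rewrite integral_nneseries//; last first.
  by move=> q; apply: measurable_funTS; exact: measurable_kern_shell.
apply: nneseries_le.
  by move=> q; apply: integral_ge0 => z _.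
move=> n; apply: (@le_trans _ _ (\sum_(0 <= q < n) (32 * 2 ^- q)%:E)%E).
  apply: lee_sum => q _; rewrite ge0_integralZl_EFin//; last first.
    apply: measurable_funTS; apply/measurable_EFinP.
    by apply: measurable_indic; exact: measurable_box.
  rewrite integral_indic//; last exact: measurable_box.
  apply: (@le_trans _ _ ((8 ^+ q.+1)%:E * mu (box (complex.Re w) (complex.Im w) (4 ^- q)))%E).
    apply: lee_wpmul2l; first by rewrite lee_fin exprn_ge0.
    apply: le_measure; rewrite ?inE//; [apply: measurableI => //|]; exact: measurable_box.
  have -> : mu (box (complex.Re w) (complex.Im w) (4 ^- q)) = ((2 * 4 ^- q) ^+ 2)%:E.
    by rewrite mu_box// invr_ge0 exprn_ge0.
  rewrite -EFinM lee_fin exprMn exprVn -exprM mulnC exprM.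
  have -> : 4 ^+ 2 = 8 * 2 :> R by ring.
  rewrite exprMn invfM exprS.
  have h8 : 8 ^+ q != 0 :> R by rewrite expf_neq0.
  have h2 : 2 ^+ q != 0 :> R by rewrite expf_neq0.
  rewrite le_eqVlt; apply/orP; left; apply/eqP.
  by move: (8 ^+ q) (2 ^+ q) h8 h2 => a b ha hb; field; rewrite ha hb.
rewrite sumEFin lee_fin -mulr_sumr.
by apply: le_trans (ler_wpM2l _ (sum_inv_pow2_le n)) _ => //; lra.
Qed.

Lemma kern_term w z q : cabs (cplx z - w) <= 4 ^- q -> ((8 ^+ q.+1)%:E <= kern w z)%E.
Proof.
move=> h; rewrite /kern; apply: (@le_trans _ _ (\sum_(0 <= q <oo) kern_shell w q z)%E); last first.
  by rewrite leeDr.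
apply: le_trans (nneseries_lim_ge q.+1 _); last by [].
rewrite big_nat_recr//= -[leLHS]add0e leeD//; first by apply: sume_ge0.
rewrite /kern_shell indicE mem_set ?mule1//.
have h1 := le_trans (Re_le_cabs _) h; have h2 := le_trans (Im_le_cabs _) h.
move: h1 h2; rewrite !raddfB /= !ler_norml => /andP[? ?] /andP[? ?].
by split; rewrite /= in_itv /=; apply/andP; split; lra.
Qed.

(** Where the kernel is finite, it dominates the power -3/2 of the distance,
    written with the square root of the inverse distance. *)
Lemma kern_fin w z (a : R) : kern w z = a%:E ->
  cplx z != w /\ Num.sqrt (cabs (cplx z - w))^-1 ^+ 3 <= a.
Proof.
move=> ka; have h q : cabs (cplx z - w) <= 4 ^- q -> 8 ^+ q.+1 <= a.
  by move=> /kern_term; rewrite ka lee_fin.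
have a1 : 1 <= a by rewrite -lee_fin -ka kern_ge1.
have b8 q : q%:R <= 8 ^+ q :> R.
  rewrite -natrX ler_nat; apply: ltnW; exact: ltn_expl.
set d := cabs _ in h *.
have d0 : 0 <= d := cabs_ge0 _.
have zw : cplx z != w.
  apply/negP => /eqP zw; have d00 : d = 0 by rewrite /d zw subrr cabs0.
  have := h (Num.Def.truncn a); rewrite d00 invr_ge0 exprn_ge0// => /(_ isT).
  rewrite leNgt => /negP; apply.
  apply: lt_le_trans (b8 _); exact: truncnS_gt.
split => //; have dp : 0 < d by rewrite cabs_gt0 subr_eq0.
have [d1|d1] := leP d 1; last first.
  apply: le_trans a1; rewrite exprn_ile1 ?sqrtr_ge0// -sqrtr1 ler_wsqrtr// invf_le1// ltW//.
have ex : exists q, 4 ^- q.+1 < d.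
  exists (Num.Def.truncn d^-1); rewrite -[ltRHS]invrK ltf_pV2 ?posrE ?exprn_gt0 ?invr_gt0//.
  apply: (lt_le_trans (truncnS_gt _)); rewrite -natrX ler_nat.
  by apply: ltnW; exact: ltn_expl.
have [q hq qmin] := ex_minnP ex.
have dq : d <= 4 ^- q.
  case: q hq qmin => [|q] hq qmin; first by rewrite expr0 invr1.
  by rewrite leNgt; apply/negP => /qmin; rewrite ltnn.
apply: le_trans (h q dq).
have -> : 8 ^+ q.+1 = (2 ^+ q.+1) ^+ 3 :> R.
  by rewrite -exprM mulnC exprM; congr (_ ^+ _); ring.
apply: lerXn2r; rewrite ?nnegrE ?sqrtr_ge0 ?exprn_ge0//.
rewrite -[leRHS]ger0_norm ?exprn_ge0// -sqrtr_sqr; apply: ler_wsqrtr.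
rewrite -exprM mulnC exprM (_ : 2 ^+ 2 = 4 :> R); last by ring.
by rewrite -[leRHS]invrK lef_pV2 ?posrE ?invr_gt0 ?exprn_gt0// ltW.
Qed.
End Kernel.

(** * Compactness of Cauchy transforms in the mean *)

Section Small.
Variable R : realType.
Local Notation C := R[i].
Local Notation T := (R * R)%type.
Local Notation mu := (@lebesgue_measure R \x @lebesgue_measure R)%E.

(** Integrals over all the boxes are measured against those of one kernel, so
    that one number [t] controls all of them. *)
Definition small (G : T -> \bar R) (t : R) : Prop :=
  [/\ measurable_fun setT G, (forall z, (0 <= G z)%E) &
      forall M, (\int[mu]_(z in boxM M) G z <= (t * kern_int R M)%:E)%E].

Lemma kern_int_ge0 M : 0 <= kern_int R M.
Proof. by rewrite /kern_int addr_ge0// exprn_ge0// mulr_ge0. Qed.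

Lemma small_le G t t' : t <= t' -> small G t -> small G t'.
Proof.
move=> tt [mG G0 iG]; split => // M; apply: le_trans (iG M) _.
by rewrite lee_fin ler_wpM2r ?kern_int_ge0.
Qed.

Lemma small_kern w : small (kern w) 1.
Proof.
split; [exact: measurable_kern|exact: kern_ge0|].
by move=> M; rewrite mul1r; exact: integral_kern.
Qed.

Lemma small0 : small (fun=> 0%E) 0.
Proof.
by split => // M; rewrite integral0 mul0r.
Qed.

Lemma smallD G H t u : small G t -> small H u -> small (fun z => G z + H z)%E (t + u).
Proof.
move=> [mG G0 iG] [mH H0 iH]; split.
- exact: emeasurable_funD.
- by move=> z; apply: adde_ge0.
- move=> M; rewrite ge0_integralD//; last 3 first.
  + exact: measurable_box.
  + by apply: measurable_funTS; exact: mG.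
  + by apply: measurable_funTS; exact: mH.
  by rewrite mulrDl EFinD; apply: leeD; [exact: iG|exact: iH].
Qed.

Lemma smallZ G c t : 0 <= c -> small G t -> small (fun z => c%:E * G z)%E (c * t).
Proof.
move=> c0 [mG G0 iG]; split.
- exact: measurable_funeM.
- by move=> z; apply: mule_ge0.
- move=> M; rewrite ge0_integralZl_EFin//; last 2 first.
  + exact: measurable_box.
  + by apply: measurable_funTS; exact: mG.
  by rewrite -mulrA EFinM; apply: lee_wpmul2l; [rewrite lee_fin|exact: iG].
Qed.

Lemma small_sum (I : Type) (s : seq I) (G : I -> T -> \bar R) t :
  (forall i, small (G i) t) -> small (fun z => \sum_(i <- s) G i z)%E ((size s)%:R * t).
Proof.
move=> h; elim: s => [|i s IH].
  rewrite mul0r; under eq_fun do rewrite big_nil; exact: small0.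
under eq_fun do rewrite big_cons.
by rewrite /= -natr1 mulrDl mul1r addrC; apply: smallD.
Qed.

(** * Cauchy transforms of two clouds with the same coarse statistics *)

Definition cauchy (s : seq C) (Z : C) : C :=
  (size s)%:R^-1 * \sum_(x <- s) (Z - x)^-1.

Lemma inv_le_kern (c : C) (z : T) : ((cabs (cplx z - c)^-1)%:E <= kern c z)%E.
Proof.
have := kern_ge1 c z; case E : (kern c z) => [a| |]//; rewrite ?leey//.
rewrite !lee_fin => a1; have [zc h] := kern_fin E.
rewrite cabsV; set X := (cabs _)^-1 in h *.
have X0 : 0 <= X by rewrite invr_ge0 cabs_ge0.
have b0 : 0 <= Num.sqrt X := sqrtr_ge0 X.
rewrite -(sqr_sqrtr X0); set b := Num.sqrt X in h b0 *.
have [b1|b1] := leP b 1; first by apply: le_trans a1; rewrite exprn_ile1.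
by apply: le_trans h; rewrite ler_weXn2l// ltW.
Qed.

(** With X = |z - x| and Y = |z - c|, the difference is at most
    |x - c| / (X Y). As |x - c| is at most d^2 and at most X + Y, it is at most
    d (X^(1/2) + Y^(1/2)), and X^(-1/2) Y^-1 + X^-1 Y^(-1/2) is at most
    X^(-3/2) + Y^(-3/2). *)
Lemma inv_diff_kern (x c : C) (z : T) (d : R) : 0 < d -> cabs (x - c) <= d ^+ 2 ->
  ((cabs ((cplx z - x)^-1 - (cplx z - c)^-1))%:E <= d%:E * (kern x z + kern c z))%E.
Proof.
move=> d0 xc; have := kern_ge0 x z; have := kern_ge0 c z.
case Ex : (kern x z) => [a| |]//; case Ec : (kern c z) => [b| |]//; rewrite ?addye ?addey//
  ?gt0_muley ?lte_fin ?leey// => _ _.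
rewrite -EFinD -EFinM lee_fin.
have [zx hx] := kern_fin Ex; have [zc hc] := kern_fin Ec.
have zx0 : cplx z - x != 0 by rewrite subr_eq0.
have zc0 : cplx z - c != 0 by rewrite subr_eq0.
have -> : (cplx z - x)^-1 - (cplx z - c)^-1 = (x - c) / ((cplx z - x) * (cplx z - c)).
  by field; rewrite zx0 zc0.
have hD : cabs (x - c) <= cabs (cplx z - x) + cabs (cplx z - c).
  rewrite (_ : x - c = (cplx z - c) - (cplx z - x)); last by ring.
  by rewrite [leRHS]addrC; exact: cabsB.
rewrite cabs_div cabsM.
have X0 : 0 < cabs (cplx z - x) by rewrite cabs_gt0.
have Y0 : 0 < cabs (cplx z - c) by rewrite cabs_gt0.
move: xc hD hx hc X0 Y0; move: (cabs (x - c)) (cabs_ge0 (x - c)) => D D0.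
move: (cabs _) (cabs _) => Y X xc hD hx hc X0 Y0.
have hs (t : R) : 0 < t -> exists2 s, 0 < s & t = s ^+ 2 /\ Num.sqrt t^-1 = s^-1.
  move=> t0; exists (Num.sqrt t); first by rewrite sqrtr_gt0.
  by rewrite sqr_sqrtr ?ltW// sqrtrV// ltW.
have [sx sx0 [eX eX']] := hs X X0; have [sy sy0 [eY eY']] := hs Y Y0.
rewrite eX' in hx; rewrite eY' in hc; rewrite eX eY in hD *.
have D1 : D <= d * (sx + sy).
  rewrite -(@ler_pXn2r _ 2) ?nnegrE ?mulr_ge0 ?addr_ge0 ?(ltW d0) ?(ltW sx0) ?(ltW sy0)//.
  apply: (@le_trans _ _ (d ^+ 2 * (sx ^+ 2 + sy ^+ 2))).
    by rewrite expr2; apply: ler_pM.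
  rewrite exprMn ler_wpM2l ?sqr_ge0// sqrrD addrAC lerDl.
  by rewrite mulrn_wge0// mulr_ge0 ?(ltW sx0) ?(ltW sy0).
apply: (@le_trans _ _ (d * (sx ^-1 ^+ 3 + sy ^-1 ^+ 3))); last first.
  by rewrite ler_pM2l// lerD.
apply: (@le_trans _ _ (d * (sx + sy) / (sx ^+ 2 * sy ^+ 2))).
  by rewrite ler_wpM2r// invr_ge0 mulr_ge0// sqr_ge0.
rewrite -mulrA ler_pM2l//.
have -> : (sx + sy) / (sx ^+ 2 * sy ^+ 2) = sx^-1 * sy^-1 ^+ 2 + sx^-1 ^+ 2 * sy^-1.
  by field; rewrite ?(lt0r_neq0 sx0) ?(lt0r_neq0 sy0).
have p0 : 0 <= sx^-1 by rewrite invr_ge0 ltW.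
have q0 : 0 <= sy^-1 by rewrite invr_ge0 ltW.
move: (sx^-1) (sy^-1) p0 q0 => p q p0 q0; rewrite -subr_ge0.
rewrite (_ : _ - _ = (p - q) ^+ 2 * (p + q)); last by ring.
by rewrite mulr_ge0 ?sqr_ge0 ?addr_ge0.
Qed.

Section Cells.
Variables (cs : seq C) (d : R).
Hypothesis d0 : 0 < d.

Definition cell (x : C) : nat := find (fun c => cabs (x - c) <= d ^+ 2) cs.
Definition cell_count (i : nat) (s : seq C) : nat := count (fun x => cell x == i) s.

Definition near_centers (s : seq C) :=
  forall x, x \in s -> exists2 c, c \in cs & cabs (x - c) <= d ^+ 2.

Let ctr x := nth 0 cs (cell x).

Lemma cell_lt s x : near_centers s -> x \in s -> (cell x < size cs)%N.
Proof. by move=> h /h[c cc xc]; rewrite -has_find; apply/hasP; exists c. Qed.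

Lemma ctr_close s x : near_centers s -> x \in s -> cabs (x - ctr x) <= d ^+ 2.
Proof.
move=> h xs; have := cell_lt h xs; rewrite -has_find => hh.
by have := nth_find 0 hh.
Qed.

Let A s Z : C := (size s)%:R^-1 * \sum_(x <- s) (Z - ctr x)^-1.

Let AE s Z : near_centers s ->
  A s Z = \sum_(i < size cs) ((cell_count i s)%:R / (size s)%:R) * (Z - nth 0 cs i)^-1.
Proof.
move=> h; rewrite /A mulr_sumr.
transitivity (\sum_(x <- s) \sum_(i < size cs | i == cell x :> nat)
   (size s)%:R^-1 * (Z - nth 0 cs i)^-1).
  rewrite big_seq [RHS]big_seq; apply: eq_bigr => x xs.
  rewrite (big_pred1 (Ordinal (cell_lt h xs)))//.
under eq_bigr do rewrite big_mkcond.
rewrite exchange_big /=; apply: eq_bigr => i _.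
rewrite -big_mkcond /= /cell_count.
rewrite -big_filter big_const_seq count_predT iter_addr_0 size_filter.
rewrite -[LHS]mulr_natl [LHS]mulrA; congr (_%:R / _ / _).
by apply: eq_count => x; rewrite eq_sym.
Qed.

(** Moving every point to the center of its cell costs 2 [d] for each cloud;
    after that only the proportions of points per cell matter. *)
Lemma cauchy_close s s' (eta : R) : near_centers s -> near_centers s' ->
  (0 < size s)%N -> (0 < size s')%N -> 0 <= eta ->
  (forall i, (i < size cs)%N ->
   `|(cell_count i s)%:R / (size s)%:R - (cell_count i s')%:R / (size s')%:R| <= eta) ->
  exists2 G, small G (4 * d + (size cs)%:R * eta) &
    forall z, ((cabs (cauchy s (cplx z) - cauchy s' (cplx z)))%:E <= G z)%E.
Proof.
move=> hs hs' n0 n0' eta0 he.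
pose P s z := ((size s)%:R^-1%:E * \sum_(x <- s) (d%:E * (kern x z + kern (ctr x) z)))%E.
have sP t : (0 < size t)%N -> small (P t) (2 * d).
  move=> t0; have -> : 2 * d = (size t)%:R^-1 * ((size t)%:R * (d * (1 + 1))).
    by rewrite [RHS]mulrA mulVf ?pnatr_eq0 -?lt0n// mul1r; ring.
  apply: smallZ; first by rewrite invr_ge0.
  apply: small_sum => x; apply: smallZ; first exact: ltW.
  by apply: smallD; exact: small_kern.
have hP t z : near_centers t ->
    ((cabs (cauchy t (cplx z) - A t (cplx z)))%:E <= P t z)%E.
  move=> ht; rewrite /cauchy /A -mulrBr cabsM cabsV cabs_nat EFinM.
  apply: lee_wpmul2l; first by rewrite lee_fin invr_ge0.
  rewrite -sumrB; apply: (@le_trans _ _ (\sum_(x <- t) (cabs ((cplx z - x)^-1 - (cplx z - ctr x)^-1))%:E)%E).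
    by rewrite sumEFin lee_fin cabs_sum.
  rewrite big_seq [leRHS]big_seq; apply: lee_sum => x xt.
  by apply: inv_diff_kern => //; exact: ctr_close ht xt.
pose Q z := (\sum_(c <- cs) (eta%:E * kern c z))%E.
exists (fun z => (P s z + P s' z) + Q z)%E.
  have -> : 4 * d + (size cs)%:R * eta = (2 * d + 2 * d) + (size cs)%:R * (eta * 1) by ring.
  apply: smallD; first by apply: smallD; exact: sP.
  by apply: small_sum => c; apply: smallZ => //; exact: small_kern.
move=> z; set Z := cplx z.
have -> : cauchy s Z - cauchy s' Z =
  (cauchy s Z - A s Z) + (- (cauchy s' Z - A s' Z)) + (A s Z - A s' Z) by ring.
apply: (@le_trans _ _ ((cabs (cauchy s Z - A s Z))%:E + (cabs (cauchy s' Z - A s' Z))%:E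
   + (cabs (A s Z - A s' Z))%:E)%E).
  rewrite -!EFinD lee_fin; apply: le_trans (cabsD _ _) _; rewrite lerD2r.
  by apply: le_trans (cabsD _ _) _; rewrite cabsN.
apply: leeD; first by apply: leeD; exact: hP.
rewrite !AE// -sumrB /Q (big_nth 0) big_mkord.
apply: (@le_trans _ _ (\sum_(i < size cs) (eta * cabs (Z - nth 0 cs i)^-1)%:E)%E).
  rewrite sumEFin lee_fin; apply: le_trans (cabs_sum _ _ _) _; apply: ler_sum => i _.
  rewrite -mulrBl cabsM ler_wpM2r ?cabs_ge0//; apply: le_trans (he i (ltn_ord i)).
  rewrite -cabs_real rmorphB !rmorphM !fmorphV !rmorph_nat//.
apply: lee_sum => i _; rewrite EFinM; apply: lee_wpmul2l; first by rewrite lee_fin.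
exact: inv_le_kern.
Qed.
End Cells.
End Small.

Section Pigeonhole.

Definition unbounded (I : nat -> Prop) := forall n, exists m, (n <= m)%N /\ I m.

Lemma pigeonhole (F : finType) (code : nat -> F) (I : nat -> Prop) : unbounded I ->
  exists t, unbounded (fun n => I n /\ code n = t).
Proof.
move=> infI; apply: contrapT => /forallNP h.
have /choice[b hb] : forall t, exists b, forall m, (b <= m)%N -> ~ (I m /\ code m = t).
  move=> t; have /existsNP[b hb] := h t; exists b => m bm hm.
  by apply: hb; exists m.
have [m [hm Im]] := infI (\max_(t : F) b t).
by apply: (hb (code m) m) => //; apply: leq_trans hm; exact: (leq_bigmax (code m)).
Qed.

End Pigeonhole.

Section Net.
Variable R : realType.
Local Notation C := R[i].

Lemma finite_net (r d : R) : 0 < d ->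
  exists cs : seq C, forall x, cabs x <= r -> exists2 c, c \in cs & cabs (x - c) <= d.
Proof.
move=> d0; pose h := d / 2; have h0 : 0 < h by rewrite divr_gt0.
have [B rB] : exists B : nat, r <= B%:R * h.
  by exists (Num.Def.truncn (r / h)).+1; rewrite -ler_pdivrMr// ltW// truncnS_gt.
pose g (a : nat) : R := a%:R * h - B%:R * h.
pose ks := iota 0 (2 * B).+1.
have net u : `|u| <= r -> exists2 a, a \in ks & `|u - g a| <= h.
  rewrite ler_norml => /andP[u1 u2].
  have u0 : 0 <= (u + B%:R * h) / h by rewrite divr_ge0 ?(ltW h0)//; lra.
  have /andP[t1 t2] := truncn_itv u0.
  exists (Num.Def.truncn ((u + B%:R * h) / h)).
    rewrite mem_iota /= add0n ltnS -(ler_nat R); apply: le_trans t1 _.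
    rewrite ler_pdivrMr// natrM; lra.
  move: t1 t2; rewrite ler_pdivlMr// ltr_pdivrMr// => t1 t2.
  rewrite -(@natr1 R (Num.Def.truncn _)) mulrDl mul1r in t2.
  by rewrite /g ler_norml; apply/andP; split; lra.
exists [seq (g a)%:C + 'i * (g b)%:C | a <- ks, b <- ks].
move=> x xr.
have [a ak ha] := net _ (le_trans (Re_le_cabs x) xr).
have [b bk hb] := net _ (le_trans (Im_le_cabs x) xr).
exists ((g a)%:C + 'i * (g b)%:C); first by apply/allpairsP; exists (a, b).
apply: le_trans (cabs_le_ReIm _) _.
have -> : x - ((g a)%:C + 'i * (g b)%:C) = (complex.Re x - g a) +i* (complex.Im x - g b).
  by case: x {xr ha hb} => u v; simpc; rewrite ?addr0 ?add0r ?mul0r ?mul1r ?subr0.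
by rewrite (_ : d = h + h) ?lerD//= /h; field.
Qed.

(** Rounding the proportions of points per cell leaves finitely many codes. *)
Lemma finite_code (s : nat -> seq C) (N : nat) (r eps : R) : 0 < eps ->
  (forall n, (N <= n)%N -> (0 < size (s n))%N /\ forall x, x \in s n -> cabs x <= r) ->
  exists (F : finType) (code : nat -> F), forall n m, (N <= n)%N -> (N <= m)%N ->
    code n = code m -> exists2 G, small G eps &
      forall z, ((cabs (cauchy (s n) (cplx z) - cauchy (s m) (cplx z)))%:E <= G z)%E.
Proof.
move=> e0 hs; pose d := eps / 8; have d0 : 0 < d by rewrite divr_gt0.
have [cs hcs] := finite_net r (exprn_gt0 2 d0).
pose D := (Num.Def.truncn (2 * (size cs)%:R / eps)).+1.
have D0 : 0 < D%:R :> R by rewrite ltr0n.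
have hD : (size cs)%:R / D%:R <= eps / 2.
  rewrite ler_pdivrMr//; have : 2 * (size cs)%:R / eps < D%:R by exact: truncnS_gt.
  by rewrite ltr_pdivrMr// => ?; lra.
exists {ffun 'I_(size cs) -> 'I_D.+1}.
exists (fun n => [ffun i : 'I_(size cs) => inord (D * cell_count cs d i (s n) %/ size (s n))]).
move=> n m Nn Nm hc; have [n0 hn] := hs n Nn; have [m0 hm] := hs m Nm.
have key : forall i, (i < size cs)%N ->
   `|(cell_count cs d i (s n))%:R / (size (s n))%:R -
     (cell_count cs d i (s m))%:R / (size (s m))%:R| <= D%:R^-1 :> R.
  move=> i ic; have /ffunP/(_ (Ordinal ic)) := hc; rewrite !ffunE /=.
  have le_D k : (0 < size (s k))%N -> (D * cell_count cs d i (s k) %/ size (s k) < D.+1)%N.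
    move=> k0; rewrite ltnS -{2}(mulnK D k0); apply: leq_div2r.
    by rewrite leq_mul2l count_size orbT.
  move=> /(congr1 val); rewrite /= !inordK ?le_D//.
  move: (cell_count _ _ _ _) (cell_count _ _ _ _) (size _) (size _) n0 m0 => b a q p p0 q0 e.
  have bd (c t : nat) : (0 < t)%N -> (D * c %/ t)%N%:R <= D%:R * (c%:R / t%:R) :> R /\
      D%:R * (c%:R / t%:R) < (D * c %/ t)%N%:R + 1 :> R.
    move=> t0; have t0' : 0 < t%:R :> R by rewrite ltr0n.
    split; rewrite [D%:R * _]mulrA.
      by rewrite ler_pdivlMr// -!natrM ler_nat leq_divM.
    by rewrite ltr_pdivrMr// natr1 -!natrM ltr_nat -ltn_divLR.
  have [h1 h2] := bd a p p0; have [h3 h4] := bd b q q0.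
  rewrite e in h1 h2; move: h1 h2 h3 h4; set u := a%:R / p%:R; set v := b%:R / q%:R.
  move=> h1 h2 h3 h4; rewrite -[leRHS]mul1r ler_pdivlMr// -[D%:R](ger0_norm (ltW D0)) -normrM.
  by rewrite ler_norml mulrBl [u * _]mulrC [v * _]mulrC; apply/andP; split; lra.
have hnear k : (forall x, x \in s k -> cabs x <= r) -> near_centers cs d (s k).
  by move=> h x xs; apply: hcs; exact: h.
have Di0 : 0 <= D%:R^-1 :> R by rewrite invr_ge0 ltW.
have [G sG hG] := cauchy_close d0 (hnear _ hn) (hnear _ hm) n0 m0 Di0 key.
exists G => //; apply: small_le sG.
have -> : 4 * d = eps / 2 by rewrite /d; field.
lra.
Qed.

Definition close_at (s : nat -> seq C) (eps : R) (n m : nat) := exists2 G, small G eps &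
  forall z, ((cabs (cauchy (s n) (cplx z) - cauchy (s m) (cplx z)))%:E <= G z)%E.

(** Extracting once for every tolerance, and diagonally. *)
Lemma close_subsequence (s : nat -> seq C) (N : nat) (r : R) :
  (forall n, (N <= n)%N -> (0 < size (s n))%N /\ forall x, x \in s n -> cabs x <= r) ->
  exists nu : nat -> nat, [/\ forall q, (nu q < nu q.+1)%N, forall q, (N <= nu q)%N,
    forall q, (4 ^ q <= nu q)%N & forall q, close_at s (2 ^- q) (nu q) (nu q.+1)].
Proof.
move=> hs.
have step (qI : nat * (nat -> Prop)) : exists J : nat -> Prop, unbounded qI.2 ->
   [/\ unbounded J, (forall n, J n -> qI.2 n) &
     forall n m, J n -> J m -> (N <= n)%N -> (N <= m)%N -> close_at s (2 ^- qI.1) n m].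
  case: qI => q I /=; have e0 : 0 < 2 ^- q :> R by rewrite invr_gt0 exprn_gt0.
  have [F [code hcode]] := finite_code e0 hs.
  have [ub|nub] := pselect (unbounded I); last by exists I.
  have [t ht] := pigeonhole code ub.
  exists (fun n => I n /\ code n = t) => _; split => // [n []//|n m [_ hn] [_ hm] Nn Nm].
  by apply: hcode => //; rewrite hn hm.
have [f hf] := choice step.
pose fix I (q : nat) : nat -> Prop := if q is p.+1 then f (p.+1, I p) else f (0%N, fun=> True).
have uI q : unbounded (I q).
  elim: q => [|q IH] /=.
    have u0 : unbounded (fun=> True) by move=> n; exists n.
    by have [] := hf (0%N, fun=> True) u0.
  by have [] := hf (q.+1, I q) IH.
have IS q n : I q.+1 n -> I q n by have [_ h _] := hf (q.+1, I q) (uI q); exact: h.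
have Ic q n m : I q n -> I q m -> (N <= n)%N -> (N <= m)%N -> close_at s (2 ^- q) n m.
  case: q => [|q] /=.
    have u0 : unbounded (fun=> True) by move=> k; exists k.
    by have [_ _ h] := hf (0%N, fun=> True) u0; exact: h.
  by have [_ _ h] := hf (q.+1, I q) (uI q); exact: h.
have [g hg] := choice (fun qn : nat * nat => uI qn.1 qn.2).
pose fix nu (q : nat) : nat :=
  if q is p.+1 then g (p.+1, maxn (nu p).+1 (N + 4 ^ p.+1)) else g (0%N, N.+1).
have nuI q : I q (nu q).
  case: q => [|q]; first by have [_] := hg (0%N, N.+1).
  by have [_] := hg (q.+1, maxn (nu q).+1 (N + 4 ^ q.+1)).
have nuN q : (N + 4 ^ q <= nu q)%N.
  case: q => [|q] /=; first by have [+ _] := hg (0%N, N.+1); rewrite /= addn1.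
  by have [+ _] := hg (q.+1, maxn (nu q).+1 (N + 4 ^ q.+1)); rewrite /= geq_max => /andP[].
have nuN' q : (N <= nu q)%N by apply: leq_trans (nuN q); rewrite leq_addr.
exists nu; split => // q.
- by have [+ _] := hg (q.+1, maxn (nu q).+1 (N + 4 ^ q.+1)); rewrite /= geq_max => /andP[].
- by apply: leq_trans (nuN q); rewrite leq_addl.
- by apply: Ic (nuN' _) (nuN' _) => //; apply: IS.
Qed.
End Net.

Section AlmostEverywhere.
Variable R : realType.
Local Notation C := R[i].
Local Notation T := (R * R)%type.
Local Notation mu := (@lebesgue_measure R \x @lebesgue_measure R)%E.

(** Both the partial sums of [h] and [u] plus these partial sums are
    nondecreasing and bounded, and [u] is their difference. *)
Lemma summable_increments (u h : nat -> R) (S : R) :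
  (forall n, `|u n.+1 - u n| <= h n) -> (forall n, \sum_(q < n) h q <= S) ->
  exists L, forall e, 0 < e -> exists Q, forall n, (Q <= n)%N -> `|u n - L| <= e.
Proof.
move=> uh hS; pose t n := \sum_(q < n) h q.
have h0 n : 0 <= h n := le_trans (normr_ge0 _) (uh n).
have tS n : t n.+1 = t n + h n by rewrite /t big_ord_recr.
have cvg_of v b : (forall n, v n <= v n.+1) -> (forall n, v n <= b) ->
    exists L, forall e : R, 0 < e -> exists Q, forall n, (Q <= n)%N -> `|v n - L| <= e.
  move=> vi vb; have vn : nondecreasing_seq v by apply/nondecreasing_seqP.
  have /(nondecreasing_is_cvgn vn) cv : has_ubound (range v).
    by exists b => _ [n _ <-].
  exists (limn v) => e e0; have /cvgrPdist_le/(_ e e0)[Q _ hQ] := cv.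
  by exists Q => n Qn; rewrite distrC; exact: hQ.
have [Lt hLt] : exists L, forall e : R, 0 < e -> exists Q, forall n, (Q <= n)%N -> `|t n - L| <= e.
  by apply: (cvg_of t S) => // n; rewrite tS lerDl.
have [Lv hLv] : exists L, forall e : R, 0 < e -> exists Q, forall n, (Q <= n)%N ->
    `|(u n + t n) - L| <= e.
  apply: (cvg_of (fun n => u n + t n) (u 0%N + S + S)) => n.
    by have := uh n; rewrite tS ler_norml => /andP[? ?]; lra.
  apply: lerD; last exact: hS.
  apply: (@le_trans _ _ (u 0%N + t n)); last by rewrite lerD2l; exact: hS.
  elim: n => [|n IH]; first by rewrite /t big_ord0 addr0.
  by have := uh n; rewrite tS ler_norml => /andP[? ?]; lra.
exists (Lv - Lt) => e e0; have e20 : 0 < e / 2 by rewrite divr_gt0.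
have [Q1 h1] := hLv _ e20; have [Q2 h2] := hLt _ e20.
exists (maxn Q1 Q2) => n; rewrite geq_max => /andP[n1 n2].
have := h1 n n1; have := h2 n n2; rewrite !ler_norml => /andP[? ?] /andP[? ?].
by apply/andP; split; lra.
Qed.

Lemma summable_increments_complex (F : nat -> C) (h : nat -> R) (S : R) :
  (forall n, cabs (F n.+1 - F n) <= h n) -> (forall n, \sum_(q < n) h q <= S) ->
  exists L, forall e, 0 < e -> exists Q, forall n, (Q <= n)%N -> cabs (F n - L) <= e.
Proof.
move=> uh hS.
have [n|a ha] := @summable_increments (fun n => complex.Re (F n)) h S _ hS.
  by apply: le_trans (uh n); rewrite -raddfB Re_le_cabs.
have [n|b hb] := @summable_increments (fun n => complex.Im (F n)) h S _ hS.
  by apply: le_trans (uh n); rewrite -raddfB Im_le_cabs.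
exists (a +i* b) => e e0; have e20 : 0 < e / 2 by rewrite divr_gt0.
have [Q1 h1] := ha _ e20; have [Q2 h2] := hb _ e20.
exists (maxn Q1 Q2) => n; rewrite geq_max => /andP[n1 n2].
apply: le_trans (cabs_le_ReIm _) _; rewrite !raddfB /=.
by rewrite (splitr e) lerD ?h1 ?h2.
Qed.

(** A series whose integral over every box is finite is finite almost everywhere;
    countably many boxes cover the plane. *)
Lemma ae_summable (H : nat -> T -> \bar R) (c : R) : 0 <= c ->
  (forall q, small (H q) (c * 2 ^- q)) ->
  \forall z \ae mu, (\sum_(0 <= q <oo) H q z < +oo)%E.
Proof.
move=> c0 sH.
have H0 q z : (0 <= H q z)%E by have [_ h _] := sH q.
have mH q : measurable_fun setT (H q) by have [h _ _] := sH q.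
have fin M : \forall z \ae mu, boxM M z -> (\sum_(0 <= q <oo) H q z)%E \is a fin_num.
  apply: integrable_ae; first exact: measurable_box.
  apply/integrableP; split.
    apply: measurable_funTS.
    by apply: (@ge0_emeasurable_sum _ _ _ _ _ xpredT) => // q _; exact: mH.
  under eq_integral => z _ do rewrite gee0_abs ?nneseries_ge0//.
  rewrite integral_nneseries//; last 2 first.
  - exact: measurable_box.
  - by move=> q; apply: measurable_funTS; exact: mH.
  apply: (@le_lt_trans _ _ (2 * c * kern_int R M)%:E); last exact: ltry.
  apply: nneseries_le; first by move=> q; exact: integral_ge0.
  move=> n; apply: (@le_trans _ _ (\sum_(0 <= q < n) (c * 2 ^- q * kern_int R M)%:E)%E).
    by apply: lee_sum => q _; have [_ _ h] := sH q; exact: h.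
  rewrite sumEFin lee_fin -mulr_suml ler_wpM2r ?kern_int_ge0// -mulr_sumr mulrC.
  by rewrite ler_wpM2r// sum_inv_pow2_le.
have := ae_foralln fin; apply: filterS => -[x y] h.
pose M := (Num.Def.truncn (`|x| + `|y|)).+1.
have hM : `|x| + `|y| <= M%:R by rewrite ltW// truncnS_gt.
have : boxM M (x, y).
  have := normr_ge0 x; have := normr_ge0 y => y0 x0.
  have : `|x| <= M%:R by lra.
  have : `|y| <= M%:R by lra.
  rewrite !ler_norml => /andP[? ?] /andP[? ?].
  by split; rewrite /= in_itv /=; apply/andP; split; lra.
move=> /h; rewrite ge0_fin_numE//; exact: nneseries_ge0.
Qed.

(** If n^(-3/2) times the sum of |z - x|^(-3/2) is at most 1, then no single
    |z - x|^(-1/2) exceeds n^(1/2), which allows to pass from the exponent 3/2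
    to the exponent 2. *)
Lemma sqsum_le_kern (s : seq C) (z : T) (b : R) : (0 < size s)%N -> b <= 1 ->
  (((size s)%:R * Num.sqrt (size s)%:R)^-1%:E * \sum_(x <- s) kern x z <= b%:E)%E ->
  cplx z \notin s /\
  (size s)%:R ^- 2 * \sum_(x <- s) cabs (cplx z - x)^-1 ^+ 2 <= b.
Proof.
move=> n0 b1; set n := (size s)%:R : R; have np : 0 < n by rewrite ltr0n.
pose m := Num.sqrt n; have m0 : 0 < m by rewrite sqrtr_gt0.
have nE : n = m ^+ 2 by rewrite sqr_sqrtr// ltW.
rewrite -/m => hb; have nm0 : 0 < n * m by rewrite mulr_gt0.
have hs : (\sum_(x <- s) kern x z <= (n * m * b)%:E)%E.
  have := lee_wpmul2l (_ : (0 <= (n * m)%:E)%E) hb; rewrite lee_fin ltW// => /(_ isT).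
  by rewrite muleA -!EFinM divff ?lt0r_neq0// mul1e.
have hk x : x \in s -> exists2 a, kern x z = a%:E & a <= n * m * b.
  move=> xs; have : (kern x z <= (n * m * b)%:E)%E.
    apply: le_trans hs; rewrite (big_rem x xs)/= leeDl//.
    by apply: sume_ge0 => y _; exact: kern_ge0.
  have := kern_ge0 x z; case: (kern x z) => [a| |]// _; rewrite lee_fin => ha.
  by exists a.
split; first by apply/negP => /hk[a /kern_fin[/eqP]].
have hfin : \sum_(x <- s) fine (kern x z) <= n * m * b.
  rewrite -lee_fin -sumEFin; apply: le_trans hs; rewrite big_seq [leRHS]big_seq.
  by apply: lee_sum => x /hk[a -> _].
have h2 x : x \in s -> cabs (cplx z - x)^-1 ^+ 2 <= m * fine (kern x z).
  move=> /hk[a ka ab]; rewrite ka /=; have [_ h3] := kern_fin ka.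
  rewrite cabsV; set X := (cabs _)^-1 in h3 *.
  have X0 : 0 <= X by rewrite invr_ge0 cabs_ge0.
  set c := Num.sqrt X in h3; have c0 : 0 <= c := sqrtr_ge0 X.
  have XE : X = c ^+ 2 by rewrite sqr_sqrtr.
  have cm : c <= m.
    rewrite -(@ler_pXn2r _ 3) ?nnegrE ?(ltW m0)//; apply: le_trans h3 _; apply: le_trans ab _.
    by rewrite nE -exprSr ler_piMr// exprn_ge0// ltW.
  rewrite XE -exprM (_ : c ^+ 4 = c * c ^+ 3); last by rewrite exprS.
  by apply: ler_pM => //; rewrite exprn_ge0.
rewrite mulrC ler_pdivrMr ?exprn_gt0//.
apply: (@le_trans _ _ (\sum_(x <- s) m * fine (kern x z))).
  by rewrite big_seq [leRHS]big_seq; apply: ler_sum => x; exact: h2.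
rewrite -mulr_sumr; apply: le_trans (ler_wpM2l (ltW m0) hfin) _.
by rewrite le_eqVlt; apply/orP; left; apply/eqP; rewrite nE; ring.
Qed.

Lemma ae_complexW (P : R[i] -> Prop) (Q : T -> Prop) :
  (forall z, Q z -> P (cplx z)) -> (\forall z \ae mu, Q z) -> ae_complex P.
Proof.
move=> h H.
have F := ae_filter_ringOfSetsType [the {measure set _ -> \bar R} of mu].
have H2 := @filterS _ _ F _ _ (fun z => h z) H.
exact: H2.
Qed.

(** The indices grow at least like 4^q, so that the means of the normalized sums
    of kernels, of order n^(-1/2), are summable like the differences of the
    Cauchy transforms; both are therefore treated as one series. *)
Theorem ae_cauchy_limit (s : nat -> seq C) (N : nat) (r : R) :
  (forall n, (N <= n)%N -> (0 < n)%N /\ size (s n) = n /\ forall x, x \in s n -> cabs x <= r) ->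
  exists nu : nat -> nat, [/\ forall q, (nu q < nu q.+1)%N, forall q, (N <= nu q)%N &
    ae_complex (fun Z : C => exists L : C, forall e : R, 0 < e -> exists Q, forall q, (Q <= q)%N ->
      [/\ Z \notin s (nu q), cabs (cauchy (s (nu q)) Z - L) <= e &
          (nu q)%:R ^- 2 * \sum_(x <- s (nu q)) cabs (Z - x)^-1 ^+ 2 <= e])].
Proof.
move=> hs; have [n Nn|nu [nu_incr nuN nu4 nuc]] := @close_subsequence _ s N r.
  by have [n0 [-> h]] := hs n Nn.
exists nu; split => //.
have sz q : size (s (nu q)) = nu q by have [_ []] := hs _ (nuN q).
have nu0 q : (0 < nu q)%N by have [] := hs _ (nuN q).
have /choice[G hG] : forall q, exists G, small G (2 ^- q : R) /\
    forall z, ((cabs (cauchy (s (nu q)) (cplx z) - cauchy (s (nu q.+1)) (cplx z)))%:E <= G z)%E.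
  by move=> q; have [G sG h] := nuc q; exists G.
pose B q z := ((((nu q)%:R * Num.sqrt (nu q)%:R)^-1 : R)%:E * \sum_(x <- s (nu q)) kern x z)%E.
have sB q : small (B q) (2 ^- q).
  have n0 : 0 < (nu q)%:R :> R by rewrite ltr0n.
  have m0 : 0 < Num.sqrt (nu q)%:R :> R by rewrite sqrtr_gt0.
  apply: (@small_le _ _ (((nu q)%:R * Num.sqrt (nu q)%:R)^-1 * ((size (s (nu q)))%:R * 1))).
    rewrite sz mulr1 invfM mulrAC mulVf ?lt0r_neq0// mul1r.
    rewrite lef_pV2 ?posrE ?exprn_gt0//.
    rewrite -[leLHS]ger0_norm ?exprn_ge0// -sqrtr_sqr; apply: ler_wsqrtr.
    by rewrite -exprM mulnC exprM -!natrX ler_nat.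
  apply: smallZ; first by rewrite invr_ge0 mulr_ge0 ?(ltW m0).
  apply: small_sum => x; exact: small_kern.
have sH q : small (fun z => G q z + B q z)%E (2 * 2 ^- q).
  by rewrite mulr_natl mulr2n; apply: smallD => //; have [] := hG q.
apply: ae_complexW (ae_summable (ler0n R 2) sH) => z hz.
set Z := cplx z.
have G0 q : (0 <= G q z)%E by have [[_ h _] _] := hG q.
have B0 q : (0 <= B q z)%E by have [_ h _] := sB q.
have GB0 q : (0 <= G q z + B q z)%E by apply: adde_ge0.
pose S := fine (\sum_(0 <= q <oo) (G q z + B q z))%E.
have SE : (\sum_(0 <= q <oo) (G q z + B q z) = S%:E)%E.
  by rewrite fineK// ge0_fin_numE// nneseries_ge0.
have part n : (\sum_(0 <= q < n) (G q z + B q z) <= S%:E)%E.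
  by rewrite -SE; exact: nneseries_lim_ge.
have finq q : (G q z + B q z)%E \is a fin_num.
  rewrite ge0_fin_numE//; apply: le_lt_trans (ltry S); apply: le_trans (part q.+1).
  by rewrite big_nat_recr//= leeDr// sume_ge0.
pose h q := fine (G q z + B q z)%E.
have hE q : (h q)%:E = (G q z + B q z)%E by rewrite fineK.
have h0 q : 0 <= h q by rewrite -lee_fin hE.
have hS n : \sum_(q < n) h q <= S.
  rewrite -lee_fin -sumEFin -(big_mkord xpredT (fun q => (h q)%:E)).
  by under eq_bigr do rewrite hE.
have hF q : cabs (cauchy (s (nu q.+1)) Z - cauchy (s (nu q)) Z) <= h q.
  rewrite cabsC -lee_fin hE; have [_ hh] := hG q; apply: le_trans (hh z) _.
  by rewrite leeDl.
have [L hL] := summable_increments_complex hF hS.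
have h_to0 e : 0 < e -> exists Q, forall q, (Q <= q)%N -> h q <= e.
  move=> e0; have [n|l hl] := @summable_increments (fun n => \sum_(q < n) h q) h S _ hS.
    by rewrite big_ord_recr/= addrAC subrr add0r ger0_norm.
  have e20 : 0 < e / 2 by rewrite divr_gt0.
  have [Q hQ] := hl _ e20; exists Q => q Qq.
  have := hQ q Qq; have := hQ q.+1 (leqW Qq); rewrite big_ord_recr/= !ler_norml.
  by move=> /andP[? ?] /andP[? ?]; lra.
exists L => e e0; have e1 : 0 < Num.min e 1 by rewrite lt_min e0 ltr01.
have [Q1 H1] := hL e e0; have [Q2 H2] := h_to0 _ e1.
exists (maxn Q1 Q2) => q; rewrite geq_max => /andP[q1 q2].
have := H2 q q2; rewrite le_min => /andP[he h1].
have hB : (B q z <= (h q)%:E)%E by rewrite hE leeDr.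
have := @sqsum_le_kern (s (nu q)) z (h q); rewrite sz => /(_ (nu0 q) h1 hB)[zs hz2].
by split => //; [exact: H1|exact: le_trans hz2 he].
Qed.
End AlmostEverywhere.

(** * The branches of the curve near infinity *)

Section ComplexLimits.
Variable R : realType.
Local Notation C := R[i].

Lemma cvg_cabsP (T : Type) (F : set_system T) (FF : Filter F) (f : T -> C) (l : C) :
  (f : T -> C^o) @ F --> (l : C^o) <->
  forall e : R, 0 < e -> \forall t \near F, cabs (f t - l) <= e.
Proof.
split => [/cvgrPdist_le h e e0|h].
  have := h e%:C; rewrite ltcR => /(_ e0); apply: filterS => t.
  by rewrite distrC normE lecR.
apply/cvgrPdist_le => e e0.
have eE : e = (complex.Re e)%:C by rewrite RRe_real// gtr0_real.
rewrite eE ltcR in e0; have := h _ e0; apply: filterS => t ht.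
by rewrite distrC normE eE lecR.
Qed.

Lemma near_cabsP (x : C) (P : C -> Prop) :
  (\forall z \near (x : C^o), P z) <-> exists2 d : R, 0 < d & forall z, cabs (z - x) < d -> P z.
Proof.
split => [/nbhs_normP[e /= e0 he]|[d d0 hd]].
  have eE : e = (complex.Re e)%:C by rewrite RRe_real// gtr0_real.
  exists (complex.Re e); first by rewrite -ltcR -eE.
  by move=> z hz; apply: he; rewrite /ball_ /= distrC normE eE ltcR.
apply/nbhs_normP; exists d%:C; first by rewrite /= ltcR.
by move=> z; rewrite /ball_ /= distrC normE ltcR; exact: hd.
Qed.

Lemma cvg_at_cabsP (f : C -> C) (x l : C) :
  (f : C^o -> C^o) z @[z --> (x : C^o)] --> (l : C^o) <->
  forall e : R, 0 < e -> exists2 d : R, 0 < d & forall z, cabs (z - x) < d -> cabs (f z - l) <= e.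
Proof.
split=> [/(cvg_cabsP (nbhs_filter (x : C^o))) h e e0|h].
  by apply/near_cabsP; exact: h.
by apply/(cvg_cabsP (nbhs_filter (x : C^o))) => e e0; apply/near_cabsP; exact: h.
Qed.

Lemma cvgM_at (f g : C -> C) (x a b : C) :
  (f : C^o -> C^o) z @[z --> (x : C^o)] --> (a : C^o) ->
  (g : C^o -> C^o) z @[z --> (x : C^o)] --> (b : C^o) ->
  (f z * g z : C^o) @[z --> (x : C^o)] --> (a * b : C^o).
Proof. by move=> h1 h2; exact: (@cvgM _ _ _ (nbhs_filter (x : C^o)) _ _ _ _ h1 h2). Qed.

Lemma cvgD_at (f g : C -> C) (x a b : C) :
  (f : C^o -> C^o) z @[z --> (x : C^o)] --> (a : C^o) ->
  (g : C^o -> C^o) z @[z --> (x : C^o)] --> (b : C^o) ->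
  (f z + g z : C^o) @[z --> (x : C^o)] --> (a + b : C^o).
Proof. by move=> h1 h2; exact: (@cvgD _ C^o _ _ (nbhs_filter (x : C^o)) _ _ _ _ h1 h2). Qed.

Lemma cvgV_at (f : C -> C) (x a : C) : a != 0 ->
  (f : C^o -> C^o) z @[z --> (x : C^o)] --> (a : C^o) ->
  ((f z)^-1 : C^o) @[z --> (x : C^o)] --> (a^-1 : C^o).
Proof. by move=> a0 h1; exact: (@cvgV _ _ _ (nbhs_filter (x : C^o)) _ _ a0 h1). Qed.

Lemma cvg_cst_at (x a : C) : (a : C^o) @[z --> (x : C^o)] --> (a : C^o).
Proof.
by apply/(@cvg_at_cabsP (fun=> a)) => e e0; exists 1 => // z _; rewrite subrr cabs0 ltW.
Qed.

Lemma cvg_id_at (x : C) : (z : C^o) @[z --> (x : C^o)] --> (x : C^o).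
Proof. by apply/(@cvg_at_cabsP id) => e e0; exists e => // z; exact: ltW. Qed.

Lemma eq_cvg_at (f g : C -> C) (x a : C) : (forall z, f z = g z) ->
  (f : C^o -> C^o) z @[z --> (x : C^o)] --> (a : C^o) ->
  (g : C^o -> C^o) z @[z --> (x : C^o)] --> (a : C^o).
Proof. by move=> /funext ->. Qed.

Lemma horner_cvg (p : {poly C}) (x : C) : p.[z] @[z --> (x : C^o)] --> (p.[x] : C^o).
Proof.
elim/poly_ind: p => [|p c IH].
  by apply/cvg_at_cabsP => e e0; exists 1 => // z _; rewrite !horner0 subrr cabs0 ltW.
rewrite hornerMXaddC.
apply: (eq_cvg_at (f := fun z => p.[z] * z + c)); first by move=> z; rewrite hornerMXaddC.
have IHz := @cvgM_at (fun z => p.[z]) id x _ _ IH (@cvg_id_at x).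
exact: (@cvgD_at (fun z => p.[z] * z) (fun=> c) x _ _ IHz (@cvg_cst_at x c)).
Qed.

Lemma horner_close (p : {poly C}) (x : C) (e : R) : 0 < e ->
  exists2 d : R, 0 < d & forall z, cabs (z - x) < d -> cabs (p.[z] - p.[x]) <= e.
Proof. by move=> e0; have /cvg_at_cabsP := @horner_cvg p x; exact. Qed.

Lemma prod_cvg (I : Type) (r : seq I) (P : pred I) (f : I -> C -> C) (x : C) (l : I -> C) :
  (forall i, P i -> f i z @[z --> (x : C^o)] --> (l i : C^o)) ->
  (\prod_(i <- r | P i) f i z) @[z --> (x : C^o)] --> (\prod_(i <- r | P i) l i : C^o).
Proof.
move=> h; elim: r => [|i r IH].
  apply/cvg_at_cabsP => e e0; exists 1 => // z _.
  by rewrite !big_nil subrr cabs0 ltW.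
rewrite big_cons; case Pi: (P i).
  apply: (eq_cvg_at (f := fun z => f i z * \prod_(j <- r | P j) f j z)).
    by move=> z; rewrite big_cons Pi.
  exact: (@cvgM_at (f i) (fun z => \prod_(j <- r | P j) f j z) x _ _ (h i Pi) IH).
by apply: eq_cvg_at IH => z; rewrite big_cons Pi.
Qed.

(** Continuity of the slope is differentiability. *)
Lemma derivable_slope (f q : C -> C) (x : C) (d : R) : 0 < d ->
  (forall z, cabs (z - x) < d -> f z - f x = (z - x) * q z) ->
  q z @[z --> (x : C^o)] --> (q x : C^o) ->
  derivable (f : C^o -> C^o) x 1.
Proof.
move=> d0 hf hq; apply/cvg_ex; exists (q x); apply/cvg_cabsP => e e0.
have /cvg_at_cabsP/(_ e e0)[d1 d10 h1] := hq.
have [d2 d20 hd2] : exists2 d2 : R, 0 < d2 & d2 <= d /\ d2 <= d1.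
  by exists (Num.min d d1); rewrite ?lt_min ?d0// !ge_min !lexx orbT.
apply/near_cabsP; exists d2 => // h; rewrite subr0 => hh h0 /=.
have e1 : h *: (1 : C^o) + x - x = h by rewrite addrK /GRing.scale /= mulr1.
rewrite hf ?e1; last exact: lt_le_trans hh hd2.1.
rewrite -[X in X *: _]/(h^-1) /GRing.scale /= mulKf//; apply: h1.
by rewrite -[X in cabs X]/(h * 1 + x - x) mulr1 addrK; exact: lt_le_trans hh hd2.2.
Qed.

End ComplexLimits.

Section Branches.
Variable R : realType.
Local Notation C := R[i].

Lemma pos_lower_bound (I : finType) (f : I -> R) : (forall i, 0 < f i) ->
  exists2 e : R, 0 < e & forall i, e <= f i.
Proof.
move=> f0; exists (\big[Num.min/1]_i f i); last by move=> i; exact: bigmin_le_cond.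
by apply: lt_bigmin.
Qed.

Variables (k : nat) (Q : 'I_k.+1 -> {poly C}) (y : 'I_k -> C) (a : C).
Hypothesis hQ : forall i : 'I_k.+1, (size (Q i) <= i.+1)%N.
Hypothesis a0 : a != 0.
Hypothesis yinj : injective y.
Hypothesis hchi : \sum_(i < k.+1) (Q i)`_i *: 'X^i = a *: \prod_(j < k) ('X - (y j)%:P).

(** The equation of the curve in the chart s = 1/z, w = u/z at infinity. *)
Definition chart (s : C) : {poly C} := \poly_(i < k.+1) (revp i (Q (inord i))).[s].
Definition chart_lead : {poly C} := revp k (Q ord_max).

Lemma chartE s u : (chart s).[u] = \sum_(i < k.+1) (revp i (Q i)).[s] * u ^+ i.
Proof. by rewrite horner_poly; apply: eq_bigr => i _; rewrite inord_val. Qed.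

Lemma chart_curve z w : z != 0 ->
  (chart z^-1).[z * w] = \sum_(i < k.+1) (Q i).[z] * w ^+ i.
Proof.
move=> z0; rewrite chartE; apply: eq_bigr => i _.
by rewrite exprMn mulrA horner_revp.
Qed.

Definition chart_at (u : C) : {poly C} := \sum_(i < k.+1) u ^+ i *: revp i (Q i).

Lemma chart_atE s u : (chart_at u).[s] = (chart s).[u].
Proof.
by rewrite chartE horner_sum; apply: eq_bigr => i _; rewrite hornerZ mulrC.
Qed.

Lemma chart0 : chart 0 = a *: \prod_(j < k) ('X - (y j)%:P).
Proof.
rewrite -hchi /chart poly_def; apply: eq_bigr => i _.
by rewrite inord_val horner_coef0 coef_poly /= subn0.
Qed.

Lemma chart_leadE s : (chart s)`_k = chart_lead.[s].
Proof.
by rewrite coef_poly ltnSn (_ : inord k = ord_max)//; apply: val_inj; rewrite /= inordK.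
Qed.

Lemma chart_lead0 : chart_lead.[0] = a.
Proof.
rewrite -chart_leadE chart0 coefZ.
have /monicP := monic_prod_XsubC (index_enum 'I_k) xpredT y.
rewrite lead_coefE size_prod_XsubC [index_enum _]unlock -enumT size_enum_ord /= => ->.
by rewrite mulr1.
Qed.

Lemma size_chart s : chart_lead.[s] != 0 -> size (chart s) = k.+1.
Proof.
move=> h; apply/eqP; rewrite eqn_leq size_poly /=.
by rewrite ltnNge; apply: contra h => /leq_sizeP/(_ k (leqnn _)); rewrite chart_leadE => ->.
Qed.

(** If all the roots were at distance more than [e] from [u], the product formula
    would make the value at [u] large. *)
Lemma near_root (p : {poly C}) (u : C) (c e : R) : size p = k.+1 -> 0 <= e -> 0 <= c ->
  c <= cabs p`_k -> cabs p.[u] < c * e ^+ k -> exists2 v, p.[v] = 0 & cabs (v - u) <= e.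
Proof.
move=> sp e0 c0 hc hu; have [rs hrs] := closed_field_poly_normal p.
have lp : lead_coef p = p`_k by rewrite lead_coefE sp.
have p0 : lead_coef p != 0 by rewrite lead_coef_eq0 -size_poly_eq0 sp.
have srs : size rs = k.
  by have := sp; rewrite hrs size_scale// size_prod_XsubC => -[].
have [/hasP[v vrs hv]|/hasPn hno] := boolP (has (fun v => cabs (v - u) <= e) rs).
  exists v => //; apply/rootP; rewrite hrs rootZ//.
  by rewrite root_prod_XsubC.
suff : c * e ^+ k <= cabs p.[u] by rewrite leNgt hu.
rewrite {1}hrs hornerZ horner_prod cabsM lp cabs_prod; apply: ler_pM => //.
  exact: exprn_ge0.
rewrite -srs; elim: rs hno {hrs srs} => [|v rs IH] hno; first by rewrite big_nil.
rewrite /= exprS big_cons hornerXsubC; apply: ler_pM; rewrite ?exprn_ge0//.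
  by have := hno v (mem_head _ _); rewrite -ltNge cabsC; exact: ltW.
by apply: IH => x xrs; apply: hno; rewrite inE xrs orbT.
Qed.

Lemma chart_roots (e : R) : 0 < e -> exists2 d : R, 0 < d & forall s, cabs s < d ->
  cabs a / 2 <= cabs chart_lead.[s] /\
  forall j, exists2 v, (chart s).[v] = 0 & cabs (v - y j) <= e.
Proof.
move=> e0; have ca0 : 0 < cabs a by rewrite cabs_gt0.
have c0 : 0 < cabs a / 2 by rewrite divr_gt0.
have [d1 d10 h1] := horner_close chart_lead 0 c0.
pose b := cabs a / 2 * e ^+ k / 2.
have b0 : 0 < b by rewrite !divr_gt0// mulr_gt0// exprn_gt0.
have /choice[d hd] : forall j, exists d : R, 0 < d /\
    forall s, cabs (s - 0) < d -> cabs ((chart_at (y j)).[s] - (chart_at (y j)).[0]) <= b.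
  by move=> j; have [d d0 h] := horner_close (chart_at (y j)) 0 b0; exists d.
have [d2 d20 hd2] := @pos_lower_bound _ d (fun j => (hd j).1).
exists (Num.min d1 d2); first by rewrite lt_min d10.
move=> s; rewrite lt_min => /andP[s1 s2].
have hl : cabs a / 2 <= cabs chart_lead.[s].
  have := h1 s; rewrite subr0 chart_lead0 => /(_ s1) h.
  have := cabsBge a (a - chart_lead.[s]); rewrite subKr cabsC => h'.
  lra.
split=> // j; apply: (@near_root _ _ (cabs a / 2)) => //; rewrite ?(ltW e0) ?(ltW c0)//.
- apply: size_chart; rewrite -cabs_gt0; exact: lt_le_trans hl.
- by rewrite chart_leadE.
- have := (hd j).2 s; rewrite subr0 !chart_atE => /(_ (lt_le_trans s2 (hd2 j))).
  rewrite (_ : (chart 0).[y j] = 0); last first.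
    by rewrite chart0 hornerZ horner_prod (bigD1 j)//= hornerXsubC subrr mul0r mulr0.
  rewrite subr0 => /le_lt_trans; apply; rewrite /b ltr_pdivrMr// ltr_pMr ?ltr1n//.
  by rewrite mulr_gt0// exprn_gt0.
Qed.

(** Near infinity the k sheets stay in disjoint discs, one for each root of the
    limiting equation, which makes each of them a function of s. *)
Theorem chart_branches : exists (V : 'I_k -> C -> C) (eps d c : R),
  [/\ 0 < eps, 0 < d, 0 < c &
   forall s, cabs s < d ->
   [/\ chart_lead.[s] != 0,
      forall u, (chart s).[u] = chart_lead.[s] * \prod_(j < k) (u - V j s),
      forall u j m, cabs (u - y j) <= eps -> m != j -> u != V m s,
      forall u j, cabs (u - y j) <= eps -> c * cabs (u - V j s) <= cabs (chart s).[u] &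
      forall j, cabs (V j s - y j) <= eps]].
Proof.
have [sep sep0 hsep] : exists2 sep : R, 0 < sep & forall l m, l != m -> sep <= cabs (y l - y m).
  have [|e e0 he] := @pos_lower_bound _ (fun p : 'I_k * 'I_k =>
      if p.1 == p.2 then 1 else cabs (y p.1 - y p.2)).
    move=> [l m] /=; case: eqVneq => // lm.
    by rewrite cabs_gt0 subr_eq0 (inj_eq yinj).
  by exists e => // l m lm; have := he (l, m); rewrite /= (negbTE lm).
pose eps := sep / 4; have eps0 : 0 < eps by rewrite divr_gt0.
have [d d0 hd] := chart_roots eps0.
have /choice[V hV] : forall js : 'I_k * C, exists v, cabs js.2 < d ->
    (chart js.2).[v] = 0 /\ cabs (v - y js.1) <= eps.
  move=> [j s] /=; have [sd|_] := boolP (cabs s < d); last by exists 0.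
  by have [_ h] := hd s sd; have [v v1 v2] := h j; exists v.
have ca0 : 0 < cabs a by rewrite cabs_gt0.
exists (fun j s => V (j, s)), eps, d, (cabs a / 2 * (sep / 2) ^+ k.-1).
split => //; first by rewrite mulr_gt0 ?exprn_gt0 ?divr_gt0.
move=> s sd; have [hl _] := hd s sd.
have l0 : chart_lead.[s] != 0.
  by rewrite -cabs_gt0; apply: lt_le_trans hl; rewrite divr_gt0.
have V1 j : (chart s).[V (j, s)] = 0 by have [] := hV (j, s) sd.
have V2 j : cabs (V (j, s) - y j) <= eps by have [] := hV (j, s) sd.
have far u j m : cabs (u - y j) <= eps -> m != j -> sep / 2 <= cabs (u - V (m, s)).
  move=> hu mj; have := hsep _ _ mj; have := V2 m.
  have := cabsD (y m - V (m, s)) (V (m, s) - y j).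
  have := cabsD (V (m, s) - u) (u - y j).
  rewrite !subrKA [cabs (y m - V _)]cabsC [cabs (V _ - u)]cabsC.
  by rewrite /eps in hu *; lra.
have Vne u j m : cabs (u - y j) <= eps -> m != j -> u != V (m, s).
  by move=> hu mj; apply/eqP => e; have := far u j m hu mj; rewrite e subrr cabs0; lra.
have Vinj : injective (fun j => V (j, s)).
  by move=> j m e; apply/eqP/negPn/negP => jm; have := Vne _ m j (V2 m) jm; rewrite -e eqxx.
have fact u : (chart s).[u] = chart_lead.[s] * \prod_(j < k) (u - V (j, s)).
  have sz := size_chart l0.
  have srs : size [seq V (j, s) | j <- enum 'I_k] = k by rewrite size_map size_enum_ord.
  rewrite {1}(@all_roots_prod_XsubC _ (chart s) [seq V (j, s) | j <- enum 'I_k]).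
  - rewrite hornerZ lead_coefE sz /= chart_leadE; congr (_ * _).
    rewrite big_map horner_prod big_enum /=; apply: eq_bigr => j _.
    by rewrite hornerXsubC.
  - by rewrite sz srs.
  - by apply/allP => _ /mapP[j _ ->]; apply/rootP.
  - by rewrite uniq_rootsE map_inj_uniq// enum_uniq.
split => // u j hu.
rewrite fact (bigD1 j)//= cabsM cabsM cabs_prod [X in _ <= _ * X]mulrC mulrA.
apply: ler_wpM2r; first exact: cabs_ge0.
apply: ler_pM => //; rewrite ?exprn_ge0 ?divr_ge0 ?(ltW sep0) ?(ltW ca0)//.
have -> : (sep / 2) ^+ k.-1 = \prod_(m < k | m != j) (sep / 2).
  by rewrite prodr_const (cardC1 j) card_ord.
apply: ler_prod => m mj; rewrite divr_ge0 ?(ltW sep0)//=; exact: far hu mj.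
Qed.

(** The implicit function theorem is elementary here: the difference
    V(s) - V(s0) can be read off the factorization of the chart at [s]. *)
Lemma branch_derivable (V : 'I_k -> C -> C) (eps d c : R) : 0 < d -> 0 < c ->
  (forall s, cabs s < d ->
   [/\ chart_lead.[s] != 0,
      forall u, (chart s).[u] = chart_lead.[s] * \prod_(j < k) (u - V j s),
      forall u j m, cabs (u - y j) <= eps -> m != j -> u != V m s,
      forall u j, cabs (u - y j) <= eps -> c * cabs (u - V j s) <= cabs (chart s).[u] &
      forall j, cabs (V j s - y j) <= eps]) ->
  forall j s0, cabs s0 < d -> derivable ((fun s => s * V j s) : C^o -> C^o) s0 1.
Proof.
move=> d0 c0 hV j s0 s0d.
have [r r0 hr] : exists2 r : R, 0 < r & forall s, cabs (s - s0) < r -> cabs s < d.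
  exists (d - cabs s0); first by rewrite subr_gt0.
  by move=> s hs; have := cabsD (s - s0) s0; rewrite subrK; lra.
have [_ fact0 _ _ V0] := hV s0 s0d.
have root0 m : (chart_at (V m s0)).[s0] = 0.
  by rewrite chart_atE fact0 (bigD1 m)//= subrr mul0r mulr0.
have Vcont m : (V m : C^o -> C^o) s @[s --> (s0 : C^o)] --> (V m s0 : C^o).
  apply/cvg_at_cabsP => e e0; have ce0 : 0 < c * e by rewrite mulr_gt0.
  have [r1 r10 h1] := horner_close (chart_at (V m s0)) s0 ce0.
  exists (Num.min r r1); first by rewrite lt_min r0.
  move=> s; rewrite lt_min => /andP[/hr sd /h1].
  rewrite root0 subr0 chart_atE => h.
  have [_ _ _ hc _] := hV s sd.
  by rewrite -(ler_pM2l c0) cabsC; apply: le_trans h; exact: hc.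
set u := V j s0.
have /factor_theorem[q hq] : root (chart_at u) s0 by apply/rootP; exact: root0.
pose W s := chart_lead.[s] * \prod_(m < k | m != j) (u - V m s).
have W0 s : cabs s < d -> W s != 0.
  move=> sd; have [l0 _ hne _ _] := hV s sd; rewrite mulf_neq0//.
  by apply/prodf_neq0 => m mj; rewrite subr_eq0; apply: hne mj; exact: V0.
have Wcvg : (W : C^o -> C^o) s @[s --> (s0 : C^o)] --> (W s0 : C^o).
  apply: (@cvgM_at _ (fun s => chart_lead.[s])); first exact: horner_cvg.
  apply: (@prod_cvg _ _ _ _ (fun m s => u - V m s)) => m _.
  apply: (@cvgD_at _ (fun=> u) (fun s => - V m s)); first exact: cvg_cst_at.
  apply: (eq_cvg_at (f := fun s => -1 * V m s)); first by move=> s; rewrite mulN1r.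
  rewrite -[- V m s0]mulN1r.
  exact: (@cvgM_at _ (fun=> -1) (V m) s0 _ _ (@cvg_cst_at _ s0 (-1)) (Vcont m)).
apply: (@derivable_slope _ _ (fun s => V j s + (- s0) * (q.[s] * (W s)^-1)) _ r r0) => [s hs|].
  have sd := hr s hs; have [_ fact _ _ _] := hV s sd.
  have : (u - V j s) * W s = (s - s0) * q.[s].
    rewrite /W mulrCA -(bigD1 j (P := xpredT) (F := fun m => u - V m s))//=.
    by rewrite -fact -chart_atE hq hornerM hornerXsubC mulrC.
  move=> /(canRL (mulfK (W0 s sd))) h.
  have -> : V j s = u - (u - V j s) by rewrite subKr.
  rewrite h -/u; ring.
apply: (@cvgD_at _ (V j)); first exact: Vcont.
apply: (@cvgM_at _ (fun=> - s0)); first exact: cvg_cst_at.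
apply: (@cvgM_at _ (fun s => q.[s])); first exact: horner_cvg.
by apply: cvgV_at => //; exact: W0.
Qed.
End Branches.

(** * Logarithmic derivatives of eigenpolynomials and the curve *)

Section Assembly.
Variable R : realType.
Local Notation C := R[i].

Definition rootpoly (c : C) (s : seq C) : {poly C} := c *: \prod_(x <- s) ('X - x%:P).

Lemma rootpoly_neq0 c s z : c != 0 -> z \notin s -> (rootpoly c s).[z] != 0.
Proof.
move=> c0 zs; rewrite /rootpoly hornerZ mulf_neq0//.
by rewrite -rootE root_prod_XsubC.
Qed.

Lemma logderivE c s l z : c != 0 -> l != 0 -> z \notin s -> (0 < size s)%N ->
  let p := rootpoly c s in
  p^`().[z] / (l * p.[z]) = (size s)%:R / l * cauchy s z.
Proof.
move=> c0 l0 zs n0 p; have p0 : l * p.[z] != 0 by rewrite mulf_neq0// rootpoly_neq0.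
have := psum1_local_zeros c zs l0; rewrite /= -/(rootpoly c s) -/p => <-.
rewrite mulfK// /psum big_map -sumrN /cauchy.
have nn : (size s)%:R != 0 :> C by rewrite pnatr_eq0 -lt0n.
set S := \sum_(x <- s) (z - x)^-1.
have -> : (size s)%:R / l * ((size s)%:R^-1 * S) = l^-1 * S.
  by field; rewrite nn l0.
rewrite mulr_sumr; apply: eq_bigr => x _.
by rewrite expr1 opprK invfM.
Qed.

Lemma sqsum_local_zeros (l z : C) (s : seq C) :
  sqsum (local_zeros l z s) = (cabs l) ^- 2 * \sum_(x <- s) cabs (z - x)^-1 ^+ 2.
Proof.
rewrite /sqsum big_map mulr_sumr; apply: eq_bigr => x _.
by rewrite cabsN invfM cabsM cabsV exprMn exprVn.
Qed.

(** Replacing each scaled derivative by a power of the logarithmic derivative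
    turns the differential equation into the equation of the curve. *)
Lemma logderiv_near_curve k (Q : 'I_k.+1 -> {poly C}) (z : C) (B : R) : 1 <= B ->
  exists2 K : R, 0 <= K & forall (c l : C) s, c != 0 -> l != 0 -> z \notin s ->
  let p := rootpoly c s in let f := p^`().[z] / (l * p.[z]) in
  pencil_op Q l p = 0 -> cabs f <= B -> sqsum (local_zeros l z s) <= 1 ->
  cabs (\sum_(i < k.+1) (Q i).[z] * f ^+ i) <= K * sqsum (local_zeros l z s).
Proof.
move=> B1; have [c0 c00 hc] := @revprod_coef_approx R B k B1.
exists (\sum_(i < k.+1) cabs (Q i).[z] * c0).
  by apply: sumr_ge0 => i _; rewrite mulr_ge0 ?cabs_ge0.
move=> c l s cn0 l0 zs p f pe fB s1.
have p0 : p.[z] != 0 by exact: rootpoly_neq0.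
have fE : - psum (local_zeros l z s) 1 = f.
  have := psum1_local_zeros c zs l0; rewrite /= -/(rootpoly c s) -/p /f => <-.
  by rewrite mulfK// mulf_neq0.
set u := local_zeros l z s in fE s1 *.
have uB : cabs (psum u 1) <= B by rewrite -cabsN fE.
have key : \sum_(i < k.+1) (Q i).[z] * ((revprod u)`_i *+ i`!) = 0.
  have := congr1 (fun q : {poly C} => q.[z]) pe.
  rewrite /pencil_op horner_sum horner0 => h.
  have lp0 : l ^+ k * p.[z] != 0 by rewrite mulf_neq0// expf_neq0.
  apply: (mulfI lp0); rewrite mulr0 -[RHS]h mulr_sumr; apply: eq_bigr => i _.
  have ik : (i <= k)%N by rewrite -ltnS.
  have := derivn_local_zeros c i zs l0; rewrite /= -/(rootpoly c s) -/p -/u => pE.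
  rewrite [RHS]hornerZ hornerM pE.
  have -> : l ^+ k = l ^+ (k - i) * l ^+ i by rewrite -exprD subnK.
  by move: (_ *+ _) (p.[z]) => e pz; ring.
rewrite -[X in cabs X]subr0 -[X in _ - X]key -sumrB mulr_suml.
apply: le_trans (cabs_sum _ _ _) _; apply: ler_sum => i _.
rewrite -mulrBr cabsM -mulrA; apply: ler_wpM2l; first exact: cabs_ge0.
rewrite cabsC -fE; apply: hc => //; by rewrite -ltnS.
Qed.

Section OneBranch.
Variables (k' : nat).
Local Notation k := k'.+1.
Variables (Q : 'I_k.+1 -> {poly C}) (y : 'I_k -> C) (a : C).
Hypothesis hQ : forall i : 'I_k.+1, (size (Q i) <= i.+1)%N.
Hypothesis a0 : a != 0.
Hypothesis hchi : \sum_(i < k.+1) (Q i)`_i *: 'X^i = a *: \prod_(j < k) ('X - (y j)%:P).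
Variables (j : 'I_k) (N : nat) (l : nat -> C) (p : nat -> {poly C}).
Hypothesis yj0 : y j != 0.
Hypothesis yj : forall m, m != j -> complex.Im (y m / y j) != 0.
Hypothesis ly : forall e : R, 0 < e -> exists M, forall n, (M <= n)%N ->
  l n != 0 /\ cabs (n%:R / l n - y j) <= e.
Hypothesis p_deg : forall n, (N <= n)%N -> size (p n) = n.+1.
Hypothesis p_eig : forall n, (N <= n)%N -> pencil_op Q (l n) (p n) = 0.

Lemma inv_nat_small (b e : R) : 0 < e -> exists M : nat, forall n, (M <= n)%N ->
  (0 < n)%N /\ b / n%:R <= e.
Proof.
move=> e0; exists (Num.Def.truncn (b / e)).+1 => n Mn; have n0 : (0 < n)%N by apply: leq_trans Mn.
split => //; rewrite ler_pdivrMr ?ltr0n// mulrC -ler_pdivrMr//.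
apply: ltW; apply: lt_le_trans (truncnS_gt _) _; by rewrite ler_nat.
Qed.

Lemma roots_setup : exists (M : nat) (r : R) (s : nat -> seq C), 0 <= r /\
  forall n, (M <= n)%N -> [/\ (N <= n)%N /\ (0 < n)%N, size (s n) = n, l n != 0,
    exists2 c, c != 0 & p n = rootpoly c (s n) &
    (forall x, x \in s n -> cabs x <= r) /\ n%:R / cabs (l n) <= cabs (y j) + 1].
Proof.
have [eps [r [eps0 hr]]] := roots_bounded hQ a0 hchi yj0 yj.
have /choice[s hs] : forall n, exists s, (N <= n)%N ->
    size s = n /\ exists2 c, c != 0 & p n = rootpoly c s.
  move=> n; have [Nn|_] := boolP (N <= n)%N; last by exists [::].
  have [rs hrs] := closed_field_poly_normal (p n).
  have lc : lead_coef (p n) != 0 by rewrite lead_coef_eq0 -size_poly_eq0 p_deg.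
  exists rs => _; split; last by exists (lead_coef (p n)).
  by have := p_deg Nn; rewrite hrs size_scale// size_prod_XsubC => -[].
have [M1 h1] := ly eps0; have [M2 h2] := ly ltr01.
have [M3 h3] := inv_nat_small (k%:R * (cabs (y j) + 1)) eps0.
exists (maxn N (maxn M1 (maxn M2 M3))), (Num.max 0 r), s; split; first by rewrite le_max lexx.
move=> n; rewrite !geq_max => /and4P[Nn n1 n2 n3].
have [l0 hl1] := h1 n n1; have [_ hl2] := h2 n n2; have [n0 hl3] := h3 n n3.
have [ssz [c c0 pE]] := hs n Nn.
have nl : n%:R / cabs (l n) <= cabs (y j) + 1.
  rewrite -(cabs_nat R n) -cabs_div -(subrK (y j) (_ / l n)) addrC.
  by apply: le_trans (cabsD _ _) _; rewrite lerD2l.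
split => //; first by exists c.
split => // x xs; rewrite le_max; apply/orP; right.
apply: (hr (s n) (l n) c _ l0 c0) xs; rewrite ?ssz//.
  apply: le_trans hl3; rewrite -!mulrA ler_wpM2l//.
  by rewrite ler_pdivlMr ?ltr0n// mulrC.
by have := p_eig Nn; rewrite pE.
Qed.

Variables (V : 'I_k -> C -> C) (eps d c : R).
Hypothesis eps0 : 0 < eps.
Hypothesis d0 : 0 < d.
Hypothesis c0 : 0 < c.
Hypothesis hV : forall s, cabs s < d ->
   [/\ (chart_lead Q).[s] != 0,
      forall u, (chart Q s).[u] = (chart_lead Q).[s] * \prod_(j < k) (u - V j s),
      forall u j m, cabs (u - y j) <= eps -> m != j -> u != V m s,
      forall u j, cabs (u - y j) <= eps -> c * cabs (u - V j s) <= cabs (chart Q s).[u] &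
      forall j, cabs (V j s - y j) <= eps].

Lemma logderiv_limitI (nu : nat -> nat) (z L : C) :
  (exists M, forall m, (M <= m)%N -> l (nu m) * (p (nu m)).[z] != 0) ->
  (forall e, 0 < e -> exists M, forall m, (M <= m)%N ->
     cabs ((p (nu m))^`().[z] / (l (nu m) * (p (nu m)).[z]) - L) <= e) ->
  logderiv_limit (fun m => l (nu m)) (fun m => p (nu m)) z L.
Proof.
move=> [M hM] h; split; first by exists M.
by apply/cvg_cabsP => e /h[M' hM']; exists M'.
Qed.

(** The radius ensures three things: 1/z lies in the domain of the branches, the
    zeros are at distance at least 1, and z f(z) differs from n/l by at most
    eps / 2, which selects the disc around y_j. *)
Theorem branch_limit : exists (nu : nat -> nat) (r : R), [/\ 0 < r,
  {homo nu : m1 m2 / (m1 < m2)%N},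
  forall m, (0 < nu m)%N && (N <= nu m)%N,
  forall z, r < cabs z -> cabs z^-1 < d /\
     logderiv_limit (fun m => l (nu m)) (fun m => p (nu m)) z (V j z^-1 / z) &
  ae_complex (fun z => exists2 L, logderiv_limit (fun m => l (nu m)) (fun m => p (nu m)) z L &
    plane_curve Q z L)].
Proof.
have [M [r0 [s [r00 hs]]]] := roots_setup.
have B1 : 1 <= cabs (y j) + 1 by rewrite lerDr cabs_ge0.
move: (cabs (y j) + 1) B1 hs => B B1 hs.
have B0 : 0 < B by apply: lt_le_trans B1.
have [|nu [nui nuM hae]] := @ae_cauchy_limit _ s M r0.
  by move=> n /hs[[_ n0] sz _ _ [hx _]].
have nu_mono : {homo nu : m1 m2 / (m1 < m2)%N} by apply: homo_ltn => //; exact: ltn_trans.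
have nu_ge m : (m <= nu m)%N.
  by elim: m => // m IH; apply: leq_ltn_trans IH (nui m).
have d'0 : 0 < d^-1 by rewrite invr_gt0.
have Be0 : 0 <= B * r0 * 2 / eps by rewrite divr_ge0 ?(ltW eps0)// !mulr_ge0 ?(ltW B0).
exists nu, (d^-1 + r0 + 1 + B * r0 * 2 / eps); split => //.
- by move: (B * r0 * 2 / eps) Be0 => x x0; lra.
- by move=> m; have [[-> ->]] := hs _ (nuM m).
- move=> z hz0; have [hz hz2] : d^-1 + r0 + 1 < cabs z /\ B * r0 * 2 / eps < cabs z - r0.
    by move: (B * r0 * 2 / eps) Be0 hz0 => x x0 hz0; split; lra.
  have z1 : 1 < cabs z by lra.
  have z0 : z != 0 by rewrite -cabs_gt0; lra.
  have zd : cabs z^-1 < d.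
    rewrite cabsV -[ltRHS]invrK ltf_pV2 ?posrE//; last by lra.
    by lra.
  split => //; have [_ _ _ hc _] := hV zd.
  have gap : 1 <= cabs z - r0 by lra.
  have far n x : (M <= n)%N -> x \in s n -> cabs z - r0 <= cabs (z - x).
    move=> /hs[_ _ _ _ [hx _]] /hx xr; apply: le_trans (cabsBge _ _).
    by rewrite lerD2l lerN2.
  have zns n : (M <= n)%N -> z \notin s n.
    move=> Mn; apply/negP => /(far n z Mn); rewrite subrr cabs0; lra.
  have inv_le n x : (M <= n)%N -> x \in s n -> cabs (z - x)^-1 <= (cabs z - r0)^-1.
    move=> Mn xs; have g0 : 0 < cabs z - r0 by lra.
    have fx := far n x Mn xs; have zx0 := lt_le_trans g0 fx.
    by rewrite cabsV lef_pV2 ?posrE.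
  pose f n := (p n)^`().[z] / (l n * (p n).[z]).
  have fE n : (M <= n)%N -> f n = n%:R / l n * cauchy (s n) z.
    move=> Mn; have [[_ n0] sz l0 [b b0 pE] _] := hs n Mn.
    by rewrite /f pE logderivE ?zns ?sz.
  have [K K0 hK] := logderiv_near_curve Q z B1.
  have csum n : (M <= n)%N -> cabs (\sum_(x <- s n) (z - x)^-1) <= n%:R * (cabs z - r0)^-1.
    move=> Mn; have [_ sz _ _ _] := hs n Mn; apply: le_trans (cabs_sum _ _ _) _.
    apply: (@le_trans _ _ (\sum_(x <- s n) (cabs z - r0)^-1)).
      by rewrite big_seq [leRHS]big_seq; apply: ler_sum => x; exact: inv_le.
    by rewrite big_const_seq count_predT iter_addr_0 sz mulr_natl.
  have gi : (cabs z - r0)^-1 <= 1 by rewrite invf_le1//; lra.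
  have gi0 : 0 <= (cabs z - r0)^-1 by rewrite invr_ge0; lra.
  have fB n : (M <= n)%N -> cabs (f n) <= B.
    move=> Mn; have [[_ n0] sz l0 _ [_ nl]] := hs n Mn.
    rewrite fE// cabsM cabs_div cabs_nat /cauchy sz [cabs (_^-1 * _)]cabsM cabsV cabs_nat.
    have n00 : 0 < n%:R :> R by rewrite ltr0n.
    rewrite -[leRHS]mulr1; apply: ler_pM => //.
    + by rewrite divr_ge0 ?cabs_ge0.
    + by rewrite mulr_ge0 ?cabs_ge0 ?invr_ge0.
    + rewrite mulrC ler_pdivrMr// mul1r; apply: le_trans (csum n Mn) _.
      by rewrite ler_piMr.
  have sq n : (M <= n)%N -> sqsum (local_zeros (l n) z (s n)) <= B ^+ 2 / n%:R.
    move=> Mn; have [[_ n0] sz l0 _ [_ nl]] := hs n Mn.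
    have n00 : 0 < n%:R :> R by rewrite ltr0n.
    have cl0 : 0 < cabs (l n) by rewrite cabs_gt0.
    rewrite sqsum_local_zeros; apply: (@le_trans _ _ (cabs (l n) ^- 2 * n%:R)).
      rewrite ler_wpM2l ?invr_ge0 ?exprn_ge0 ?cabs_ge0//.
      apply: (@le_trans _ _ (\sum_(x <- s n) 1)).
        rewrite big_seq [leRHS]big_seq; apply: ler_sum => x xs.
        by rewrite exprn_ile1 ?cabs_ge0//; apply: le_trans (inv_le n x Mn xs) gi.
      by rewrite big_const_seq count_predT iter_addr_0 sz.
    rewrite ler_pdivlMr// -mulrA -expr2 mulrC -exprVn -exprMn.
    by apply: lerXn2r; rewrite ?nnegrE ?divr_ge0 ?cabs_ge0 ?(ltW B0).
  have uy n : (M <= n)%N -> cabs (n%:R / l n - y j) <= eps / 2 -> cabs (z * f n - y j) <= eps.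
    move=> Mn hn; have [[_ n0] sz l0 _ [hx nl]] := hs n Mn.
    have n00 : n%:R != 0 :> C by rewrite pnatr_eq0 -lt0n.
    (* z / (z - x) = 1 + x / (z - x), and the mean of the last term is small far
     away from the zeros. *)
  have -> : z * f n - y j = (n%:R / l n - y j) +
        (n%:R / l n) * (n%:R^-1 * \sum_(x <- s n) x * (z - x)^-1).
      rewrite fE// /cauchy sz.
      have e : z * \sum_(x <- s n) (z - x)^-1 = n%:R + \sum_(x <- s n) x * (z - x)^-1.
        have -> : n%:R = \sum_(x <- s n) (1 : C).
          by rewrite big_const_seq count_predT iter_addr_0 sz.
        rewrite mulr_sumr -big_split /= big_seq [RHS]big_seq; apply: eq_bigr => x xs.
        have zx : z - x != 0.
          by rewrite subr_eq0; apply/eqP => zx; have := zns n Mn; rewrite zx xs.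
        by field.
      rewrite (_ : z * _ = n%:R / l n * (n%:R^-1 * (z * \sum_(x <- s n) (z - x)^-1))); last by ring.
      by rewrite e; field; rewrite n00 l0.
    apply: le_trans (cabsD _ _) _; rewrite (splitr eps); apply: lerD => //.
    rewrite !cabsM !cabsV cabs_nat.
    apply: (@le_trans _ _ (B * (r0 * (cabs z - r0)^-1))).
      apply: ler_pM => //; rewrite ?divr_ge0 ?cabs_ge0 ?mulr_ge0 ?invr_ge0 ?cabs_ge0//.
      have n01 : 0 < n%:R :> R by rewrite ltr0n.
      rewrite mulrC ler_pdivrMr//; apply: le_trans (cabs_sum _ _ _) _.
      apply: (@le_trans _ _ (\sum_(x <- s n) r0 * (cabs z - r0)^-1)).
        rewrite big_seq [leRHS]big_seq; apply: ler_sum => x xs.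
        by rewrite cabsM; apply: ler_pM; rewrite ?cabs_ge0 ?hx ?(inv_le n x Mn xs).
      by rewrite big_const_seq count_predT iter_addr_0 sz mulr_natr.
    rewrite mulrA ler_pdivrMr; last by lra.
    by move: hz2; rewrite ltr_pdivrMr// => hz2; lra.
  apply: logderiv_limitI.
    exists 0%N => m _; have [_ _ l0 [b b0 pE] _] := hs _ (nuM m).
    by rewrite mulf_neq0// pE rootpoly_neq0// zns.
  move=> e e0; have e20 : 0 < eps / 2 by rewrite divr_gt0.
  have [M1 h1] := ly e20.
  have e30 : 0 < Num.min 1 (e * c / (K + 1)).
    by rewrite lt_min ltr01 divr_gt0 ?mulr_gt0//; lra.
  have [M2 h2] := inv_nat_small (B ^+ 2) e30.
  exists (maxn M1 M2) => m; rewrite geq_max => /andP[m1 m2].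
  have Mn := nuM m; set n := nu m in Mn *; rewrite -/(f n).
  have n1 : (M1 <= n)%N by apply: leq_trans m1 (nu_ge m).
  have n2 : (M2 <= n)%N by apply: leq_trans m2 (nu_ge m).
  have [l0 hl] := h1 n n1; have [n0 hn] := h2 n n2.
  have sqn := le_trans (sq n Mn) hn; move: sqn; rewrite le_min => /andP[sq1 sq2].
  have h3 := hc _ _ (uy n Mn hl).
  rewrite chart_curve// in h3.
  have [[Nn _] _ _ [b b0 pE] _] := hs n Mn.
  have h4 : cabs (\sum_(i < k.+1) (Q i).[z] * f n ^+ i) <= K * sqsum (local_zeros (l n) z (s n)).
    have := hK b (l n) (s n) b0 l0 (zns n Mn); rewrite /= -pE; apply => //; last exact: fB.
    exact: p_eig.
  have h5 : c * cabs (z * f n - V j z^-1) <= e * c.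
    apply: le_trans h3 _; apply: le_trans h4 _.
    apply: le_trans (ler_wpM2l K0 sq2) _.
    rewrite mulrA ler_pdivrMr; last by lra.
    by rewrite mulrC ler_wpM2l ?mulr_ge0 ?(ltW e0) ?(ltW c0)// lerDl.
  have -> : f n - V j z^-1 / z = (z * f n - V j z^-1) / z by field.
  rewrite cabs_div ler_pdivrMr; last by lra.
  have h6 : cabs (z * f n - V j z^-1) <= e by rewrite -(ler_pM2l c0) [c * e]mulrC.
  by apply: le_trans h6 _; rewrite ler_peMr ?(ltW e0)// ltW.
- apply: ae_complexW hae => xy [L' hL']; set z := cplx xy in hL' *.
  pose f n := (p n)^`().[z] / (l n * (p n).[z]).
  have fE q : z \notin s (nu q) -> f (nu q) = (nu q)%:R / l (nu q) * cauchy (s (nu q)) z.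
    move=> zq; have [[_ n0] sz l0 [b b0 pE] _] := hs _ (nuM q).
    by rewrite /f pE logderivE// sz.
  have flim e : 0 < e -> exists Q1, forall q, (Q1 <= q)%N -> cabs (f (nu q) - y j * L') <= e.
    move=> e0; pose D := 2 * (cabs L' + 1 + cabs (y j) + 1).
    have L0 := cabs_ge0 L'; have Y0 := cabs_ge0 (y j).
    have D0 : 0 < D by rewrite /D; lra.
    have t0 : 0 < Num.min 1 (e / D) by rewrite lt_min ltr01 divr_gt0.
    have [Q1 h1] := hL' _ t0; have [M1 h2] := ly t0.
    exists (maxn Q1 M1) => q; rewrite geq_max => /andP[q1 q2].
    have [zq hc _] := h1 q q1; have [_ hl] := h2 (nu q) (leq_trans q2 (nu_ge q)).
    move: hc hl; rewrite !le_min => /andP[hc1 hc2] /andP[_ hl2].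
    rewrite fE//; set w := cauchy _ _ in hc1 hc2 *; set t := _ / l _ in hl2 *.
    rewrite (_ : t * w - _ = (t - y j) * w + y j * (w - L')); last by ring.
    apply: le_trans (cabsD _ _) _.
    rewrite (cabsM (t - y j)) (cabsM (y j)).
    have wB : cabs w <= cabs L' + 1.
      by rewrite -[w](subrK L') addrC; apply: le_trans (cabsD _ _) _; rewrite lerD2l.
    have eD : e / D * D = e by rewrite mulfVK// lt0r_neq0.
    have eD0 : 0 <= e / D by rewrite divr_ge0 ?ltW.
    have h3 : cabs (t - y j) * cabs w <= e / D * (cabs L' + 1).
      by apply: ler_pM; rewrite ?cabs_ge0.
    have h4 : cabs (y j) * cabs (w - L') <= cabs (y j) * (e / D) by apply: ler_wpM2l.
    apply: le_trans (lerD h3 h4) _; rewrite -[leRHS]eD; move: (e / D) eD0 => x x0.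
    by rewrite [cabs (y j) * x]mulrC -mulrDr ler_wpM2l// /D; lra.
  (* The logarithmic derivative is n/l times the Cauchy transform, and n/l tends
     to y_j. *)
  exists (y j * L').
    apply: logderiv_limitI; last exact: flim.
    have [Q1 h1] := hL' 1 ltr01; exists Q1 => q /h1[zq _ _].
    have [_ _ l0 [b b0 pE] _] := hs _ (nuM q).
    by rewrite mulf_neq0// pE rootpoly_neq0.
  set L := y j * L' in flim *.
  pose P : {poly C} := \poly_(i < k.+1) (Q (inord i)).[z].
  have PE w : P.[w] = \sum_(i < k.+1) (Q i).[z] * w ^+ i.
    by rewrite horner_poly; apply: eq_bigr => i _; rewrite inord_val.
  rewrite /plane_curve -PE; apply/eqP/negPn/negP => PL.
  have PL0 : 0 < cabs P.[L] by rewrite cabs_gt0.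
  have PL4 : 0 < cabs P.[L] / 4 by rewrite divr_gt0.
  have [d1 d10 hd1] := horner_close P L PL4.
  have B2 : 1 <= cabs L + 1 by rewrite lerDr cabs_ge0.
  have [K K0 hK] := logderiv_near_curve Q z B2.
  have t0 : 0 < Num.min 1 (d1 / 2) by rewrite lt_min ltr01 divr_gt0.
  have u0 : 0 < Num.min 1 (cabs P.[L] / 4 / (K + 1)) / B ^+ 2.
    by rewrite divr_gt0 ?exprn_gt0// lt_min ltr01 divr_gt0//; lra.
  have [Q1 h1] := flim _ t0; have [Q2 h2] := hL' _ u0.
  pose q := maxn Q1 Q2.
  have := h1 q (leq_maxl _ _); rewrite le_min => /andP[f1 f2].
  have [zq _ hsum] := h2 q (leq_maxr _ _).
  have [[Nn n0] sz l0 [b b0 pE] [_ nl]] := hs _ (nuM q).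
  set n := nu q in f1 f2 zq hsum Nn n0 sz l0 pE nl.
  have n00 : 0 < n%:R :> R by rewrite ltr0n.
  have hsq : sqsum (local_zeros (l n) z (s n)) <= Num.min 1 (cabs P.[L] / 4 / (K + 1)).
    rewrite sqsum_local_zeros; move: hsum; rewrite ler_pdivlMr ?exprn_gt0//.
    move=> hm; apply: le_trans hm; set S := \sum_(x <- s n) _.
    have S0 : 0 <= S by apply: sumr_ge0 => x _; rewrite exprn_ge0 ?cabs_ge0.
    have cl0 : 0 < cabs (l n) by rewrite cabs_gt0.
    have h : (n%:R / cabs (l n)) ^+ 2 <= B ^+ 2.
      by apply: lerXn2r; rewrite ?nnegrE ?divr_ge0 ?cabs_ge0 ?(ltW B0).
    have e : cabs (l n) ^- 2 * S = n%:R ^- 2 * S * (n%:R / cabs (l n)) ^+ 2.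
      by field; rewrite ?(lt0r_neq0 n00) ?(lt0r_neq0 cl0).
    by rewrite e; apply: ler_wpM2l => //; rewrite mulr_ge0 ?invr_ge0 ?exprn_ge0.
  move: hsq; rewrite le_min => /andP[sq1 sq2].
  have fB : cabs (f n) <= cabs L + 1.
    by rewrite -[f n](subrK L) addrC; apply: le_trans (cabsD _ _) _; rewrite lerD2l.
  have h4 : cabs P.[f n] <= K * sqsum (local_zeros (l n) z (s n)).
    rewrite PE; have := hK b (l n) (s n) b0 l0 zq; rewrite /= -pE; apply => //.
    exact: p_eig.
  have h5 : cabs P.[f n] <= cabs P.[L] / 4.
    apply: le_trans h4 _; apply: le_trans (ler_wpM2l K0 sq2) _.
    rewrite mulrA ler_pdivrMr; last by lra.
    by rewrite mulrC ler_wpM2l ?(ltW PL4)// lerDl.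
  have fd : cabs (f n - L) < d1 by lra.
  have h6 := hd1 _ fd; have := cabsBge P.[L] P.[f n]; rewrite cabsC; lra.
Qed.
End OneBranch.
End Assembly.

Section CharacteristicRoots.
Variable R : realType.
Local Notation C := R[i].
Variables (k : nat) (Q : 'I_k.+1 -> {poly C}) (alpha : 'I_k -> C).
Hypothesis hgen : general_type Q.
Hypothesis alpha_inj : injective alpha.
Hypothesis alpha_root : forall j : 'I_k, root (characteristic Q) (alpha j).

Let a := (Q ord_max)`_k.

Lemma top_coef_neq0 : a != 0.
Proof.
have [sz _] := hgen; have <- : lead_coef (Q ord_max) = a by rewrite lead_coefE sz.
by rewrite lead_coef_eq0 -size_poly_eq0 sz.
Qed.

Lemma alpha_neq0 j : alpha j != 0.
Proof.
apply/eqP => aj0; have /rootP := alpha_root j.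
rewrite aj0 horner_sum big_ord_recr /= big1 => [|i _].
  by rewrite add0r subnn hornerZ hornerXn expr0 mulr1; apply/eqP; exact: top_coef_neq0.
by rewrite hornerZ hornerXn expr0n subn_eq0 leqNgt ltn_ord mulr0.
Qed.

Lemma inv_alpha_inj : injective (fun j => (alpha j)^-1).
Proof. by move=> i j /invr_inj/alpha_inj. Qed.

(** The reciprocals of the characteristic roots are the slopes at infinity. *)
Lemma slopes_factor :
  \sum_(i < k.+1) (Q i)`_i *: 'X^i = a *: \prod_(j < k) ('X - ((alpha j)^-1)%:P).
Proof.
pose chi := \poly_(i < k.+1) (Q (inord i))`_i.
have chiE : \sum_(i < k.+1) (Q i)`_i *: 'X^i = chi.
  by rewrite /chi poly_def; apply: eq_bigr => i _; rewrite inord_val.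
have ck : chi`_k = a.
  by rewrite coef_poly ltnSn /a (_ : inord k = ord_max)//; apply: val_inj; rewrite /= inordK.
have sz : size chi = k.+1.
  apply/eqP; rewrite eqn_leq size_poly /= ltnNge; apply/negP => /leq_sizeP/(_ k (leqnn _)).
  by rewrite ck; apply/eqP; exact: top_coef_neq0.
rewrite chiE (@all_roots_prod_XsubC _ chi [seq (alpha j)^-1 | j <- enum 'I_k]).
- by rewrite lead_coefE sz ck big_map big_enum.
- by rewrite sz size_map size_enum_ord.
- apply/allP => _ /mapP[j _ ->]; apply/rootP; rewrite -chiE.
  have /rootP := alpha_root j; rewrite !horner_sum => h.
  apply: (mulfI (expf_neq0 k (alpha_neq0 j))); rewrite mulr0 -[RHS]h mulr_sumr.
  apply: eq_bigr => i _; have ik : (i <= k)%N by rewrite -ltnS.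
  rewrite !hornerZ !hornerXn mulrCA; congr (_ * _).
  have -> : alpha j ^+ k = alpha j ^+ (k - i) * alpha j ^+ i by rewrite -exprD subnK.
  by rewrite exprVn mulfK// expf_neq0// alpha_neq0.
- by rewrite uniq_rootsE map_inj_uniq ?enum_uniq//; exact: inv_alpha_inj.
Qed.

(** A real ratio would put two characteristic roots on one line through the
    origin. *)
Lemma slopes_nonreal (j m : 'I_k) : m != j -> complex.Im ((alpha m)^-1 / (alpha j)^-1) != 0.
Proof.
move=> mj; apply/eqP => im0; have [_ hline] := hgen.
have am : alpha m != alpha j by rewrite (inj_eq alpha_inj).
rewrite invrK mulrC in im0.
apply: (hline (alpha j) (alpha m)) => //; first by rewrite eq_sym.
exists (alpha m); first exact: alpha_neq0.
exists (complex.Re (alpha j / alpha m)), 1; rewrite mul1r; split => //.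
rewrite -[LHS](mulfVK (alpha_neq0 m)); congr (_ * _).
by case: (alpha j / alpha m) im0 => u v /= ->.
Qed.

Lemma ratio_inv_lim (l : nat -> C) (j : 'I_k) :
  (fun n : nat => l n / n%:R : C^o) @ \oo --> (alpha j : C^o) ->
  forall e : R, 0 < e -> exists M, forall n, (M <= n)%N ->
    l n != 0 /\ cabs (n%:R / l n - (alpha j)^-1) <= e.
Proof.
move=> hl e e0; have aj := alpha_neq0 j.
have hv := @cvgV _ _ \oo eventually_filter _ _ aj hl.
have [M1 _ h1] := (cvg_cabsP eventually_filter _ _).1 hv e e0.
have ca : 0 < cabs (alpha j) / 2 by rewrite divr_gt0 ?cabs_gt0.
have [M2 _ h2] := (cvg_cabsP eventually_filter _ _).1 hl _ ca.
exists (maxn M1 M2) => n; rewrite geq_max => /andP[n1 n2]; split.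
  apply/eqP => l0; have := h2 n n2; rewrite /= l0 mul0r sub0r cabsN.
  by have := cabs_gt0 (alpha j); rewrite aj; lra.
by have := h1 n n1; rewrite /= invf_div.
Qed.
End CharacteristicRoots.

Theorem theorem1 (R : realType) (k : nat) (Q : 'I_k.+1 -> {poly R[i]})
  (hQ : homogenized_pencil Q)
  (hgen : general_type Q)
  (alpha : 'I_k -> R[i])
  (alpha_inj : injective alpha)
  (alpha_root : forall j : 'I_k, root (characteristic Q) (alpha j))
  (N : nat)
  (lambda : nat -> 'I_k -> R[i])
  (lambda_inj : forall n : nat, (N <= n)%N -> injective (lambda n))
  (lambda_eig : forall n : nat, (N <= n)%N -> forall l : R[i],
     eigenvalue_of_degree Q n l <-> exists j : 'I_k, l = lambda n j)
  (lambda_lim : forall j : 'I_k,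
     (fun n : nat => lambda n j / n%:R : R[i]^o) @ \oo --> (alpha j : R[i]^o))
  (p : nat -> 'I_k -> {poly R[i]})
  (p_deg : forall (n : nat) (j : 'I_k), (N <= n)%N -> size (p n j) = n.+1)
  (p_eig : forall (n : nat) (j : 'I_k), (N <= n)%N ->
     eigenpolynomial Q (lambda n j) (p n j)) :
  exists (nu : 'I_k -> nat -> nat) (Psi : 'I_k -> R[i] -> R[i]),
    (forall j : 'I_k,
      [/\ {homo nu j : m1 m2 / (m1 < m2)%N},
          (forall m : nat, (0 < nu j m)%N && (N <= nu j m)%N),
          ae_complex (fun z => logderiv_limit
            (fun m => lambda (nu j m) j) (fun m => p (nu j m) j) z (Psi j z)),
          near_infinity (fun z => logderiv_limit
            (fun m => lambda (nu j m) j) (fun m => p (nu j m) j) z (Psi j z)) /\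
          analytic_near_infinity (Psi j)
        & ae_complex (fun z => plane_curve Q z (Psi j z))]) /\
    independent_sections_near_infinity Q Psi.
Proof.
have a0 := top_coef_neq0 hgen.
have an0 := alpha_neq0 hgen alpha_root.
have yinj := inv_alpha_inj alpha_inj.
have hchi := slopes_factor hgen alpha_inj alpha_root.
have him := slopes_nonreal hgen alpha_inj alpha_root.
have hlim j := ratio_inv_lim hgen alpha_root (lambda_lim j).
have [V [eps [d [c [eps0 d0 c0 hV]]]]] := chart_branches a0 yinj hchi.
have /choice[nr hnr] : forall j, exists nr : (nat -> nat) * R, [/\ 0 < nr.2,
    {homo nr.1 : m1 m2 / (m1 < m2)%N},
    forall m, (0 < nr.1 m)%N && (N <= nr.1 m)%N,
    forall z, nr.2 < cabs z -> cabs z^-1 < d /\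
      logderiv_limit (fun m => lambda (nr.1 m) j) (fun m => p (nr.1 m) j) z (V j z^-1 / z) &
    ae_complex (fun z => exists2 L, logderiv_limit
      (fun m => lambda (nr.1 m) j) (fun m => p (nr.1 m) j) z L & plane_curve Q z L)].
  move=> j; destruct k as [|k']; first by case: j.
  have [|||||nu [r h]] := @branch_limit R k' Q (fun j => (alpha j)^-1) _ hQ a0 hchi j N
    (fun n => lambda n j) (fun n => p n j) _ _ _ _ _ V eps d c eps0 d0 c0 hV.
  - by rewrite invr_eq0 an0.
  - by move=> m mj; exact: him.
  - exact: hlim.
  - by move=> n; exact: p_deg.
  - by move=> n Nn; have [] := p_eig n j Nn.
  - by exists (nu, r).
(* The explicit branch is used near infinity, where the limit exists at every
   point; elsewhere any limit is taken when there is one. *)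
pose Lim j z : set R[i] := [set L | logderiv_limit (fun m => lambda ((nr j).1 m) j)
   (fun m => p ((nr j).1 m) j) z L /\ plane_curve Q z L].
pose Psi j z := if (nr j).2 < cabs z then V j z^-1 / z else xget 0 (Lim j z).
have curve j z : z != 0 -> cabs z^-1 < d -> plane_curve Q z (V j z^-1 / z).
  move=> z0 zd; have [_ fact _ _ _] := hV _ zd.
  rewrite /plane_curve -chart_curve// mulrC mulfVK// fact (bigD1 j)//=.
  by rewrite subrr mul0r mulr0.
have Psi_ae j : ae_complex (fun z => Lim j z (Psi j z)).
  have [r0 _ _ hinf hae] := hnr j; apply: ae_complexW hae => xy [L h1 h2].
  set z := cplx xy in h1 h2 *; rewrite /Psi; case: ifPn => [hz|_].
    have [zd hL] := hinf z hz; split => //; apply: curve => //.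
    by rewrite -cabs_gt0; apply: lt_trans hz.
  by apply: (@xgetI _ 0 (Lim j z) L).
have Psi_ana j : analytic_near_infinity (Psi j).
  exists (fun s => s * V j s); split.
    apply/near_cabsP; exists d => // s; rewrite subr0 => sd.
    exact: (branch_derivable d0 c0 hV sd).
  exists (nr j).2 => z; rewrite normE ltcR => hz.
  by rewrite /Psi hz mulrC.
exists (fun j => (nr j).1), Psi; split.
  move=> j; have [r0 h1 h2 hinf hae] := hnr j; split => //.
  - by apply: ae_complexW (Psi_ae j) => xy [].
  - split => //; exists (nr j).2 => z; rewrite normE ltcR => hz.
    by rewrite /Psi hz; have [] := hinf z hz.
  - by apply: ae_complexW (Psi_ae j) => xy [].
split => //; exists (d^-1 + \sum_j (nr j).2) => z; rewrite normE ltcR => hz.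
have rpos j : 0 < (nr j).2 by have [] := hnr j.
have sum0 : 0 <= \sum_j (nr j).2 by apply: sumr_ge0 => j _; exact: ltW.
have di : 0 < d^-1 by rewrite invr_gt0.
have hzj j : (nr j).2 < cabs z.
  apply: le_lt_trans hz; rewrite (bigD1 j)//= addrCA lerDl addr_ge0 ?(ltW di)//.
  by apply: sumr_ge0 => i _; exact: ltW.
have PsiE j : Psi j z = V j z^-1 / z by rewrite /Psi hzj.
have zp : 0 < cabs z by lra.
have z0 : z != 0 by rewrite -cabs_gt0.
have zd : cabs z^-1 < d.
  by rewrite cabsV -[ltRHS]invrK ltf_pV2 ?posrE//; lra.
have [l0 fact hne _ hclose] := hV _ zd.
split.
  move=> i j /=; rewrite !PsiE => /(mulIf _) e; apply/eqP/negPn/negP => ij.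
  have := hne (V j z^-1) j i (hclose j) ij; rewrite e ?eqxx//.
  by rewrite invr_eq0.
move=> w; rewrite /plane_curve -chart_curve// fact; split => [/eqP|[j ->]].
  rewrite mulf_eq0 (negbTE l0) /= => /prodf_eq0[j _]; rewrite subr_eq0 => /eqP e.
  by exists j; rewrite PsiE -e mulrC mulKf.
by rewrite PsiE (bigD1 j)//= [z * _]mulrC mulfVK// subrr mul0r mulr0.
Qed.
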